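(* Let $\Bbbk$ be a field and let $m,n\geq 1$ be integers. Let $Q$ be the quiver with two vertices $1,2$ and three arrows: a loop $a$ at vertex $1$, a loop $b$ at vertex $2$, and an arrow $c\colon 1\to 2$. Let $\Lambda(m,n)=\Bbbk Q/I$, where $I$ is the two-sided ideal generated by the relations $$a^m,\quad b^n,\quad ca-bc,\quad b^2c$$ (paths are composed right to left, so $ca$ means first $a$, then $c$). Then the algebra $\Lambda(m,n)$ is of finite general representation type.
   Context: For an algebra $A=\Bbbk Q/I$ given by a quiver $Q=(Q_0,Q_1,t,h)$ with relations $R$ generating $I$, and a dimension vector $\mathbf d\colon Q_0\to\mathbb Z_{\geq 0}$, the representation variety is $$\operatorname{rep}_A(\mathbf d)=\Big\{M=(M_\alpha)_{\alpha\in Q_1}\in\prod_{\alpha\in Q_1}\operatorname{Mat}_{\mathbf d(h\alpha),\mathbf d(t\alpha)}(\Bbbk)\ \Big|\ M_r=0\text{ for all }r\in R\Big\},$$ where $M_r$ is obtained by evaluating the relation $r$ on the matrices of $M$. The group $GL(\mathbf d)=\prod_{z\in Q_0}GL(\mathbf d(z))$ acts by $g\cdot M=(g_{h\alpha}M_\alpha g_{t\alpha}^{-1})_{\alpha\in Q_1}$, and orbits correspond to isomorphism classes of representations of $A$ of dimension vector $\mathbf d$. Concretely, for $A=\Lambda(m,n)$ and $\mathbf d=(d_1,d_2)$, points are triples $(A,B,C)$ of matrices of sizes $d_1\times d_1$, $d_2\times d_2$, $d_2\times d_1$ with $A^m=0$, $B^n=0$, $CA=BC$, $B^2C=0$. If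 $\Bbbk$ is algebraically closed these are classical varieties; over a general field, $\operatorname{rep}_A(\mathbf d)$ is regarded as a scheme of finite type over $\Bbbk$ with the Zariski topology, and the orbit of a $\Bbbk$-rational point $M$ is the image of the orbit morphism $g\mapsto g\cdot M$. The algebra $A$ is of discrete general representation type if for every dimension vector $\mathbf d$, every irreducible component of $\operatorname{rep}_A(\mathbf d)$ has a dense $GL(\mathbf d)$-orbit. It is of finite general representation type if, in addition, there are only finitely many isomorphism classes (over all $\mathbf d$ together) of indecomposable representations whose orbit is dense in an irreducible component of the corresponding $\operatorname{rep}_A(\mathbf d)$. *)

(* Defs.v *)
From HB Require Import structures.
From mathcomp Require Import all_boot all_order all_algebra.
From mathcomp Require Import ring_quotient all_classical topology.
(* The notations of mpoly are incompatible with those of topology. *)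
From mathcomp Require Import -(notations) mpoly.

Set Implicit Arguments.
Unset Strict Implicit.
Unset Printing Implicit Defensive.

Import GRing.Theory.
Local Open Scope classical_set_scope.
Local Open Scope ring_scope.

Definition Spec (R : comNzRingType) : Type := prime_idealr R.

HB.instance Definition _ (R : comNzRingType) := gen_eqMixin (Spec R).
HB.instance Definition _ (R : comNzRingType) := gen_choiceMixin (Spec R).

Section Zariski.
Variable R : comNzRingType.
Implicit Types (E : set R) (P : prime_idealr R).

Definition zero_locus E : set (Spec R) :=
  [set P : prime_idealr R | forall f, E f -> f \in (P : pred R)].

Definition zariski_open (U : set (Spec R)) : Prop :=
  exists E, U = ~` zero_locus E.

Lemma zariski_openT : zariski_open setT.
Proof.
exists setT; apply/esym/seteqP; split => // P _ PT.
by have := PT 1 I; rewrite idealr1.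
Qed.

Lemma zariski_openI : setI_closed zariski_open.
Proof.
move=> _ _ [E ->] [F ->].
exists [set h | exists f g, [/\ E f, F g & h = f * g]].
rewrite -setCU; congr (~` _); apply/seteqP; split => P.
  case=> HP h [f [g [Ef Fg ->]]]; rewrite prime_idealrM.
    by rewrite (HP f Ef).
  by rewrite (HP g Fg) orbT.
move=> HP; have [HE|/existsNP[f /not_implyP[Ef /negP nf]]] :=
  pselect (zero_locus E P); first by left.
right=> g Fg; have := HP (f * g); rewrite prime_idealrM (negPf nf); apply.
by exists f, g.
Qed.

Lemma zariski_open_bigU (J : Type) (f : J -> set (Spec R)) :
  (forall i, zariski_open (f i)) -> zariski_open (\bigcup_i f i).
Proof.
move=> /choice[E fE]; exists (\bigcup_i E i).
have -> : f = fun i => ~` zero_locus (E i) by apply/funext.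
rewrite -setC_bigcap; congr (~` _); apply/seteqP; split => P.
  by move=> HP g [i _ Eg]; apply: (HP i I).
by move=> HP i _ g Eg; apply: HP; exists i.
Qed.

HB.instance Definition _ := @isOpenTopological.Build (Spec R) zariski_open
  zariski_openT zariski_openI zariski_open_bigU.

End Zariski.

Section SpecMap.
Variables (R S : comNzRingType) (phi : {rmorphism R -> S}) (P : Spec S).

Let preim : pred R := fun f => phi f \in (P : pred S).

Let preimE f : (f \in preim) = (phi f \in (P : pred S)).
Proof. by []. Qed.

Lemma spec_preim_idealr : idealr_closed preim.
Proof.
split; first by rewrite preimE rmorph0 idealr0.
  by rewrite preimE rmorph1 idealr1.
move=> a u v; rewrite !preimE rmorphD rmorphM => Pu Pv.
by rewrite rpredD ?idealMr.
Qed.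

Lemma spec_preim_prime : prime_idealr_closed preim.
Proof. by move=> u v; rewrite !preimE rmorphM prime_idealrM. Qed.

Definition spec_map : Spec R :=
  HB.pack_for (prime_idealr R) (preim : R -> bool)
    (isIdealr.Build R preim spec_preim_idealr)
    (isPrimeIdealrClosed.Build R preim spec_preim_prime).

End SpecMap.

Definition irreducible_set (T : topologicalType) (Z : set T) : Prop :=
  Z !=set0 /\
  forall A B : set T, closed A -> closed B ->
    Z `<=` A `|` B -> Z `<=` A \/ Z `<=` B.

Definition irreducible_component (T : topologicalType) (X Z : set T) : Prop :=
  [/\ Z `<=` X, irreducible_set Z &
      forall W : set T, W `<=` X -> irreducible_set W -> Z `<=` W -> W = Z].

Definition dense_in (T : topologicalType) (O Z : set T) : Prop :=
  O `<=` Z /\ Z `<=` closure O.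

Record quiver := Quiver {
  vertex : finType;
  arrow : finType;
  arrow_tail : arrow -> vertex;
  arrow_head : arrow -> vertex }.

(* [arrow_path a p] is the path "first p, then a", written a p. *)
Inductive qpath (Q : quiver) (x : vertex Q) : vertex Q -> Type :=
  | trivial_path : qpath x x
  | arrow_path (a : arrow Q) of qpath x (arrow_tail a) : qpath x (arrow_head a).

Record relation (k : fieldType) (Q : quiver) := Relation {
  source : vertex Q;
  target : vertex Q;
  terms : seq (k * qpath source target) }.

Record bound_quiver (k : fieldType) := BoundQuiver {
  bquiver :> quiver;
  relations : set (relation k bquiver) }.

Definition dim_vector (Q : quiver) := vertex Q -> nat.

Definition rep_space (Q : quiver) (R : Type) (d : dim_vector Q) : Type :=
  forall a : arrow Q, 'M[R]_(d (arrow_head a), d (arrow_tail a)).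

Section Evaluation.
Variables (k : fieldType) (Q : quiver) (R : comNzRingType) (iota : k -> R).
Variables (d : dim_vector Q) (M : rep_space R d).

Fixpoint path_eval (x y : vertex Q) (p : qpath x y) : 'M[R]_(d y, d x) :=
  match p in qpath _ z return 'M[R]_(d z, d x) with
  | trivial_path => 1%:M
  | arrow_path a p' => M a *m path_eval p'
  end.

Definition relation_eval (r : relation k Q) :
    'M[R]_(d (target r), d (source r)) :=
  \sum_(cp <- terms r) iota cp.1 *: path_eval cp.2.

End Evaluation.

Section Representations.
Variables (k : fieldType) (A : bound_quiver k).

Definition is_rep (d : dim_vector A) (M : rep_space k d) : Prop :=
  forall r, relations r -> relation_eval id M r = 0.

Definition isomorphic (d e : dim_vector A)
    (M : rep_space k d) (N : rep_space k e) : Prop :=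
  exists (f : forall z, 'M[k]_(e z, d z)) (g : forall z, 'M[k]_(d z, e z)),
    [/\ forall a, f (arrow_head a) *m M a = N a *m f (arrow_tail a),
        forall z, g z *m f z = 1%:M &
        forall z, f z *m g z = 1%:M].

Definition direct_sum (d e : dim_vector A)
    (M : rep_space k d) (N : rep_space k e) :
    rep_space k ((fun z => d z + e z)%N : dim_vector A) :=
  fun a => block_mx (M a) 0 0 (N a).

Definition zero_dim (d : dim_vector A) : Prop := forall z, d z = 0%N.

Definition indecomposable (d : dim_vector A) (M : rep_space k d) : Prop :=
  ~ zero_dim d /\
  forall (d1 d2 : dim_vector A) (M1 : rep_space k d1) (M2 : rep_space k d2),
    is_rep M1 -> is_rep M2 -> isomorphic M (direct_sum M1 M2) ->
    zero_dim d1 \/ zero_dim d2.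

End Representations.

Section RepresentationScheme.
Variables (k : fieldType) (A : bound_quiver k) (d : dim_vector A).

Definition rep_coord : finType :=
  {a : arrow A & ('I_(d (arrow_head a)) * 'I_(d (arrow_tail a)))%type}.

Definition rep_entry (R : Type) (M : rep_space R d) (c : rep_coord) : R :=
  M (tag c) (tagged c).1 (tagged c).2.

Definition rep_ring : comNzRingType := mpoly #|rep_coord| k.

Definition generic_rep : rep_space rep_ring d :=
  fun a => \matrix_(i, j) mpolyX k (mnm1 (enum_rank
    (Tagged (fun a => ('I_(d (arrow_head a)) * 'I_(d (arrow_tail a)))%type) (i, j)
      : rep_coord))).

(* The underlying space of rep_A(d), as a closed subset of affine space: the
   closed subscheme is cut out by the entries of M_r for the generic M. *)
Definition rep_scheme : set (Spec rep_ring) :=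
  zero_locus [set f | exists r, relations r /\
    exists i j, f = relation_eval (@mpolyC _ k) generic_rep r i j].

Definition gl_coord : finType :=
  {z : vertex A & ('I_(d z) * 'I_(d z))%type}.

Definition gl_ring : comNzRingType := mpoly (#|gl_coord| + #|gl_coord|)%N k.

(* GL(d) is presented as the closed subscheme g g' = g' g = 1 of the affine
   space of pairs (g, g') of families of square matrices, so that
   k[GL(d)] is the quotient of [gl_ring] by these equations. *)
Definition generic_gl (z : vertex A) : 'M[gl_ring]_(d z) :=
  \matrix_(i, j) mpolyX k (mnm1 (lshift _ (enum_rank
    (Tagged (fun z => ('I_(d z) * 'I_(d z))%type) (i, j) : gl_coord)))).

Definition generic_gl_inv (z : vertex A) : 'M[gl_ring]_(d z) :=
  \matrix_(i, j) mpolyX k (mnm1 (rshift _ (enum_rank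
    (Tagged (fun z => ('I_(d z) * 'I_(d z))%type) (i, j) : gl_coord)))).

Definition gl_scheme : set (Spec gl_ring) :=
  zero_locus [set f | exists z i j,
    f = (generic_gl z *m generic_gl_inv z - 1%:M) i j \/
    f = (generic_gl_inv z *m generic_gl z - 1%:M) i j].

Variable M : rep_space k d.

Definition generic_translate : rep_space gl_ring d :=
  fun a => generic_gl (arrow_head a) *m map_mx (@mpolyC _ k) (M a)
           *m generic_gl_inv (arrow_tail a).

Definition orbit_comorphism : {rmorphism rep_ring -> gl_ring} :=
  comp_mpoly [tuple rep_entry generic_translate (enum_val i)
             | i < #|rep_coord|].

Definition rep_orbit : set (Spec rep_ring) :=
  spec_map orbit_comorphism @` gl_scheme.

End RepresentationScheme.

Arguments rep_scheme {k A} d _.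

Section GeneralRepresentationType.
Variables (k : fieldType) (A : bound_quiver k).

Definition discrete_general_type : Prop :=
  forall (d : dim_vector A) (Z : set (Spec (rep_ring d))),
    irreducible_component (rep_scheme d) Z ->
    exists M : rep_space k d, is_rep M /\ dense_in (rep_orbit M) Z.

Definition general_rep (d : dim_vector A) (M : rep_space k d) : Prop :=
  is_rep M /\ exists Z : set (Spec (rep_ring d)),
    irreducible_component (rep_scheme d) Z /\ dense_in (rep_orbit M) Z.

Definition finite_general_type : Prop :=
  discrete_general_type /\
  exists (N : nat) (F : 'I_N -> {d : dim_vector A & rep_space k d}),
    forall (d : dim_vector A) (M : rep_space k d),
      indecomposable M -> general_rep M ->
      exists i, isomorphic M (projT2 (F i)).

End GeneralRepresentationType.

Inductive Lambda_vertex := vertex_1 | vertex_2.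
Inductive Lambda_arrow := arrow_a | arrow_b | arrow_c.

Definition Lambda_vertex_code (v : Lambda_vertex) : bool :=
  if v is vertex_1 then false else true.
Definition Lambda_vertex_decode (b : bool) : Lambda_vertex :=
  if b then vertex_2 else vertex_1.
Lemma Lambda_vertex_codeK : cancel Lambda_vertex_code Lambda_vertex_decode.
Proof. by case. Qed.
HB.instance Definition _ :=
  Finite.copy Lambda_vertex (can_type Lambda_vertex_codeK).

Definition Lambda_arrow_code (a : Lambda_arrow) : option bool :=
  match a with
  | arrow_a => Some false | arrow_b => Some true | arrow_c => None
  end.
Definition Lambda_arrow_decode (o : option bool) : Lambda_arrow :=
  match o with
  | Some false => arrow_a | Some true => arrow_b | None => arrow_c
  end.
Lemma Lambda_arrow_codeK : cancel Lambda_arrow_code Lambda_arrow_decode.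
Proof. by case. Qed.
HB.instance Definition _ :=
  Finite.copy Lambda_arrow (can_type Lambda_arrow_codeK).

Definition Lambda_tail (x : Lambda_arrow) : Lambda_vertex :=
  match x with
  | arrow_a => vertex_1 | arrow_b => vertex_2 | arrow_c => vertex_1
  end.
Definition Lambda_head (x : Lambda_arrow) : Lambda_vertex :=
  match x with
  | arrow_a => vertex_1 | arrow_b => vertex_2 | arrow_c => vertex_2
  end.

Definition Lambda_quiver : quiver := Quiver Lambda_tail Lambda_head.

Section Lambda_paths.
Variable x : vertex Lambda_quiver.

Definition then_a (p : qpath x vertex_1) : qpath x vertex_1 :=
  @arrow_path Lambda_quiver x arrow_a p.
Definition then_b (p : qpath x vertex_2) : qpath x vertex_2 :=
  @arrow_path Lambda_quiver x arrow_b p.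
Definition then_c (p : qpath x vertex_1) : qpath x vertex_2 :=
  @arrow_path Lambda_quiver x arrow_c p.

End Lambda_paths.

Definition Lambda_e1 : qpath _ _ := @trivial_path Lambda_quiver vertex_1.
Definition Lambda_e2 : qpath _ _ := @trivial_path Lambda_quiver vertex_2.

Definition Lambda (k : fieldType) (m n : nat) : bound_quiver k :=
  @BoundQuiver k Lambda_quiver
    [set Relation [:: (1, iter m (@then_a _) Lambda_e1)];
         Relation [:: (1, iter n (@then_b _) Lambda_e2)];
         Relation [:: (1, then_c (then_a Lambda_e1));
                      (-1, then_b (then_c Lambda_e1))];
         Relation [:: (1, then_b (then_b (then_c Lambda_e1)))]].

(* Main.v *)
Require Import Defs.
From HB Require Import structures.
From mathcomp Require Import all_boot all_order all_algebra.
From mathcomp Require Import zify generic_quotient ring_quotient all_classical topology.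
From mathcomp Require Import -(notations) mpoly.

(* A representation is a triple (A, B, C) with A and B nilpotent, CA = BC and B^2 C = 0;
   put A and B in Jordan form. If a column block of size at least 3 can be enlarged at
   the expense of another one of size at least 3, then A deforms, C being kept, to a
   matrix with the new Jordan type; likewise for the row blocks. Hence a general triple
   has at most one block size strictly between 2 and m (resp. 2 and n), with
   multiplicity one. For fixed A and B the admissible C form an affine space on which
   the commutant of (A, B) acts, and a finite list of 58 pieces suffices: every choice of
   block sizes is realised by a direct sum of pairwise "orthogonal" pieces, for which the
   tangent map (Y, X) |-> YC + CX is onto. The orbit of such a C is dense, because
   every line through C lies in the orbit to all orders.

   Orbit closures are handled through points over arbitrary fields: a function that
   vanishes on all points of the orbit of the sum of pieces vanishes on every
   representation of that type. Each component is then the closure of an orbit of a sum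
   of pieces. If M is indecomposable and its orbit is dense in the same component as
   that of a sum M', then the generic points of the two orbits agree over the residue
   field of the component, so M divides a power of M' over that field, hence over k;
   as End(M) is local, M is isomorphic to M', and so to one of finitely many pieces. *)

Set Implicit Arguments.
Unset Strict Implicit.
Unset Printing Implicit Defensive.

Import GRing.Theory.


(** * Block matrices and Jordan matrices *)

(** For fixed Jordan types the two surviving entries of each block of C behave like a linear
    polynomial in a variable of square zero, and so do the homomorphisms between Jordan blocks that
    act on them. The products that are used are governed by the order of the block sizes and by the
    sizes 1 and 2, never by m, n or the field; this reduces the theorem to one finite computation,
    valid in every characteristic. The list of pieces is justified by a descent: a weight modelled
    on the dimension of Ext^1 drops whenever two non-orthogonal pieces are replaced by orthogonal
    ones with the same blocks. The obstacle is that k may be finite, so that k-rational points need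
    not be dense in an orbit. Limits are therefore taken with a transcendental X, which is
    specialised to 0 for a transfer between Jordan blocks and to 1 for a line that ends in C; and
    since indecomposability is assumed over k only, homomorphisms are brought down from the
    extension to k by linear algebra. *)

Section FinMatrix.
Local Open Scope ring_scope.
Variable R : comNzRingType.

Definition fm (X Y : finType) (g : X -> Y -> R) : 'M[R]_(#|X|, #|Y|) :=
  \matrix_(i, j) g (enum_val i) (enum_val j).

Lemma fmE (X Y : finType) (g : X -> Y -> R) x y : fm g (enum_rank x) (enum_rank y) = g x y.
Proof. by rewrite mxE !enum_rankK. Qed.

Lemma fmP (X Y : finType) (A B : 'M[R]_(#|X|, #|Y|)) :
  (forall x y, A (enum_rank x) (enum_rank y) = B (enum_rank x) (enum_rank y)) -> A = B.
Proof.
move=> AB; apply/matrixP => i j.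
by rewrite -[i]enum_valK -[j]enum_valK.
Qed.

Lemma fm_mulE (X Y Z : finType) (A : 'M[R]_(#|X|, #|Y|)) (B : 'M[R]_(#|Y|, #|Z|)) x z :
  (A *m B) (enum_rank x) (enum_rank z) =
  \sum_y A (enum_rank x) (enum_rank y) * B (enum_rank y) (enum_rank z).
Proof.
rewrite mxE (reindex_onto enum_rank enum_val) /=; last by move=> i _; rewrite enum_valK.
by apply: eq_bigl => y; rewrite enum_rankK eqxx.
Qed.

Lemma fm1E (X : finType) (x y : X) :
  (1%:M : 'M[R]_#|X|) (enum_rank x) (enum_rank y) = (x == y)%:R.
Proof. by rewrite mxE (inj_eq enum_rank_inj). Qed.

(** The transition matrices are rectangular, so that sizes which are equal but not convertible, such
    as two numbers of block indices, need no cast. *)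
Definition sim (d e : nat) (A : 'M[R]_d) (B : 'M[R]_e) : Prop :=
  exists (P : 'M[R]_(e, d)) (Q : 'M[R]_(d, e)),
    [/\ P *m A = B *m P, Q *m P = 1%:M & P *m Q = 1%:M].

Lemma sim_refl d (A : 'M[R]_d) : sim A A.
Proof. by exists 1%:M, 1%:M; rewrite !mul1mx mulmx1. Qed.

Lemma sim_sym d e (A : 'M[R]_d) (B : 'M[R]_e) : sim A B -> sim B A.
Proof.
case=> P [Q [PA QP PQ]]; exists Q, P; split=> //.
by rewrite -[Q *m B]mulmx1 -PQ -!mulmxA [B *m _]mulmxA -PA !mulmxA QP mul1mx.
Qed.

Lemma sim_trans d e f (A : 'M[R]_d) (B : 'M[R]_e) (C : 'M[R]_f) :
  sim A B -> sim B C -> sim A C.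
Proof.
case=> P [Q [PA QP PQ]] [P' [Q' [PB QP' PQ']]]; exists (P' *m P), (Q *m Q'); split.
- by rewrite -mulmxA PA !mulmxA PB.
- by rewrite mulmxA -[_ *m P']mulmxA QP' mulmx1.
- by rewrite mulmxA -[_ *m Q]mulmxA PQ mulmx1.
Qed.

Lemma sim_block d e d' e' (A : 'M[R]_d) (B : 'M[R]_e) (A' : 'M[R]_d') (B' : 'M[R]_e') :
  sim A B -> sim A' B' -> sim (block_mx A 0 0 A') (block_mx B 0 0 B').
Proof.
case=> P [Q [PA QP PQ]] [P' [Q' [PB QP' PQ']]].
exists (block_mx P 0 0 P'), (block_mx Q 0 0 Q').
by rewrite !mulmx_block !(mulmx0, mul0mx, addr0, add0r) PA PB QP QP' PQ PQ' -!scalar_mx_block.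
Qed.

Lemma sim_tr d e (A : 'M[R]_d) (B : 'M[R]_e) : sim A B -> sim A^T B^T.
Proof.
case=> P [Q [PA QP PQ]]; apply: sim_sym; exists P^T, Q^T.
by rewrite -!trmx_mul PA QP PQ !trmx1.
Qed.

Lemma sim_bij d e (A : 'M[R]_d) (B : 'M[R]_e) (f : 'I_e -> 'I_d) (g : 'I_d -> 'I_e) :
  cancel f g -> cancel g f -> (forall i j, B i j = A (f i) (f j)) -> sim A B.
Proof.
move=> fK gK BA; exists (\matrix_(i, j) (f i == j)%:R), (\matrix_(i, j) (g i == j)%:R).
have pick (n : nat) (x : 'I_n) (F : 'I_n -> R) : \sum_i (x == i)%:R * F i = F x.
  rewrite (bigD1 x) //= eqxx mul1r big1 ?addr0 // => i; rewrite eq_sym.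
  by move=> /negPf->; rewrite mul0r.
split; apply/matrixP => i j; rewrite !mxE.
- under eq_bigr do rewrite mxE; rewrite pick.
  under eq_bigr do rewrite mxE (can2_eq fK gK) eq_sym mulrC.
  by rewrite pick BA gK.
- by under eq_bigr do rewrite !mxE; rewrite pick gK.
- by under eq_bigr do rewrite !mxE; rewrite pick fK.
Qed.

End FinMatrix.

Section BlockIndex.
Variables (R : comNzRingType) (I : finType).
Implicit Type a : I -> nat.

Definition bix a : finType := {i : I & 'I_(a i)}.

Definition pos a (x : bix a) : nat := tagged x.

Lemma pos_lt a (x : bix a) : pos x < a (tag x).
Proof. exact: ltn_ord. Qed.

Lemma bix_eq a (x y : bix a) : (x == y) = (tag x == tag y) && (pos x == pos y).
Proof.
case: x y => [i p] [j q]; rewrite /pos /=.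
have [eq_ij|neq_ij] := eqVneq i j; last first.
  by apply/negbTE; apply: contraNneq neq_ij => /(congr1 tag) /= ->.
by subst j; rewrite eq_Tagged.
Qed.

Definition ix a i p (lt_p : p < a i) : bix a := Tagged (fun i => 'I_(a i)) (Ordinal lt_p).

Lemma sum_bix a (F : I -> nat -> R) :
  (\sum_(x : bix a) F (tag x) (pos x) = \sum_i \sum_(p < a i) F i p)%R.
Proof. by rewrite (sig_big_dep _ _ (fun i (p : 'I_(a i)) => F i p)). Qed.

Lemma card_bix a : #|bix a| = \sum_i a i.
Proof.
rewrite card_tagged sumnE big_map big_enum /=.
by apply: eq_bigr => i _; rewrite card_ord.
Qed.

End BlockIndex.

Section Entries.
Variable R : comNzRingType.

Lemma sum_pick n (F : nat -> R) k : (forall r, r != k -> F r = 0%R) ->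
  (\sum_(r < n) F r = if (k < n)%N then F k else 0)%R.
Proof.
move=> F0; case: ifP => [lt_kn|/negbT nlt].
  rewrite (bigD1 (Ordinal lt_kn)) //= big1 ?addr0 // => r neq.
  by apply: F0; apply: contraNneq neq => eq_rk; apply/eqP/val_inj.
rewrite big1 // => r _; apply: F0; apply: contraNneq nlt => <-; exact: ltn_ord.
Qed.

Lemma sum_pick_ord n (F : nat -> R) k : (forall r, r < n -> r != k -> F r = 0%R) ->
  (\sum_(r < n) F r = if (k < n)%N then F k else 0)%R.
Proof.
move=> F0; rewrite (eq_bigr (fun r : 'I_n => if (r < n)%N then F r else 0%R)); last first.
  by move=> r _; rewrite ltn_ord.
rewrite (sum_pick (F := fun r => if r < n then F r else 0%R) _ (k := k)).
  by case: (ltnP k n).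
by move=> r; case: ifP => // lt_rn; exact: F0.
Qed.

Lemma sum_pick_fin (I : finType) (F : I -> R) k : (forall i, i != k -> F i = 0%R) ->
  (\sum_i F i = F k)%R.
Proof. by move=> F0; rewrite (bigD1 k) //= big1 ?addr0. Qed.

Variables (I I' : finType) (a : I -> nat) (b : I' -> nat).

Implicit Types (A B : 'M[R]_(#|bix b|, #|bix a|)).

(* The value is 0 outside the blocks. *)
Definition ent (A : 'M[R]_(#|bix b|, #|bix a|)) (i : I') (p : nat) (j : I) (q : nat) : R :=
  if insub p is Some p' then
    if insub q is Some q' then
      A (enum_rank (existT (fun i => 'I_(b i)) i p' : bix b))
        (enum_rank (existT (fun j => 'I_(a j)) j q' : bix a))
    else 0%R
  else 0%R.

Definition blk (F : I' -> nat -> I -> nat -> R) : 'M[R]_(#|bix b|, #|bix a|) :=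
  fm (fun x y => F (tag x) (pos x) (tag y) (pos y)).

Lemma ent_big A i p j q : (b i <= p) || (a j <= q) -> ent A i p j q = 0%R.
Proof.
rewrite /ent; case: insubP => // p' lt_p _; case: insubP => // q' lt_q _.
by rewrite leqNgt lt_p leqNgt lt_q.
Qed.

Lemma entE A (x : bix b) (y : bix a) :
  A (enum_rank x) (enum_rank y) = ent A (tag x) (pos x) (tag y) (pos y).
Proof.
case: x y => i p [j q]; rewrite /ent /pos /=.
case: insubP => [p' _ /val_inj->|]; last by rewrite ltn_ord.
by case: insubP => [q' _ /val_inj->|]; last by rewrite ltn_ord.
Qed.

Lemma entP A B : (forall i p j q, p < b i -> q < a j -> ent A i p j q = ent B i p j q) -> A = B.
Proof. by move=> AB; apply: fmP => x y; rewrite !entE AB ?pos_lt. Qed.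

Lemma ent_ix A i p j q (lt_p : p < b i) (lt_q : q < a j) :
  ent A i p j q = A (enum_rank (ix lt_p)) (enum_rank (ix lt_q)).
Proof. by rewrite entE. Qed.

Lemma ent_blk F i p j q : p < b i -> q < a j -> ent (blk F) i p j q = F i p j q.
Proof. by move=> lt_p lt_q; rewrite (ent_ix _ lt_p lt_q) fmE. Qed.

Lemma entD A B i p j q : ent (A + B)%R i p j q = (ent A i p j q + ent B i p j q)%R.
Proof.
rewrite /ent; case: insubP => [? _ _|_]; last by rewrite addr0.
by case: insubP => [? _ _|_]; rewrite ?addr0 // mxE.
Qed.

Lemma entZ c A i p j q : ent (c *: A)%R i p j q = (c * ent A i p j q)%R.
Proof.
rewrite /ent; case: insubP => [? _ _|_]; last by rewrite mulr0.
by case: insubP => [? _ _|_]; rewrite ?mulr0 // mxE.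
Qed.

Lemma ent0 i p j q : ent 0%R i p j q = 0%R.
Proof. by rewrite /ent; case: insubP => // ? _ _; case: insubP => // ? _ _; rewrite mxE. Qed.

End Entries.

Section Products.
Variables (R : comNzRingType) (I1 I2 I3 : finType).
Variables (a : I1 -> nat) (b : I2 -> nat) (c : I3 -> nat).

Lemma ent_mul (A : 'M[R]_(#|bix c|, #|bix b|)) (B : 'M[R]_(#|bix b|, #|bix a|)) i p k r :
  (ent (A *m B) i p k r = \sum_j \sum_(q < b j) ent A i p j q * ent B j q k r)%R.
Proof.
have [big|] := boolP ((c i <= p) || (a k <= r)).
  rewrite ent_big // big1 // => j _; rewrite big1 // => q _.
  by case/orP: big => le; [rewrite (ent_big A) ?mul0r ?le | rewrite (ent_big B) ?mulr0 ?le ?orbT].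
rewrite negb_or -!ltnNge => /andP[lt_p lt_r].
rewrite (ent_ix _ lt_p lt_r) fm_mulE -(sum_bix _ (fun j q => ent A i p j q * ent B j q k r)%R).
by apply: eq_bigr => y _; rewrite !entE.
Qed.

End Products.

(** * Matrices that commute with Jordan matrices *)

Section Jordan.
Variable R : comNzRingType.

Definition Jord (I : finType) (a : I -> nat) : 'M[R]_#|bix a| :=
  blk a a (fun i p j q => ((i == j) && (p == q.+1))%:R%R).

Lemma ent_Jord (I : finType) (a : I -> nat) i p j q : p < a i -> q < a j ->
  ent (Jord a) i p j q = ((i == j) && (p == q.+1))%:R%R.
Proof. exact: ent_blk. Qed.

(** The default value 0 of [ent] makes this a pure shift: the last column of a block needs no
    separate case. *)
Lemma ent_mul_Jord (I I' : finType) (a : I -> nat) (b : I' -> nat)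
    (A : 'M[R]_(#|bix b|, #|bix a|)) i p j q :
  q < a j -> ent (A *m Jord a) i p j q = ent A i p j q.+1.
Proof.
move=> lt_q; rewrite ent_mul (sum_pick_fin (k := j)) => [|k /negPf neq_kj]; last first.
  by rewrite big1 // => r _; rewrite ent_Jord // neq_kj mulr0.
rewrite (@sum_pick_ord _ _ (fun r => ent A i p j r * ent (Jord a) j r j q)%R q.+1)
  => [|r lt_r /negPf neq_r]; last first.
  by rewrite ent_Jord // neq_r andbF mulr0.
case: ltnP => [lt_q1|ge_q1]; first by rewrite ent_Jord // !eqxx mulr1.
by rewrite ent_big // ge_q1 orbT.
Qed.

Lemma ent_Jord_mul (I I' : finType) (a : I -> nat) (b : I' -> nat)
    (A : 'M[R]_(#|bix b|, #|bix a|)) i p j q :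
  p < b i -> ent (Jord b *m A) i p j q = if p is p'.+1 then ent A i p' j q else 0%R.
Proof.
move=> lt_p; rewrite ent_mul (sum_pick_fin (k := i)) => [|k neq_ki]; last first.
  by rewrite big1 // => r _; rewrite ent_Jord // eq_sym (negPf neq_ki) mul0r.
case: p lt_p => [|p] lt_p.
  by rewrite big1 // => r _; rewrite ent_Jord // andbF mul0r.
rewrite (@sum_pick_ord _ _ (fun r => ent (Jord b) i p.+1 i r * ent A i r j q)%R p)
  => [|r lt_r neq_r]; last first.
  by rewrite ent_Jord // eqSS eq_sym (negPf neq_r) andbF mul0r.
by rewrite (ltnW lt_p) ent_Jord ?(ltnW lt_p) // !eqxx mul1r.
Qed.

(* A matrix [C] with [C J = J C] and [J^2 C = 0] is determined, in each block, by
   the two bottom entries [h i j false] and [h i j true] of its first column. *)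
Definition bands (I I' : finType) (a : I -> nat) (b : I' -> nat)
    (h : I' -> I -> bool -> R) : 'M[R]_(#|bix b|, #|bix a|) :=
  blk a b (fun i p j q => \sum_(t : bool) h i j t * (p + 2 == q + b i + t)%N%:R)%R.

(** The relation J^2 C = 0 empties all rows of a block except the last two, and C J = J C makes the
    block constant along diagonals, so the first column decides. In a block of width 1 commutation
    also kills the entry of degree 0. *)
Lemma bandsP (I I' : finType) (a : I -> nat) (b : I' -> nat) (C : 'M[R]_(#|bix b|, #|bix a|)) :
  (forall j, 0 < a j) ->
  (C *m Jord a = Jord b *m C)%R -> (Jord b *m (Jord b *m C) = 0)%R ->
  exists2 h, C = bands a b h & forall i j, ~~ ((1 < a j) && (1 < b i)) -> h i j false = 0%R.
Proof.
move=> a_gt0 CJ JJC.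
have C0 i p j q : p.+2 < b i -> ent C i p j q = 0%R.
  move=> lt_p; have := congr1 (fun A => ent A i p.+2 j q) JJC.
  by rewrite ent_Jord_mul // ent_Jord_mul 1?ltnW // ent0.
have CS i p j q : p < b i -> q < a j ->
    ent C i p j q.+1 = if p is p'.+1 then ent C i p' j q else 0%R.
  by move=> lt_p lt_q; rewrite -ent_Jord_mul // -CJ ent_mul_Jord.
(* In a block of height 1 the truncated subtraction makes [h i j false] read the entry that
   [h i j true] already records; [h'] replaces this repetition by 0. *)
pose h i j (t : bool) : R := ent C i (b i - (~~ t).+1) j 0%N.
pose h' i j (t : bool) : R := if t || (1 < b i) then h i j t else 0%R.
exists h'; last first.
  move=> i j; rewrite /h' /h negb_and -!leqNgt /=; case: ltnP => //= bi; rewrite orbF => aj.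
  have := CS i (b i - 1) j 0; rewrite ltn_subrL (ltn_trans _ bi) // a_gt0 => /(_ isT isT).
  rewrite ent_big ?aj ?orbT // => /esym; case: (b i) bi => [|[|n]] // _; by rewrite !subSS !subn0.
apply: entP => i p j q lt_p lt_q; rewrite ent_blk // big_bool /=.
have [le_qp|lt_pq] := leqP q p; last first.
  rewrite [LHS](_ : _ = 0%R); last first.
    elim: q p lt_p lt_q lt_pq => // q IHq p lt_p lt_q lt_pq; rewrite CS ?(ltnW lt_q) //.
    by case: p lt_p lt_pq => // p lt_p lt_pq; rewrite IHq // ltnW.
  rewrite (_ : (p + 2 == q + b i + 1)%N = false) ?mulr0 ?add0r; last lia.
  rewrite /h' /=; have [b2|b1] := ltnP 1 (b i); last by rewrite mul0r.
  by rewrite (_ : (p + 2 == q + b i + 0)%N = false) ?mulr0 //; lia.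
have -> : ent C i p j q = ent C i (p - q) j 0%N.
  elim: q p lt_p lt_q le_qp => [|q IHq] [|p] lt_p lt_q le_qp; rewrite ?subn0 // CS ?(ltnW lt_q) //.
  by rewrite IHq ?subSS // ltnW.
have [lt_pqb|] := ltnP (p - q).+2 (b i).
  rewrite C0 // (_ : (p + 2 == q + b i + 1)%N = false); last lia.
  by rewrite (_ : (p + 2 == q + b i + 0)%N = false) ?mulr0 ?addr0 //; lia.
rewrite /h' /h leq_eqVlt /= => /orP[/eqP bi|bi].
  rewrite (_ : (p + 2 == q + b i + 1)%N = false) ?mulr0 ?add0r; last lia.
  rewrite (_ : (p + 2 == q + b i + 0)%N = true) ?mulr1; last lia.
  by rewrite (_ : (1 < b i) = true); [congr ent | ]; lia.
rewrite (_ : (p + 2 == q + b i + 0)%N = false) ?mulr0 ?addr0; last lia.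
rewrite (_ : (p + 2 == q + b i + 1)%N = true) ?mulr1; last lia.
by congr ent; lia.
Qed.

End Jordan.

Section BandProducts.
Variable R : comNzRingType.

(** The hypotheses are guarded by [u] and [v] being non-zero because the size inequalities that
    locate [k] are available only where the bands have non-zero coefficients. *)
Lemma sum_two_deltas n (A B : pred nat) (c : bool) k (u v : R) :
  (u != 0 -> v != 0 -> forall r, (r < n)%N -> A r -> B r -> c && (r == k))%R ->
  (u != 0 -> v != 0 -> c -> [&& (k < n)%N, A k & B k])%R ->
  (\sum_(r < n) (u * (A r)%:R) * (v * (B r)%:R) = u * v * c%:R)%R.
Proof.
have [->|u0] := eqVneq u 0%R; first by rewrite big1 ?mul0r // => *; rewrite !mul0r.
have [->|v0] := eqVneq v 0%R; first by rewrite big1 ?mulr0 ?mul0r // => *; rewrite mul0r mulr0.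
move=> /(_ isT isT) AB /(_ isT isT) ck.
rewrite (@sum_pick_ord _ _ (fun r => (u * (A r)%:R) * (v * (B r)%:R))%R k) => [|r lt_r neq].
  case: ifP => lt_k; last by case: c ck {AB} => [/(_ isT)|]; rewrite ?lt_k // mulr0.
  case: c AB ck => [_ /(_ isT)/and3P[_ -> ->]|AB _]; first by rewrite !mulr1.
  case Ak: (A k); case Bk: (B k); rewrite ?mulr0 ?mul0r //.
  by have := AB k lt_k Ak Bk.
case Ar: (A r); case Br: (B r); rewrite ?mulr0 ?mul0r //.
by have := AB r lt_r Ar Br; rewrite (negPf neq) andbF.
Qed.

(** Homomorphisms between Jordan blocks are cut down to degrees 0 and 1, as C meets only the last
    two rows of a block. Here degree 0 is the diagonal through the bottom right corner, because C
    sits at the bottom of its blocks; in [col_bands] it is the diagonal through the top left corner,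
    because C is read off its first column. *)
Definition row_bands (I I' : finType) (b : I -> nat) (b' : I' -> nat)
    (y : I' -> I -> bool -> R) : 'M[R]_(#|bix b'|, #|bix b|) :=
  blk b b' (fun i p j q => \sum_(t : bool) y i j t * (p + b j == q + b' i + t)%N%:R)%R.

Definition col_bands (I I' : finType) (a : I -> nat) (a' : I' -> nat)
    (x : I' -> I -> bool -> R) : 'M[R]_(#|bix a'|, #|bix a|) :=
  blk a a' (fun i p j q => \sum_(t : bool) x i j t * (p == q + t)%N%:R)%R.

(** The inequality says that multiplication by the corresponding power of the variable is a
    homomorphism between the two truncated polynomial modules. *)
Definition supported (I I' : finType) (s : I -> nat) (s' : I' -> nat) (x : I' -> I -> bool -> R) :=
  forall i j (t : bool), ~~ (s j <= s' i + t) -> x i j t = 0%R.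

Lemma row_bands_Jord (I I' : finType) (b : I -> nat) (b' : I' -> nat) y :
  supported b b' y ->
  (row_bands b b' y *m Jord R b = Jord R b' *m row_bands b b' y)%R.
Proof.
move=> y0; apply: entP => i p j q lt_p lt_q.
rewrite ent_mul_Jord // ent_Jord_mul //.
have {}y0 t : y i j t != 0%R -> b j <= b' i + t.
  by move=> yn; apply: contraNT yn => /y0->.
have term (t c c' : bool) : (b j <= b' i + t -> c = c') ->
    (y i j t * c%:R = y i j t * c'%:R)%R.
  have [->|/y0 le cc'] := eqVneq (y i j t) 0%R; first by rewrite !mul0r.
  by rewrite cc'.
case: p lt_p => [|p] lt_p; last first.
  rewrite [RHS]ent_blk ?(ltnW lt_p) //.
  have [lt_q1|ge_q1] := ltnP q.+1 (b j).
    by rewrite ent_blk //; apply: eq_bigr => t _; apply: term => le; lia.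
  rewrite ent_big ?ge_q1 ?orbT // big1 // => t _.
  apply: etrans (term t _ false _) _ => [le|]; [lia | by rewrite mulr0].
have [lt_q1|ge_q1] := ltnP q.+1 (b j); last by rewrite ent_big ?ge_q1 ?orbT .
rewrite ent_blk // big1 // => t _.
by apply: etrans (term t _ false _) _ => [le|]; [lia | rewrite mulr0].
Qed.

Lemma col_bands_Jord (I I' : finType) (a : I -> nat) (a' : I' -> nat) x :
  supported a' a (fun j i t => x i j t) ->
  (col_bands a a' x *m Jord R a = Jord R a' *m col_bands a a' x)%R.
Proof.
move=> x0; apply: entP => i p j q lt_p lt_q.
rewrite ent_mul_Jord // ent_Jord_mul //.
have term (t c c' : bool) : (a' i <= a j + t -> c = c') ->
    (x i j t * c%:R = x i j t * c'%:R)%R.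
  have [le cc'|nle _] := boolP (a' i <= a j + t); first by rewrite cc'.
  by rewrite (x0 j i t nle) !mul0r.
case: p lt_p => [|p] lt_p; last first.
  rewrite [RHS]ent_blk ?(ltnW lt_p) //.
  have [lt_q1|ge_q1] := ltnP q.+1 (a j).
    by rewrite ent_blk //; apply: eq_bigr => t _; apply: term => le; lia.
  rewrite ent_big ?ge_q1 ?orbT // big1 // => t _.
  apply: etrans (term t _ false _) _ => [le|]; [lia | by rewrite mulr0].
have [lt_q1|ge_q1] := ltnP q.+1 (a j); last by rewrite ent_big ?ge_q1 ?orbT.
rewrite ent_blk // big1 // => t _.
by apply: etrans (term t _ false _) _ => [le|]; [lia | rewrite mulr0].
Qed.

(* The type of a product of bands is the sum of the types of the factors. *)
Definition band_conv (u v : bool -> R) (t : bool) : R :=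
  (u false * v t + (if t then u true * v false else 0))%R.

(** Degrees of bands add, and a product of degree 2 would have to lie below the last row of the
    block. Blocks therefore multiply like linear polynomials modulo the square of the variable. *)
Lemma mul_row_bands (I I1 I2 : finType) (a : I -> nat) (b : I1 -> nat) (b' : I2 -> nat) y h :
  (forall i, 0 < b i) -> supported b b' y ->
  (forall i j, ~~ ((1 < a j) && (1 < b i)) -> h i j false = 0%R) ->
  (row_bands b b' y *m bands a b h =
   bands a b' (fun i j t => \sum_k band_conv (y i k) (h k j) t))%R.
Proof.
move=> b_gt0 y0 h0; apply: entP => i p j q lt_p lt_q.
rewrite ent_mul ent_blk // [LHS](eq_bigr (fun k => \sum_(t : bool)
  band_conv (y i k) (h k j) t * (p + 2 == q + b' i + t)%N%:R)%R); last first.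
  move=> k _; have bk := b_gt0 k.
  have {}y0 t : (y i k t != 0)%R -> b k <= b' i + t.
    by move=> yn; apply: contraNT yn => /y0->.
  have {}h0 t : (h k j t != 0)%R -> 1 < b k + t.
    case: t => [_|hn]; first by rewrite addn1.
    by rewrite addn0; apply: contraNT hn => n1; apply/eqP/h0; rewrite (negPf n1) andbF.
  have term (t t' : bool) : (\sum_(r < b k) (y i k t * (p + b k == r + b' i + t)%N%:R) *
      (h k j t' * (r + 2 == q + b k + t')%N%:R) =
      y i k t * h k j t' * (p + 2 == q + b' i + (t + t'))%N%:R)%R.
    apply: (@sum_two_deltas _ (fun r => p + b k == r + b' i + t)%N
      (fun r => r + 2 == q + b k + t')%N _ (q + b k + t' - 2)).
      by move=> /y0 le /h0 b2 r lt_r /eqP e1 /eqP e2; lia.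
    by move=> /y0 le /h0 b2 /eqP e; lia.
  under eq_bigr => r _ do rewrite !ent_blk // !big_bool mulrDl !mulrDr.
  rewrite !big_split /= !term big_bool /band_conv /=.
  rewrite (_ : (p + 2 == q + b' i + 2)%N = false); last lia.
  by rewrite mulr0 add0r addr0 mulrDl addrA [(_ * _ + y i k false * _ * _)%R]addrC.
by rewrite exchange_big; apply: eq_bigr => t _; rewrite mulr_suml.
Qed.

Lemma mul_bands_col (I1 I2 I' : finType) (a : I1 -> nat) (a' : I2 -> nat) (b : I' -> nat) x h :
  (forall j, 0 < a' j) ->
  (forall i j, ~~ ((1 < a' j) && (1 < b i)) -> h i j false = 0%R) ->
  (bands a' b h *m col_bands a a' x =
   bands a b (fun i j t => \sum_k band_conv (h i k) (x k j) t))%R.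
Proof.
move=> a_gt0 h0; apply: entP => i p j q lt_p lt_q.
rewrite ent_mul ent_blk // [LHS](eq_bigr (fun k => \sum_(t : bool)
  band_conv (h i k) (x k j) t * (p + 2 == q + b i + t)%N%:R)%R); last first.
  move=> k _; have ak := a_gt0 k.
  have {}h0 t : (h i k t != 0)%R -> 1 < a' k + t.
    case: t => [_|hn]; first by rewrite addn1.
    by rewrite addn0; apply: contraNT hn => n1; apply/eqP/h0; rewrite (negPf n1).
  have term (t t' : bool) : (\sum_(r < a' k) (h i k t * (p + 2 == r + b i + t)%N%:R) *
      (x k j t' * ((r : nat) == q + t')%N%:R) =
      h i k t * x k j t' * (p + 2 == q + b i + (t + t'))%N%:R)%R.
    apply: (@sum_two_deltas _ (fun r => p + 2 == r + b i + t)%N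
      (fun r : nat => r == q + t')%N _ (q + t')).
      by move=> /h0 a2 _ r lt_r /eqP e1 /eqP e2; lia.
    by move=> /h0 a2 _ /eqP e; lia.
  under eq_bigr => r _ do rewrite !ent_blk // !big_bool mulrDl !mulrDr.
  rewrite !big_split /= !term big_bool /band_conv /=.
  rewrite (_ : (p + 2 == q + b i + 2)%N = false); last lia.
  by rewrite mulr0 add0r addr0 mulrDl addrA [(_ * _ + h i k false * _ * _)%R]addrC.
by rewrite exchange_big; apply: eq_bigr => t _; rewrite mulr_suml.
Qed.

End BandProducts.

(** * Nilpotent matrices and their Jordan form *)

Section MatrixPower.
Local Open Scope ring_scope.
Variable R : comNzRingType.

(** The iterated product is the form in which a power of a loop evaluates, and it covers matrices of
    size 0. *)
Definition mxpow d (A : 'M[R]_d) (m : nat) : 'M[R]_d := iter m (mulmx A) 1%:M.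

Arguments mxpow : simpl never.

Lemma mxpowS d (A : 'M[R]_d) m : mxpow A m.+1 = A *m mxpow A m.
Proof. by []. Qed.

Lemma mxpowSr d (A : 'M[R]_d) m : mxpow A m.+1 = mxpow A m *m A.
Proof.
elim: m => [|m IHm]; first by rewrite /mxpow /= mul1mx mulmx1.
by rewrite mxpowS {1}IHm mulmxA.
Qed.

Lemma mxpowD d (A : 'M[R]_d) m n : mxpow A (m + n) = mxpow A m *m mxpow A n.
Proof.
elim: m => [|m IHm]; first by rewrite /mxpow mul1mx.
by rewrite addSn !mxpowS IHm mulmxA.
Qed.

Lemma mxpow_mul d e (A : 'M[R]_d) (B : 'M[R]_e) (P : 'M[R]_(e, d)) m :
  P *m A = B *m P -> P *m mxpow A m = mxpow B m *m P.
Proof.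
move=> PA; elim: m => [|m IHm]; first by rewrite /mxpow mulmx1 mul1mx.
by rewrite !mxpowS mulmxA PA -mulmxA IHm mulmxA.
Qed.

Lemma sim_mxpow0 d e (A : 'M[R]_d) (B : 'M[R]_e) m :
  sim A B -> mxpow A m = 0 -> mxpow B m = 0.
Proof.
case=> P [Q [PA QP PQ]] A0.
by rewrite -[mxpow B m]mulmx1 -PQ mulmxA -(mxpow_mul m PA) A0 mulmx0 mul0mx.
Qed.

Lemma ent_Jord_pow (I : finType) (a : I -> nat) m i p j q : (p < a i)%N -> (q < a j)%N ->
  ent (mxpow (Jord R a) m) i p j q = ((i == j) && (p == q + m)%N)%:R.
Proof.
move=> lt_p lt_q; elim: m q lt_q => [|m IHm] q lt_q.
  rewrite (ent_ix _ lt_p lt_q) fm1E bix_eq /= addn0.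
  by case: (eqVneq i j).
rewrite mxpowSr ent_mul_Jord //; have [lt_q1|ge_q1] := ltnP q.+1 (a j).
  by rewrite IHm // addSnnS.
rewrite ent_big ?ge_q1 ?orbT //; case: (eqVneq i j) => //= eq_ij; subst j.
by rewrite (_ : (p == _) = false) //; lia.
Qed.

Lemma Jord_pow0 (I : finType) (a : I -> nat) m :
  mxpow (Jord R a) m = 0 <-> (forall i, a i <= m)%N.
Proof.
split=> [Jm i|le_am].
  have [//|lt_ma] := leqP (a i) m; have := congr1 (fun A => ent A i m i 0%N) Jm.
  rewrite ent_Jord_pow ?(leq_ltn_trans _ lt_ma) // ent0 eqxx add0n eqxx => /eqP.
  by rewrite oner_eq0.
apply: entP => i p j q lt_p lt_q; rewrite ent0 ent_Jord_pow //.
case: (eqVneq i j) => //= eq_ij; subst j; rewrite (_ : (p == _) = false) //.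
by have := le_am i; lia.
Qed.

End MatrixPower.

Section Jordanization.
Variable F : fieldType.
Local Open Scope ring_scope.

Lemma inverse_dims d e (P : 'M[F]_(e, d)) (Q : 'M[F]_(d, e)) :
  Q *m P = 1%:M -> P *m Q = 1%:M -> d = e.
Proof. by move=> /mulmx1_min le_de /mulmx1_min le_ed; apply/eqP; rewrite eqn_leq le_de. Qed.

Lemma left_inverse_square d e (P : 'M[F]_(e, d)) (Q : 'M[F]_(d, e)) :
  d = e -> P *m Q = 1%:M -> Q *m P = 1%:M.
Proof. by move=> eq_de; subst e; exact: mulmx1C. Qed.

Lemma split_idempotent d (e : 'M[F]_d) : e *m e = e ->
  exists r (U : 'M[F]_(d, r)) (V : 'M[F]_(r, d)), V *m U = 1%:M /\ U *m V = e.
Proof.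
move=> ee; exists (\rank e), (col_base e), (row_base e); split; last exact: mulmx_base.
apply: (row_full_inj (col_base_full e)); apply: (row_free_inj (row_base_free e)).
by rewrite mulmx1 mulmxA mulmx_base -mulmxA mulmx_base ee.
Qed.

Definition nilblock r : 'M[F]_r := \matrix_(i, j) (i == j.+1 :> nat)%:R.

(* A Jordan chain of maximal length spans a direct summand. *)
Lemma split_chain d (A : 'M[F]_d) r : mxpow A r.+1 = 0 -> mxpow A r != 0 ->
  exists e (A' : 'M[F]_e), sim A (block_mx (nilblock r.+1) 0 0 A').
Proof.
move=> Ar1 /matrix0Pn[i0 [j0 c0]].
have Abig n : (r < n)%N -> mxpow A n = 0.
  by move=> lt_rn; rewrite -(subnK lt_rn) mxpowD Ar1 mulmx0.
(* The columns of [U] are a chain of length r + 1, the rows of [W] a dual chain. As the entry (i0,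
   j0) of A^r is not 0, [W *m U] is triangular with that entry on the diagonal; this makes
   [U *m T *m W] below a projection onto the chain that commutes with A. *)
pose U : 'M[F]_(d, r.+1) := \matrix_(x, k) mxpow A k x j0.
pose W : 'M[F]_(r.+1, d) := \matrix_(k, y) mxpow A (r - k) i0 y.
have WUE (k l : 'I_r.+1) : (W *m U) k l = mxpow A (r - k + l) i0 j0.
  by rewrite mxpowD !mxE; apply: eq_bigr => y _; rewrite !mxE.
have AU : A *m U = U *m nilblock r.+1.
  apply/matrixP => x l; transitivity (mxpow A l.+1 x j0).
    by rewrite /= !mxE; apply: eq_bigr => y _; rewrite !mxE.
  rewrite [RHS]mxE; under eq_bigr do rewrite !mxE.
  rewrite (@sum_pick_ord _ _ (fun k => mxpow A k x j0 * (k == l.+1)%:R) l.+1); last first.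
    by move=> k _ /negPf->; rewrite mulr0.
  rewrite eqxx mulr1; case: ltnP => // le_rl; by rewrite Abig // mxE.
have WA : W *m A = nilblock r.+1 *m W.
  apply/matrixP => k y; transitivity (mxpow A (r - k).+1 i0 y).
    by rewrite mxpowSr !mxE; apply: eq_bigr => x _; rewrite !mxE.
  case: k => [[|k] lt_k].
    have -> : mxpow A (r - Ordinal lt_k).+1 = 0 by apply: Abig; rewrite subn0.
    by rewrite !mxE big1 // => l _; rewrite !mxE mul0r.
  rewrite [RHS]mxE (bigD1 (Ordinal (ltnW lt_k))) //= big1 ?addr0 => [|l neq].
    rewrite [nilblock _ _ _]mxE [W _ _]mxE eqxx mul1r.
    rewrite -mxpowS (_ : (r - k.+1).+1 = (r - k)%N) //; move: lt_k; lia.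
  rewrite mxE eqSS [_ == _ :> nat](_ : _ = false) ?mul0r //.
  by apply: contraNF neq => /eqP eq_kl; apply/eqP/val_inj; rewrite /= eq_kl.
have unitWU : W *m U \in unitmx.
  rewrite unitmxE (det_trig (A := W *m U)).
    rewrite unitfE prodf_seq_neq0; apply/allP => k _ /=; rewrite WUE subnK //.
    by rewrite -ltnS.
  apply/is_trig_mxP => k l lt_kl; rewrite WUE Abig ?mxE //.
  by have := ltn_ord k; lia.
pose T := invmx (W *m U); have JT : nilblock r.+1 *m T = T *m nilblock r.+1.
  have JWU : nilblock r.+1 *m (W *m U) = W *m U *m nilblock r.+1.
    by rewrite mulmxA -WA -mulmxA AU mulmxA.
  rewrite -[LHS]mul1mx -(mulVmx unitWU) -/T -!mulmxA; congr (_ *m _).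
  by rewrite !mulmxA -[W *m U *m _]JWU -!mulmxA [W *m (U *m T)]mulmxA mulmxV ?mulmx1.
have TWU : T *m W *m U = 1%:M by rewrite -mulmxA mulVmx.
pose E := U *m T *m W.
have EE : E *m E = E by rewrite /E -!mulmxA [W *m _]mulmxA [T *m (_ *m _)]mulmxA mulVmx // mul1mx.
have AE : A *m E = E *m A.
  by rewrite /E !mulmxA AU -[U *m _ *m _]mulmxA JT -!mulmxA -WA.
have [|s [U' [V' [VU' UV']]]] := @split_idempotent _ (1%:M - E).
  by rewrite mulmxBl mul1mx mulmxBr mulmx1 EE subrr subr0.
have TWE : T *m W *m (1%:M - E) = 0.
  by rewrite mulmxBr mulmx1 /E !mulmxA TWU mul1mx subrr.
have EU : (1%:M - E) *m U = 0.
  by rewrite mulmxBl mul1mx /E -!mulmxA [T *m (_ *m _)]mulmxA TWU mulmx1 subrr.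
have TWU' : T *m W *m U' = 0.
  by rewrite -[U']mulmx1 -VU' [U' *m _]mulmxA UV' mulmxA TWE mul0mx.
have VU : V' *m U = 0.
  by rewrite -[V']mul1mx -VU' -[V' *m U' *m V']mulmxA UV' -mulmxA EU mulmx0.
exists s, (V' *m A *m U'); exists (col_mx (T *m W) V'), (row_mx U U'); split.
- rewrite mul_col_mx mul_block_col !mul0mx addr0 add0r; congr col_mx.
    by rewrite -mulmxA WA !mulmxA JT.
  rewrite -[V' *m A *m U' *m V']mulmxA UV' mulmxBr mulmx1 -[V' *m A *m E]mulmxA AE.
  by rewrite /E !mulmxA VU !mul0mx subr0.
- by rewrite mul_row_col mulmxA -/E UV' addrC subrK.
- by rewrite mul_col_row TWU TWU' VU VU' -scalar_mx_block.
Qed.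

Lemma Jordan_form d (A : 'M[F]_d) m : mxpow A m = 0 ->
  exists (I : finType) (a : I -> nat), (forall i, 0 < a i <= m)%N /\ sim A (Jord F a).
Proof.
have [n] := ubnP d; elim: n d A => // n IHn d A lt_dn Am.
have [d0|d_gt0] := posnP d.
  exists void, (fun=> 0%N); split=> [[]|]; exists 0, 0; split; apply/matrixP => i.
  - by case: (enum_val i) => [[]].
  - by case: i => i lt_i; exfalso; rewrite d0 in lt_i.
  - by case: (enum_val i) => [[]].
have [r Ar1 Ar] : exists2 r, mxpow A r.+1 = 0 & mxpow A r != 0.
  elim: m {IHn} Am => [Am|m IHm Am]; last by have [/IHm//|] := eqVneq (mxpow A m) 0; exists m.
  have := congr1 (fun A : 'M_d => A (Ordinal d_gt0) (Ordinal d_gt0)) Am.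
  by rewrite !mxE eqxx => /eqP; rewrite oner_eq0.
have [e [A' simA]] := split_chain Ar1 Ar.
have eq_d : d = (r.+1 + e)%N by have [P [Q [_ QP PQ]]] := simA; exact: inverse_dims QP PQ.
have blk_pow k (B : 'M[F]_r.+1) (B' : 'M[F]_e) :
    mxpow (block_mx B 0 0 B') k = block_mx (mxpow B k) 0 0 (mxpow B' k).
  elim: k => [|k IHk]; first by rewrite /= scalar_mx_block.
  by rewrite /= -/(mxpow _ k) IHk mulmx_block !(mulmx0, mul0mx, addr0, add0r).
have := sim_mxpow0 simA Am; rewrite blk_pow => Bm.
have A'm : mxpow A' m = 0 
    by have := congr1 (@drsubmx _ r.+1 e r.+1 e) Bm; rewrite block_mxKdr => ->;
       apply/matrixP => i j; rewrite !mxE.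
have lt_rm : (r < m)%N.
  rewrite ltnNge; apply: contraNN Ar => le_mr.
  by rewrite -(subnK le_mr) mxpowD Am mulmx0.
have [|I [a [a_bd simA']]] := IHn e A' _ A'm; first by move: lt_dn; rewrite eq_d; lia.
pose a' (i : option I) := if i is Some i then a i else r.+1.
exists (option I), a'; split=> [[i|]|]; rewrite ?a_bd //.
apply: sim_trans simA _; apply: sim_trans (sim_block (sim_refl _) simA') _.
pose f (y : bix a') : 'I_(r.+1 + #|bix a|) :=
  match y with
  | existT None p => lshift _ p
  | existT (Some i) p => rshift _ (enum_rank (existT (fun i => 'I_(a i)) i p : bix a))
  end.
pose g (k : 'I_(r.+1 + #|bix a|)) : bix a' :=
  match fintype.split k with
  | inl p => existT (fun i => 'I_(a' i)) None p
  | inr k => existT (fun i => 'I_(a' i)) (Some (tag (enum_val k))) (tagged (enum_val k))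
  end.
have fK : cancel f g.
  move=> [[i|] p]; rewrite /g /f; last by rewrite (unsplitK (inl p)).
  by rewrite (unsplitK (inr _)) enum_rankK.
have gK : cancel g f.
  move=> k; rewrite /g; case: split_ordP => [p ->|j ->] //=.
  by congr rshift; rewrite -[RHS]enum_valK; case: (enum_val j).
apply: (@sim_bij _ _ _ _ _ (fun i => f (enum_val i)) (fun k => enum_rank (g k))).
- by move=> i; rewrite fK enum_valK.
- by move=> k; rewrite enum_rankK gK.
move=> i j; rewrite [LHS]mxE; case: (enum_val i) => [[i'|] p]; case: (enum_val j) => [[j'|] q] /=.
- by rewrite block_mxEdr fmE.
- by rewrite block_mxEdl mxE.
- by rewrite block_mxEur mxE.
- by rewrite block_mxEul mxE.
Qed.

End Jordanization.

(** * Transfer of one unit of length between Jordan blocks *)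

Section Moves.
Variables (F : fieldType) (I : finType) (a : I -> nat) (j0 j1 : I).
Hypotheses (neq_j : j0 != j1) (a0_gt0 : 0 < a j0) (le_a : a j0 <= a j1).

Definition moved (i : I) : nat :=
  if i == j0 then (a j0).-1 else if i == j1 then (a j1).+1 else a i.

(** Adding a non-zero multiple of this matrix to the Jordan matrix continues the chain [j1] into the
    last vector of the chain [j0]. *)
Definition last_unit : 'M[F]_#|bix a| :=
  blk a a (fun i p j q =>
    [&& i == j0, j == j1, p.+1 == a j0 & q.+1 == a j1]%:R%R).

(** The counterpart at the other end of the chains. As a left factor of C it sees only the top row
    of block [j0], whereas [last_unit] as a right factor of C sees only the last column. *)
Definition first_unit : 'M[F]_#|bix a| :=
  blk a a (fun i p j q => [&& i == j1, j == j0, p == 0%N & q == 0%N]%:R%R).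

Variable s : F.
Hypothesis s0 : (s != 0)%R.

Let P : 'M[F]_(#|bix moved|, #|bix a|) := blk a moved (fun i p j q =>
  ((i == j) && (p == q))%:R + s^-1 * [&& i == j1, j == j0 & p + a j0 == q + (a j1).+1]%N%:R)%R.

(** The columns of [Q] are the chains of the perturbed matrix. The long one ends in s times the last
    vector of [j0]. The short one is the chain [j0] minus a multiple of the tail of the long chain
    with the same end; there is room for this tail because [a j0 <= a j1]. *)
Let Q : 'M[F]_(#|bix a|, #|bix moved|) := blk moved a (fun i p j q =>
  ((i == j) && (p == q))%:R - s^-1 * [&& i == j1, j == j0 & p + a j0 == q + (a j1).+1]%N%:R
  + s * [&& i == j0, j == j1, p.+1 == a j0 & q == a j1]%:R)%R.

Lemma ent_P_mul (I' : finType) (c : I' -> nat) (M : 'M[F]_(#|bix a|, #|bix c|)) i p k r :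
  p < moved i ->
  (ent (P *m M) i p k r = ent M i p k r + (if (i == j1) && ((a j1).+1 <= p + a j0)%N
     then s^-1 * ent M j0 (p + a j0 - (a j1).+1)%N k r else 0))%R.
Proof.
move=> lt_p; rewrite ent_mul.
under eq_bigr => j _ do under eq_bigr => q _ do rewrite ent_blk // mulrDl.
under eq_bigr => j _ do rewrite big_split /=.
rewrite big_split /=; congr (_ + _)%R.
  rewrite (sum_pick_fin (k := i)) => [|j]; last first.
    by rewrite eq_sym => /negPf neq; rewrite big1 // => q _; rewrite neq mul0r.
  rewrite (@sum_pick_ord _ _ (fun q => ((i == i) && (p == q))%:R * ent M i q k r)%R p) => [|q _].
    by rewrite !eqxx mul1r; case: ifP => // /negbT; rewrite -leqNgt => ge; rewrite ent_big ?ge.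
  by rewrite eq_sym => /negPf->; rewrite andbF mul0r.
rewrite (sum_pick_fin (k := j0)) => [|j /negPf neq]; last first.
  by rewrite big1 // => q _; rewrite neq andbF mulr0 mul0r.
have [eq_i|neq_i] /= := eqVneq i j1; last by rewrite big1 // => q _; rewrite mulr0 mul0r.
rewrite eqxx; case: (leqP (a j1).+1 (p + a j0)) => [le|gt]; last first.
  by rewrite big1 // => q _; rewrite [_ == _](_ : _ = false) ?mulr0 ?mul0r //=; lia.
rewrite (@sum_pick_ord _ _ (fun q => s^-1 * (p + a j0 == q + (a j1).+1)%N%:R * ent M j0 q k r)%R
  (p + a j0 - (a j1).+1)) => [|q _ neq]; last first.
  by rewrite [_ == _](_ : _ = false) ?mulr0 ?mul0r //=; apply/negbTE; lia.
rewrite subnK // eqxx mulr1; case: ifP => // /negbT; rewrite -leqNgt => ge.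
by rewrite ent_big ?ge // mulr0.
Qed.

Lemma moved_lt i p : p < moved i -> i != j1 -> p < a i.
Proof. by rewrite /moved; case: eqP => [->|_] lt /negPf neq; move: lt; rewrite ?neq; lia. Qed.

Lemma moved1 : moved j1 = (a j1).+1.
Proof. by rewrite /moved eq_sym (negPf neq_j) eqxx. Qed.

Lemma moved0 : moved j0 = (a j0).-1.
Proof. by rewrite /moved eqxx. Qed.

Lemma PQ1 : (P *m Q = 1%:M)%R.
Proof.
apply: entP => i p k r lt_p lt_r; rewrite ent_P_mul //.
rewrite (ent_ix 1%:M%R lt_p lt_r) fm1E bix_eq /= /pos /=.
have [eq_i|neq_i] /= := eqVneq i j1; last first.
  rewrite addr0 ent_blk //; last exact: moved_lt.
  rewrite (negPf neq_i) mulr0 subr0 [X in (_ + s * X)%R](_ : _ = 0%R) ?mulr0 ?addr0 //.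
  case: eqP => //= eq_i; rewrite [p.+1 == _](_ : _ = false) ?andbF //.
  by move: lt_p; rewrite eq_i moved0; lia.
subst i; have lt_p1 : p < (a j1).+1 by rewrite -moved1.
have [lt_p'|ge_p] := ltnP p (a j1); last first.
  have eq_p : p = a j1 by lia.
  rewrite ent_big ?ge_p // add0r ifT; last lia.
  rewrite ent_blk //; last lia.
  rewrite eqxx (negPf neq_j) mulr0 subr0 mulrDr mulrA mulVf // mul1r.
  rewrite [X in (X + _)%R](_ : _ = 0%R) ?add0r.
    by congr _%:R%R; have [eq_k|neq] //= := eqVneq k j1; lia.
  case: eqP => /= [eq_k|]; last by rewrite mulr0.
  rewrite [_ == r](_ : _ = false) ?mulr0 //.
  by move: lt_r; rewrite -eq_k moved0; lia.
rewrite ent_blk // [j1 == j0]eq_sym (negPf neq_j) mulr0 addr0 eqxx /=.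
case: (leqP (a j1).+1 (p + a j0)) => [le|gt].
  rewrite ent_blk //; last lia.
  rewrite eqxx (negPf neq_j) mulr0 subr0 [X in (s * X)%R](_ : _ = 0%R) ?mulr0 ?addr0; last first.
    by rewrite [_.+1 == _](_ : _ = false) ?andbF //=; lia.
  rewrite -addrA [X in (_ + X)%R](_ : _ = 0%R) ?addr0 ?[k == j1]eq_sym //.
  rewrite [j0 == k]eq_sym; case: (k == j0) => /=; last by rewrite mulr0 addr0 oppr0.
  by rewrite (_ : (p + a j0 == _) = (p + a j0 - (a j1).+1 == r)) ?addNr //; lia.
rewrite addr0 [p + _ == _](_ : _ = false); last lia.
by rewrite andbF mulr0 subr0.
Qed.

Lemma P_move : (P *m (Jord F a + s *: last_unit) = Jord F moved *m P)%R.
Proof.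
apply: entP => i p k r lt_p lt_r; rewrite ent_P_mul // ent_Jord_mul //.
have eM j q : q < a j -> (ent (Jord F a + s *: last_unit) j q k r =
    ((j == k) && (q == r.+1))%:R + s * [&& j == j0, k == j1, q.+1 == a j0 & r.+1 == a j1]%:R)%R.
  by move=> lt_q; rewrite entD entZ ent_Jord // ent_blk.
have [eq_i|neq_i] /= := eqVneq i j1; last first.
  have lt_pi := moved_lt lt_p neq_i; rewrite addr0 eM //.
  rewrite [X in (s * X)%R](_ : _ = 0%R) ?mulr0 ?addr0; last first.
    case: eqP => //= eq_i; rewrite [p.+1 == _](_ : _ = false) ?andbF //.
    by move: lt_p; rewrite eq_i moved0; lia.
  case: p lt_p lt_pi => [|p] lt_p lt_pi; first by rewrite andbF.
  rewrite ent_blk ?(ltnW lt_p) // (negPf neq_i) mulr0 addr0.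
  by case: (i == k).
subst i; have lt_p1 : p < (a j1).+1 by rewrite -moved1.
case: p lt_p lt_p1 => [|p] lt_p lt_p1.
  rewrite ifF ?addr0; last lia.
  rewrite eM; last lia.
  by rewrite andbF [j1 == j0]eq_sym (negPf neq_j) mulr0 addr0.
rewrite [RHS]ent_blk ?(ltnW lt_p) // eqxx /=.
have [lt_p'|ge_p] := ltnP p.+1 (a j1); last first.
  have eq_p : p.+1 = a j1 by lia.
  rewrite ent_big ?ge_p // add0r ifT; last lia.
  rewrite eM; last lia.
  rewrite eqxx /= mulrDr mulrA mulVf // mul1r addrC; congr (_ + _ * _)%R.
    by congr _%:R%R; have [eq_k|neq] //= := eqVneq k j1; lia.
  congr _%:R%R; rewrite [j0 == k]eq_sym; have [eq_k|neq] //= := eqVneq k j0.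
  by move: lt_r; rewrite eq_k; lia.
rewrite eM // [j1 == j0]eq_sym (negPf neq_j) mulr0 addr0.
congr (_ + _)%R.
case: (leqP (a j1).+1 (p.+1 + a j0)) => [le|gt].
  rewrite eM; last lia.
  rewrite eqxx [X in (s * X)%R](_ : _ = 0%R) ?mulr0 ?addr0; last first.
    by rewrite [_.+1 == a j0](_ : _ = false) ?andbF //=; lia.
  congr (_ * _)%R; congr _%:R%R; rewrite [j0 == k]eq_sym; case: (k == j0) => //=; lia.
rewrite [p + _ == _](_ : _ = false) ?andbF ?mulr0 //; lia.
Qed.

Lemma card_moved : #|bix a| = #|bix moved|.
Proof.
rewrite !card_bix (bigD1 j0) // (bigD1 j1) ?[j1 == j0]eq_sym //=.
rewrite [RHS](bigD1 j0) // [in RHS](bigD1 j1) ?[j1 == j0]eq_sym //= moved0 moved1.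
rewrite !addnA; congr (_ + _); first by move: a0_gt0; lia.
by apply: eq_bigr => i /andP[/negPf n0 /negPf n1]; rewrite /moved n0 n1.
Qed.

Lemma sim_last_unit : sim (Jord F a + s *: last_unit)%R (Jord F moved).
Proof.
exists P, Q; split; [exact: P_move | | exact: PQ1].
exact: left_inverse_square card_moved PQ1.
Qed.

End Moves.

Section Reversal.
Variables (F : fieldType) (I : finType) (a : I -> nat).

Definition flip (x : bix a) : bix a := existT (fun i => 'I_(a i)) (tag x) (rev_ord (tagged x)).

Lemma flipK : involutive flip.
Proof. by case=> i p; rewrite /flip /= rev_ordK. Qed.

Lemma sim_flip (A B : 'M[F]_#|bix a|) :
  (forall x y, A (enum_rank y) (enum_rank x) = B (enum_rank (flip x)) (enum_rank (flip y))) ->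
  sim B A^T.
Proof.
move=> AB; apply: (@sim_bij _ _ _ _ _ (fun i => enum_rank (flip (enum_val i)))
  (fun i => enum_rank (flip (enum_val i)))) => [i|i|i j].
- by rewrite enum_rankK flipK enum_valK.
- by rewrite enum_rankK flipK enum_valK.
- by rewrite mxE -AB !enum_valK.
Qed.

Lemma Jord_flip x y :
  Jord F a (enum_rank y) (enum_rank x) = Jord F a (enum_rank (flip x)) (enum_rank (flip y)).
Proof.
rewrite !entE !ent_Jord ?pos_lt //= [tag y == _]eq_sym; congr _%:R%R.
case: x y => [i p] [j q]; rewrite /pos /=; have [eq_ij|//] := eqVneq i j.
by subst j; have := ltn_ord p; have := ltn_ord q; lia.
Qed.

End Reversal.

(** Transposition combined with the reversal of the positions in each block fixes the Jordan matrix
    and exchanges the two kinds of unit, so the claim follows from [sim_last_unit]. *)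
Lemma sim_first_unit (F : fieldType) (I : finType) (a : I -> nat) (j0 j1 : I) (s : F) :
  j0 != j1 -> 0 < a j0 -> a j0 <= a j1 ->
  (s != 0)%R -> sim (Jord F a + s *: first_unit F a j0 j1)%R (Jord F (moved a j0 j1)).
Proof.
move=> neq_j a0 le_a s0.
have sim1 : sim (Jord F a + s *: first_unit F a j0 j1)%R
    (Jord F a + s *: last_unit F a j0 j1)^T%R.
  have addE (M N : 'M[F]_#|bix a|) i j : (M + s *: N)%R i j = (M i j + s * N i j)%R.
    by rewrite !mxE.
  apply: sim_flip => x y; rewrite !addE Jord_flip.
  congr (_ + _ * _)%R; rewrite /first_unit /last_unit /blk !fmE; congr _%:R%R.
  case: x y => [i p] [j q]; rewrite /pos /=; move: (ltn_ord p) (ltn_ord q).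
  move: (nat_of_ord p) (nat_of_ord q) => {}p {}q.
  by case: eqP => [->|_]; case: eqP => [->|_] //=; lia.
apply: (sim_trans sim1); apply: (sim_trans (sim_tr (sim_last_unit neq_j a0 le_a s0))).
by apply: sim_sym; apply: sim_flip => x y; exact: Jord_flip.
Qed.

(** * Pieces and their orthogonality *)

(* A piece describes a triple (A, B, C) with A and B in Jordan form.  It lists the
   classes of the Jordan blocks of A (columns) and of B (rows): classes 0 and 1 are
   the sizes 1 and 2, class 3 is the maximal size, and class 2 is the only further
   size, which a general representation uses at most once.  A link (i, j, t) is an
   entry 1 of C in block (i, j), in the first column and the row numbered
   (height - 2 + t). *)
Definition cell : Type := (nat * nat * bool)%type.
Definition piece : Type := (seq nat * seq nat * seq cell)%type.

Definition cols (p : piece) : seq nat := p.1.1.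
Definition rows (p : piece) : seq nat := p.1.2.
Definition links (p : piece) : seq cell := p.2.

(* Implies, for all sizes of the classes 2 and 3, that the band of degree [tau] between
   Jordan blocks of classes [c] and [c'] commutes with them. *)
Definition hom_class (c c' : nat) (tau : bool) : bool :=
  (c' <= c) || [&& tau, c == 0 & c' == 1].

(** The product of an elementary band of degree [tau], from row block [i] to row block [i'], with
    the links of [p]: degrees add, and total degree 2 disappears. *)
Definition row_move (p : piece) (i' i : nat) (tau : bool) : seq cell :=
  [seq (i', l.1.2, l.2 || tau) | l <- links p & (l.1.1 == i) && ~~ (l.2 && tau)].

Definition col_move (q : piece) (j' j : nat) (tau : bool) : seq cell :=
  [seq (l.1.1, j, l.2 || tau) | l <- links q & (l.1.2 == j') && ~~ (l.2 && tau)].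

(** Generators of the image of the tangent map (Y, X) |-> Y C_p + C_q X, obtained from the
    elementary bands Y and X. *)
Definition moves (p q : piece) : seq (seq cell) :=
  flatten [seq
    [seq if hom_class (nth 0 (rows q) i') (nth 0 (rows p) i) tau
         then row_move p i' i tau else [::]
    | i' <- iota 0 (size (rows q)), i <- iota 0 (size (rows p))] ++
    [seq if hom_class (nth 0 (cols p) j) (nth 0 (cols q) j') tau
         then col_move q j' j tau else [::]
    | j' <- iota 0 (size (cols q)), j <- iota 0 (size (cols p))]
  | tau <- [:: false; true]].

Definition cells (p q : piece) : seq cell :=
  flatten [seq [seq ij <- [:: (i, j, false); (i, j, true)]
                | ij.2 || (0 < nth 0 (rows q) i) && (0 < nth 0 (cols p) j)]
          | i <- iota 0 (size (rows q)), j <- iota 0 (size (cols p))].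

(* Unit vectors are deduced one at a time, without division, so that the conclusion
   holds over every commutative ring. *)
Definition saturate_step (ms : seq (seq cell)) (known : seq cell) : seq cell :=
  foldl (fun known m => if [seq x <- m | x \notin known] is [:: x]
                        then x :: known else known) known ms.

(** Every number of rounds is sound, and further rounds could only enlarge the result; 4 is a choice
    of effort. *)
Definition reached (p q : piece) : seq cell :=
  iter 4 (saturate_step (moves p q)) [::].

Definition orthogonal (p q : piece) : bool :=
  all (mem (reached p q)) (cells p q).

(* The rank modulo 2.  It only serves to define the weight [wt] that decreases in
   [generic_pieces]; no meaning of it is used. *)
Fixpoint rank2 (n : nat) (vs : seq (seq cell)) : nat :=
  if n isn't n'.+1 then 0 else
  match vs with
  | [::] => 0
  | [::] :: vs' => rank2 n' vs'
  | ((x :: _) as v) :: vs' =>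
      (rank2 n' [seq if x \in w
                     then [seq y <- v | y \notin w] ++ [seq y <- w | y \notin v]
                     else w | w <- vs']).+1
  end.

(** Modelled on the codimension of the image of the tangent map over the field with two elements,
    that is, on the dimension of a relative Ext^1 with A and B kept fixed. *)
Definition ext2 (p q : piece) : nat :=
  size (cells p q) - rank2 (size (moves p q)) (moves p q).

(** The order of the first eight matters: the single row block of class c is at position 3 - c and
    the single column block at position 7 - c, and [generic_datum] starts from these. The classes of
    the blocks are symmetric under exchanging columns and rows, in accordance with the duality that
    transposes C. *)
Definition pieces : seq piece :=
  [::
  ([::], [:: 3], [::]);
  ([::], [:: 2], [::]);
  ([::], [:: 1], [::]);
  ([::], [:: 0], [::]);
  ([:: 3], [::], [::]);
  ([:: 2], [::], [::]);
  ([:: 1], [::], [::]);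
  ([:: 0], [::], [::]);
  ([:: 3], [:: 3], [:: (0, 0, false)]);
  ([:: 3], [:: 2], [:: (0, 0, false)]);
  ([:: 3], [:: 1], [:: (0, 0, false)]);
  ([:: 3], [:: 0], [:: (0, 0, true)]);
  ([:: 2], [:: 3], [:: (0, 0, false)]);
  ([:: 2], [:: 2], [:: (0, 0, false)]);
  ([:: 2], [:: 1], [:: (0, 0, false)]);
  ([:: 2], [:: 0], [:: (0, 0, true)]);
  ([:: 1], [:: 3], [:: (0, 0, false)]);
  ([:: 1], [:: 2], [:: (0, 0, false)]);
  ([:: 1], [:: 1], [:: (0, 0, false)]);
  ([:: 1], [:: 0], [:: (0, 0, true)]);
  ([:: 0], [:: 3], [:: (0, 0, true)]);
  ([:: 0], [:: 2], [:: (0, 0, true)]);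
  ([:: 0], [:: 1], [:: (0, 0, true)]);
  ([:: 0], [:: 0], [:: (0, 0, true)]);
  ([:: 3], [:: 0; 3], [:: (0, 0, true); (1, 0, false)]);
  ([:: 3], [:: 0; 2], [:: (0, 0, true); (1, 0, false)]);
  ([:: 2], [:: 0; 3], [:: (0, 0, true); (1, 0, false)]);
  ([:: 2], [:: 0; 2], [:: (0, 0, true); (1, 0, false)]);
  ([:: 1], [:: 0; 3], [:: (0, 0, true); (1, 0, false)]);
  ([:: 1], [:: 0; 2], [:: (0, 0, true); (1, 0, false)]);
  ([:: 0; 3], [:: 3], [:: (0, 0, true); (0, 1, false)]);
  ([:: 0; 3], [:: 2], [:: (0, 0, true); (0, 1, false)]);
  ([:: 0; 3], [:: 1], [:: (0, 0, true); (0, 1, false)]);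
  ([:: 0; 2], [:: 3], [:: (0, 0, true); (0, 1, false)]);
  ([:: 0; 2], [:: 2], [:: (0, 0, true); (0, 1, false)]);
  ([:: 0; 2], [:: 1], [:: (0, 0, true); (0, 1, false)]);
  ([:: 2; 3], [:: 0; 3], [:: (0, 0, true); (0, 1, true); (1, 0, false)]);
  ([:: 2; 3], [:: 0; 2], [:: (0, 0, true); (0, 1, true); (1, 0, false)]);
  ([:: 1; 3], [:: 0; 3], [:: (0, 0, true); (0, 1, true); (1, 0, false)]);
  ([:: 1; 3], [:: 0; 2], [:: (0, 0, true); (0, 1, true); (1, 0, false)]);
  ([:: 1; 2], [:: 0; 3], [:: (0, 0, true); (0, 1, true); (1, 0, false)]);
  ([:: 1; 2], [:: 0; 2], [:: (0, 0, true); (0, 1, true); (1, 0, false)]);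
  ([:: 0; 3], [:: 2; 3], [:: (0, 0, true); (0, 1, false); (1, 0, true)]);
  ([:: 0; 3], [:: 1; 3], [:: (0, 0, true); (0, 1, false); (1, 0, true)]);
  ([:: 0; 3], [:: 1; 2], [:: (0, 0, true); (0, 1, false); (1, 0, true)]);
  ([:: 0; 2], [:: 2; 3], [:: (0, 0, true); (0, 1, false); (1, 0, true)]);
  ([:: 0; 2], [:: 1; 3], [:: (0, 0, true); (0, 1, false); (1, 0, true)]);
  ([:: 0; 2], [:: 1; 2], [:: (0, 0, true); (0, 1, false); (1, 0, true)]);
  ([:: 2; 3], [:: 0; 2; 3], [:: (0, 0, true); (0, 1, true); (1, 0, false); (2, 1, false)]);
  ([:: 1; 3], [:: 0; 2; 3], [:: (0, 0, true); (0, 1, true); (1, 0, false); (2, 1, false)]);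
  ([:: 1; 2], [:: 0; 2; 3], [:: (0, 0, true); (0, 1, true); (1, 0, false); (2, 1, false)]);
  ([:: 0; 2; 3], [:: 2; 3], [:: (0, 0, true); (0, 1, false); (0, 2, false); (1, 1, false)]);
  ([:: 0; 2; 3], [:: 1; 3], [:: (0, 0, true); (0, 1, false); (0, 2, false); (1, 1, false)]);
  ([:: 0; 2; 3], [:: 1; 2], [:: (0, 0, true); (0, 1, false); (0, 2, false); (1, 1, false)]);
  ([:: 1; 2; 3], [:: 0; 2; 3], [:: (0, 0, true); (0, 1, true); (0, 2, true); (1, 0, false); (2, 1, false)]);
  ([:: 0; 2; 3], [:: 1; 2; 3],
    [:: (0, 0, true); (0, 1, false); (0, 2, false); (1, 1, false); (2, 0, true)]);
  ([:: 1; 2; 3], [:: 0; 0; 2; 3],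
    [:: (0, 0, true); (0, 1, true); (1, 0, true); (1, 2, true); (2, 0, false); (3, 1, false)]);
  ([:: 0; 0; 2; 3], [:: 1; 2; 3],
    [:: (0, 0, true); (0, 1, true); (0, 2, false); (1, 0, true); (1, 3, false); (2, 1, true)])].

Definition pc (i : nat) : piece := nth ([::], [::], [::]) pieces i.

Definition table (T : Type) (f : piece -> piece -> T) : seq (seq T) :=
  [seq [seq f p q | q <- pieces] | p <- pieces].

Definition candidates : seq nat := iota 0 (size pieces).

Definition orth_table := Eval vm_compute in
  table (fun p q => orthogonal p q && orthogonal q p).
Definition ext_table := Eval vm_compute in table (fun p q => ext2 p q + ext2 q p).

Definition orth (i j : nat) : bool := nth false (nth [::] orth_table i) j.
Definition ext (i j : nat) : nat := nth 0 (nth [::] ext_table i) j.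

Definition wt (L M : seq nat) : nat := sumn [seq sumn [seq ext i j | j <- M] | i <- L].

Definition all_cols (L : seq nat) : seq nat := flatten [seq cols (pc i) | i <- L].
Definition all_rows (L : seq nat) : seq nat := flatten [seq rows (pc i) | i <- L].

Definition admissible (L : seq nat) : bool :=
  (count_mem 2 (all_cols L) <= 1) && (count_mem 2 (all_rows L) <= 1).

Definition dim_vec (p : piece) : seq nat :=
  [seq count_mem c (cols p) | c <- iota 0 4] ++ [seq count_mem c (rows p) | c <- iota 0 4].

(* A search for pairwise orthogonal pieces with the dimensions [v]. *)
Fixpoint decompose (n : nat) (v : seq nat) (cand : seq nat) : seq nat :=
  if n isn't n'.+1 then [::] else
  (fix go (l : seq nat) : seq nat :=
    if l isn't i :: l' then [::] else
    let w := dim_vec (pc i) in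
    if w == v then [:: i] else
    if all2 leq w v then
      if decompose n' [seq x.1 - x.2 | x <- zip v w] [seq j <- l | orth i j] is (_ :: _) as R
      then i :: R else go l'
    else go l') cand.

(** One order of each pair suffices, since weight and orthogonality are symmetric; the fuel 6 bounds
    the number of pieces in a replacement. Nothing is assumed of the search, as [improvementP]
    checks its results. *)
Definition improvement_table := Eval vm_compute in
  [seq [seq if (i < j) && ~~ orth i j && admissible [:: i; j] then
    decompose 6 [seq x.1 + x.2 | x <- zip (dim_vec (pc i)) (dim_vec (pc j))] candidates
    else [::] | j <- candidates] | i <- candidates].

Definition improvement (i j : nat) : seq nat := nth [::] (nth [::] improvement_table i) j.

Definition ext_sum (L : seq nat) : seq nat :=
  foldr (fun i v => [seq x.1 + x.2 | x <- zip (nth [::] ext_table i) v])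
    (nseq (size pieces) 0) L.

(** Comparing the two vectors [ext_sum] replaces a comparison against all lists of further
    pieces. *)
Definition improves (L R : seq nat) : bool :=
  [&& all (gtn (size pieces)) R, perm_eq (all_cols R) (all_cols L),
      perm_eq (all_rows R) (all_rows L), wt R R < wt L L &
      all2 leq (ext_sum R) (ext_sum L)].

Lemma orth_tableP : all (fun i => all (fun j =>
  orth i j ==> orthogonal (pc i) (pc j)) candidates) candidates.
Proof. vm_cast_no_check (erefl true). Qed.

(** Each piece is rigid: repetitions of one piece never obstruct, so improvements concern distinct
    pieces only. *)
Lemma orth_refl : all (fun i => orth i i) candidates.
Proof. vm_cast_no_check (erefl true). Qed.

(** The finite core of the proof. Pairs with two columns or two rows of class 2 are exempt, because
    they cannot occur in an admissible list. *)
Lemma improvementP : all (fun i => all (fun j => (j <= i) || orth i j ||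
  (admissible [:: i; j] ==> improves [:: i; j] (improvement i j))) candidates) candidates.
Proof. vm_cast_no_check (erefl true). Qed.

Lemma ext_tables_sym : all (fun i => all (fun j =>
  (orth i j == orth j i) && (ext i j == ext j i)) candidates) candidates.
Proof. vm_cast_no_check (erefl true). Qed.

Lemma size_ext_table : all (fun r => size r == size pieces) ext_table.
Proof. vm_cast_no_check (erefl true). Qed.

Lemma candidateP i : (i \in candidates) = (i < size pieces).
Proof. by rewrite mem_iota. Qed.

Lemma orth_sym i j : i \in candidates -> j \in candidates -> orth i j = orth j i.
Proof.
by move=> ci cj; have /andP[/eqP] := allP (allP ext_tables_sym i ci) j cj.
Qed.

Lemma ext_sym i j : i \in candidates -> j \in candidates -> ext i j = ext j i.
Proof.
by move=> ci cj; have /andP[_ /eqP] := allP (allP ext_tables_sym i ci) j cj.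
Qed.

Lemma ext_sumE L j : all (mem candidates) L -> j \in candidates ->
  nth 0 (ext_sum L) j = wt L [:: j].
Proof.
move=> + cj; rewrite candidateP in cj.
suff: all (mem candidates) L ->
    size (ext_sum L) = size pieces /\ nth 0 (ext_sum L) j = wt L [:: j].
  by move=> H /H[].
elim: L => [|i L IHL]; first by rewrite size_nseq nth_nseq cj.
case/andP=> ci /IHL[sL nL].
rewrite -[ext_sum (i :: L)]/[seq x.1 + x.2 | x <- zip (nth [::] ext_table i) (ext_sum L)].
have sr : size (nth [::] ext_table i) = size pieces.
  by apply/eqP/(allP size_ext_table)/mem_nth; rewrite -candidateP.
have sz : size (zip (nth [::] ext_table i) (ext_sum L)) = size pieces.
  by rewrite size_zip sr sL minnn.
rewrite size_map sz (nth_map (0, 0)) ?sz // nth_zip ?sr ?sL //= nL.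
by split; rewrite // /wt /= addn0.
Qed.

Lemma wt_cons_r L i M : wt L (i :: M) = wt L [:: i] + wt L M.
Proof.
rewrite /wt; elim: L => //= x L ->.
by rewrite addn0 addnACA.
Qed.

Lemma wt_catl L L' M : wt (L ++ L') M = wt L M + wt L' M.
Proof. by rewrite /wt map_cat sumn_cat. Qed.

Lemma wt_catr L M M' : wt L (M ++ M') = wt L M + wt L M'.
Proof.
rewrite /wt; elim: L => //= x L ->.
by rewrite map_cat sumn_cat addnACA.
Qed.

Lemma wt_nil L : wt L [::] = 0.
Proof. by rewrite /wt; elim: L. Qed.

Lemma wt_sym L M : all (mem candidates) L -> all (mem candidates) M -> wt L M = wt M L.
Proof.
move=> cL cM; elim: L cL => [_|i L IHL /andP[ci cL]]; first by rewrite wt_nil.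
rewrite wt_cons_r -(IHL cL) -cat1s wt_catl; congr (_ + _).
rewrite /wt /= addn0; congr sumn; elim: {L IHL cL} M cM => [//|j M IHM /andP[cj /IHM]] /= ->.
by rewrite addn0 ext_sym.
Qed.

Lemma wt_perm L L' : perm_eq L L' -> wt L L = wt L' L'.
Proof.
move=> LL'; rewrite /wt; have -> : [seq sumn [seq ext i j | j <- L] | i <- L] =
  [seq sumn [seq ext i j | j <- L'] | i <- L].
  by apply: eq_map => i; apply/perm_sumn/perm_map.
exact/perm_sumn/perm_map.
Qed.

Lemma admissible_perm L L' : perm_eq L L' -> admissible L = admissible L'.
Proof.
move=> LL'; rewrite /admissible /all_cols /all_rows.
by rewrite !(permP (perm_flatten (perm_map _ LL'))).
Qed.

Lemma all_cols_cat L L' : all_cols (L ++ L') = all_cols L ++ all_cols L'.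
Proof. by rewrite /all_cols map_cat flatten_cat. Qed.

Lemma all_rows_cat L L' : all_rows (L ++ L') = all_rows L ++ all_rows L'.
Proof. by rewrite /all_rows map_cat flatten_cat. Qed.

Lemma admissible_cat L L' : admissible (L ++ L') -> admissible L.
Proof.
rewrite /admissible !all_cols_cat !all_rows_cat !count_cat.
by case/andP=> a b; rewrite (leq_trans (leq_addr _ _) a) (leq_trans (leq_addr _ _) b).
Qed.

(** The weight is a symmetric bilinear form on lists of pieces: the cross terms with [K] are bounded
    piece by piece through [ext_sum], and strictness comes from the diagonal term. *)
Lemma improves_wt L R K : improves L R -> all (mem candidates) L ->
  all (mem candidates) K -> wt (R ++ K) (R ++ K) < wt (L ++ K) (L ++ K).
Proof.
case/and5P=> ltR _ _ lt_RL le_RL candL candK.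
have candR : all (mem candidates) R.
  by apply/allP => i /(allP ltR) /=; rewrite candidateP.
have wtRL c : c \in candidates -> wt R [:: c] <= wt L [:: c].
  move=> cc; rewrite -!ext_sumE //.
  elim: (ext_sum R) (ext_sum L) c {cc} le_RL => [|x s IHs] [|y t] [|c] //=.
    by case/andP.
  by case/andP=> _ /IHs.
have {}wtRL : wt R K <= wt L K.
  elim: K candK => [_|c K IHK /= /andP[cc /IHK leK]].
    by rewrite !wt_nil.
  by rewrite (wt_cons_r R) (wt_cons_r L); exact: leq_add (wtRL _ cc) leK.
rewrite !wt_catl !wt_catr (wt_sym candK candR) (wt_sym candK candL) -!addnA -addSn leq_add //.
by rewrite leq_add // leq_add2r.
Qed.

(* Replacing a non-orthogonal pair by orthogonal pieces with the same blocks does not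
   increase the weight against any other piece and lowers the total weight. *)
Lemma generic_pieces L : all (mem candidates) L -> admissible L ->
  exists L', [/\ all (mem candidates) L', perm_eq (all_cols L') (all_cols L),
    perm_eq (all_rows L') (all_rows L) & {in L' &, forall i j, orth i j}].
Proof.
have [n] := ubnP (wt L L); elim: n L => // n IHn L lt_n candL admL.
have [/allP orthL|] := boolP (all (fun i => all (fun j => orth i j) L) L).
  by exists L; split=> // i j iL jL; exact: (allP (orthL i iL)).
case/allPn=> i0 i0L /allPn[j0 j0L nij0].
have [i [j [iL jL lt_ij nij]]] :
    exists i j, [/\ i \in L, j \in L, i < j & ~~ orth i j].
  have [lt_ij|lt_ji|eq_ij] := ltngtP i0 j0; first by exists i0, j0.
    exists j0, i0; split=> //; rewrite orth_sym //; exact: (allP candL).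
  by case/negP: nij0; rewrite -eq_ij; apply: (allP orth_refl); exact: (allP candL).
have [ci cj] := (allP candL i iL, allP candL j jL).
pose K := rem j (rem i L).
have LK : perm_eq L ([:: i; j] ++ K).
  rewrite (perm_trans (perm_to_rem iL)) //= perm_cons perm_to_rem //.
  by have := jL; rewrite (perm_mem (perm_to_rem iL)) inE gtn_eqF.
have candK : all (mem candidates) K.
  by move: candL; rewrite (perm_all _ LK) all_cat => /andP[].
have admK : admissible ([:: i; j] ++ K) by rewrite -(admissible_perm LK).
have := allP (allP improvementP i ci) j cj.
rewrite (admissible_cat admK) (negPf nij) leqNgt lt_ij /=.
move: (improvement i j) => R impR.
have lt_R := improves_wt impR _ candK.
have /and5P[ltR colR rowR _ _] := impR.
have candR : all (mem candidates) R.
  by apply/allP => c /(allP ltR) /=; rewrite candidateP.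
have [|||L' [candL' colL' rowL' orthL']] := IHn (R ++ K).
- by rewrite -ltnS (leq_trans _ lt_n) // ltnS (wt_perm LK) lt_R //; apply/and3P.
- by rewrite all_cat candR.
- move: admK; rewrite /admissible.
  rewrite !(all_cols_cat _ K) !(all_rows_cat _ K).
  by rewrite !(count_cat _ _ (all_cols K)) !(count_cat _ _ (all_rows K)) (permP colR) (permP rowR).
have catE (f : piece -> seq nat) : perm_eq (flatten [seq f (pc i) | i <- R])
    (flatten [seq f (pc i) | i <- [:: i; j]]) ->
  perm_eq (flatten [seq f (pc i) | i <- R ++ K]) (flatten [seq f (pc i) | i <- L]).
  move=> fR; rewrite perm_sym (perm_trans (perm_flatten (perm_map _ LK))) //.
  by rewrite !map_cat !flatten_cat perm_cat2r perm_sym.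
by exists L'; split=> //; [apply: perm_trans colL' _ | apply: perm_trans rowL' _]; apply: catE.
Qed.

(** Links are natural numbers, so that one datum gives a matrix C over every ring. *)
Record datum := Datum {
  dcol : finType;
  drow : finType;
  dcol_size : dcol -> nat;
  drow_size : drow -> nat;
  dlink : drow -> dcol -> bool -> nat }.

(** * Surjectivity of the tangent map *)

Section Tangent.
Local Open Scope ring_scope.

Definition lk (R : comNzRingType) (D : datum) (i : drow D) (j : dcol D) (t : bool) : R :=
  (dlink i j t)%:R.

Definition in_span (R : comNzRingType) (D D' : datum) (h : drow D' -> dcol D -> bool -> R) :=
  exists (y : drow D' -> drow D -> bool -> R) (x : dcol D' -> dcol D -> bool -> R),
    [/\ supported (@drow_size D) (@drow_size D') y,
        supported (@dcol_size D') (@dcol_size D) (fun j i => x i j) &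
        forall i j t, h i j t = \sum_k band_conv (y i k) (lk R k j) t
                              + \sum_k band_conv (lk R i k) (x k j) t].

(** All commutative rings are allowed because [curve_lift] applies the condition over an integral
    domain, in practice a polynomial ring, to the error term of an approximation. *)
Definition tangent (D D' : datum) : Prop :=
  forall (R : comNzRingType) (h : drow D' -> dcol D -> bool -> R),
    (forall i j, ~~ ((1 < dcol_size j)%N && (1 < drow_size i)%N) -> h i j false = 0) ->
    in_span h.

Lemma band_conv0l (R : comNzRingType) (v : bool -> R) t : band_conv (fun=> 0) v t = 0.
Proof. by rewrite /band_conv !mul0r; case: t; rewrite addr0. Qed.

Lemma band_conv0r (R : comNzRingType) (u : bool -> R) t : band_conv u (fun=> 0) t = 0.
Proof. by rewrite /band_conv !mulr0; case: t; rewrite addr0. Qed.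

Lemma band_convDl (R : comNzRingType) (u u' v : bool -> R) t :
  band_conv (fun t => u t + u' t) v t = band_conv u v t + band_conv u' v t.
Proof. by rewrite /band_conv; case: t; rewrite /= !mulrDl ?addr0 // addrACA. Qed.

Lemma band_convDr (R : comNzRingType) (u v v' : bool -> R) t :
  band_conv u (fun t => v t + v' t) t = band_conv u v t + band_conv u v' t.
Proof. by rewrite /band_conv; case: t; rewrite /= !mulrDr ?addr0 // addrACA. Qed.

Lemma band_convZl (R : comNzRingType) c (u v : bool -> R) t :
  band_conv (fun t => c * u t) v t = c * band_conv u v t.
Proof. by rewrite /band_conv; case: t; rewrite /= mulrDr !mulrA ?mulr0. Qed.

Lemma band_convZr (R : comNzRingType) c (u v : bool -> R) t :
  band_conv u (fun t => c * v t) t = c * band_conv u v t.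
Proof. by rewrite /band_conv; case: t; rewrite /= mulrDr ![u _ * (c * _)]mulrCA ?mulr0. Qed.

Section Span.
Variables (R : comNzRingType) (D D' : datum).
Implicit Type h : drow D' -> dcol D -> bool -> R.

Lemma in_span_ext h h' : (forall i j t, h i j t = h' i j t) -> in_span h -> in_span h'.
Proof. by move=> hh' [y [x [y0 x0 hE]]]; exists y, x; split=> // i j t; rewrite -hh'. Qed.

Lemma in_span0 : @in_span R D D' (fun _ _ _ => 0).
Proof.
exists (fun _ _ _ => 0), (fun _ _ _ => 0); split=> // i j t.
rewrite !big1 ?addr0 // => k _; first exact: (band_conv0r (lk R i k)).
exact: (band_conv0l (lk R k j)).
Qed.

Lemma in_spanD h h' : in_span h -> in_span h' -> in_span (fun i j t => h i j t + h' i j t).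
Proof.
move=> [y [x [y0 x0 hE]]] [y' [x' [y0' x0' hE']]].
exists (fun i j t => y i j t + y' i j t), (fun i j t => x i j t + x' i j t); split.
- by move=> i j t ns; rewrite y0 ?y0' ?addr0.
- by move=> i j t ns; rewrite x0 ?x0' ?addr0.
move=> i j t; rewrite hE hE' addrACA -!big_split /=; congr (_ + _); apply: eq_bigr => k _; symmetry.
  exact: (band_convDl (y i k) (y' i k)).
exact: (band_convDr _ (x k j) (x' k j)).
Qed.

Lemma in_spanZ h c : in_span h -> in_span (fun i j t => c * h i j t).
Proof.
move=> [y [x [y0 x0 hE]]].
exists (fun i j t => c * y i j t), (fun i j t => c * x i j t); split.
- by move=> i j t ns; rewrite y0 ?mulr0.
- by move=> i j t ns; rewrite x0 ?mulr0.
move=> i j t; rewrite hE mulrDr !mulr_sumr; congr (_ + _); apply: eq_bigr => k _; symmetry.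
  exact: (band_convZl c (y i k)).
exact: (band_convZr c _ (x k j)).
Qed.

Lemma in_span_sum (T : Type) (s : seq T) (H : T -> drow D' -> dcol D -> bool -> R) :
  (forall e, in_span (H e)) -> in_span (fun i j t => \sum_(e <- s) H e i j t).
Proof.
move=> spanH; elim: s => [|e s IHs].
  by apply: in_span_ext in_span0 => i j t; rewrite big_nil.
by apply: in_span_ext (in_spanD (spanH e) IHs) => i j t; rewrite big_cons.
Qed.

End Span.

Definition dnil : datum :=
  @Datum void void (fun=> 0%N) (fun=> 0%N) (fun _ _ _ => 0%N).

Definition dsum (D D' : datum) : datum :=
  @Datum (dcol D + dcol D')%type (drow D + drow D')%type
    (fun j => match j with inl j => dcol_size j | inr j => dcol_size j end)
    (fun i => match i with inl i => drow_size i | inr i => drow_size i end)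
    (fun i j t => match i, j with
       | inl i, inl j => dlink i j t | inr i, inr j => dlink i j t | _, _ => 0%N end).

Lemma tangent_nil_l D : tangent dnil D.
Proof.
by move=> R h _; exists (fun _ _ _ => 0), (fun _ _ _ => 0); split=> // i [].
Qed.

Lemma tangent_nil_r D : tangent D dnil.
Proof. by move=> R h _; exists (fun _ _ _ => 0), (fun _ _ _ => 0); split=> // -[]. Qed.

(** The link matrix of a sum is block diagonal, so the equations for different summands share no
    unknowns. This is why orthogonality of pairs of pieces suffices for a whole list. *)
Lemma tangent_sum_l D D' E : tangent D E -> tangent D' E -> tangent (dsum D D') E.
Proof.
move=> tD tD' R h h0.
have [i j|y [x [y0 x0 hE]]] := tD R (fun i j => h i (inl j)); first exact: (h0 i (inl j)).
have [i j|y' [x' [y0' x0' hE']]] := tD' R (fun i j => h i (inr j)); first exact: (h0 i (inr j)).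
exists (fun i k => match k with inl k => y i k | inr k => y' i k end).
exists (fun k j => match j with inl j => x k j | inr j => x' k j end).
split=> [i [k|k] t|[j|j] k t|i [j|j] t]; rewrite ?big_sumType /=.
- exact: y0.
- exact: y0'.
- exact: x0.
- exact: x0'.
- rewrite hE; congr (_ + _); rewrite [X in _ = _ + X]big1 ?addr0 // => k _.
  exact: (band_conv0r (y' i k)).
- rewrite hE'; congr (_ + _); rewrite [X in _ = X + _]big1 ?add0r // => k _.
  exact: (band_conv0r (y i k)).
Qed.

Lemma tangent_sum_r D E E' : tangent D E -> tangent D E' -> tangent D (dsum E E').
Proof.
move=> tE tE' R h h0.
have [i j|y [x [y0 x0 hE]]] := tE R (fun i j => h (inl i) j); first exact: (h0 (inl i) j).
have [i j|y' [x' [y0' x0' hE']]] := tE' R (fun i j => h (inr i) j); first exact: (h0 (inr i) j).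
exists (fun i k => match i with inl i => y i k | inr i => y' i k end).
exists (fun k j => match k with inl k => x k j | inr k => x' k j end).
split=> [[i|i] k t|j [k|k] t|[i|i] j t]; rewrite ?big_sumType /=.
- exact: y0.
- exact: y0'.
- exact: x0.
- exact: x0'.
- rewrite hE; congr (_ + _); rewrite [X in _ = _ + X]big1 ?addr0 // => k _.
  exact: (band_conv0l (x' k j)).
- rewrite hE'; congr (_ + _); rewrite [X in _ = X + _]big1 ?add0r // => k _.
  exact: (band_conv0l (x k j)).
Qed.

Definition wf_datum (D : datum) : Prop :=
  [/\ forall j : dcol D, (0 < dcol_size j)%N, forall i : drow D, (0 < drow_size i)%N &
      forall (i : drow D) (j : dcol D),
        ~~ ((1 < dcol_size j)%N && (1 < drow_size i)%N) -> dlink i j false = 0%N].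

Lemma wf_nil : wf_datum dnil.
Proof. by split=> -[]. Qed.

Lemma wf_sum D D' : wf_datum D -> wf_datum D' -> wf_datum (dsum D D').
Proof.
move=> [a b c] [a' b' c']; split=> [[j|j]|[i|i]|[i|i] [j|j]] //=.
- exact: c.
- exact: c'.
Qed.

Definition link_mx (R : comNzRingType) (D : datum) :=
  bands (@dcol_size D) (@drow_size D) (@lk R D).

Lemma tangent_mx (R : comNzRingType) D D' (C : 'M[R]_(#|bix (@drow_size D')|, #|bix (@dcol_size D)|)) :
  wf_datum D -> wf_datum D' -> tangent D D' ->
  C *m Jord R _ = Jord R _ *m C -> Jord R _ *m (Jord R _ *m C) = 0 ->
  exists (Y : 'M[R]_(#|bix (@drow_size D')|, #|bix (@drow_size D)|))
         (X : 'M[R]_(#|bix (@dcol_size D')|, #|bix (@dcol_size D)|)),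
    [/\ Y *m Jord R _ = Jord R _ *m Y, X *m Jord R _ = Jord R _ *m X &
        C = Y *m link_mx R D + link_mx R D' *m X].
Proof.
move=> [a0 b0 l0] [a0' b0' l0'] tDD' CJ JJC.
have [h Ch h0] := bandsP a0 CJ JJC; subst C.
have [y [x [ys xs hE]]] := tDD' R h h0.
exists (row_bands _ _ y), (col_bands _ _ x); split.
- exact: row_bands_Jord.
- exact: col_bands_Jord.
rewrite mul_row_bands // ?mul_bands_col //; last 2 first.
- by move=> i j ns; rewrite /lk l0'.
- by move=> i j ns; rewrite /lk l0.
apply: entP => i p j q lt_p lt_q; rewrite entD !ent_blk // -big_split /=.
by apply: eq_bigr => t _; rewrite hE mulrDl.
Qed.

End Tangent.

Section PieceDatum.
Variables sa sb : nat -> nat.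

(** All that the verification of the pieces uses about the actual block sizes; hence one table
    serves all m, n and all intermediate sizes. *)
Definition size_fun (s : nat -> nat) : Prop :=
  [/\ s 0 = 1, s 1 = 2 & {homo s : c c' / c <= c'}].

Definition piece_datum (p : piece) : datum :=
  @Datum 'I_(size (cols p)) 'I_(size (rows p))
    (fun j => sa (nth 0 (cols p) j)) (fun i => sb (nth 0 (rows p) i))
    (fun i j t => count_mem (i : nat, j : nat, t) (links p)).

Hypotheses (sa_fun : size_fun sa) (sb_fun : size_fun sb).

Lemma size_fun_gt0 s c : size_fun s -> 0 < s c.
Proof. by case=> s0 _ mono; rewrite -[X in X <= _]s0 mono. Qed.

Lemma size_fun_gt1 s c : size_fun s -> (1 < s c) = (0 < c).
Proof.
case=> s0 s1 mono; case: c => [|c]; first by rewrite s0.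
by rewrite -[X in X <= _]s1 mono.
Qed.

Lemma hom_class_size s c c' (t : bool) : size_fun s -> hom_class c c' t -> s c' <= s c + t.
Proof.
case=> s0 s1 mono /orP[le|/and3P[-> /eqP-> /eqP->]]; last by rewrite s0 s1.
by rewrite (leq_trans (mono _ _ le)) ?leq_addr.
Qed.

Local Open Scope ring_scope.

Definition cell_array (R : comNzRingType) m n (s : seq cell) (i : 'I_m) (j : 'I_n) (t : bool) : R :=
  (count_mem (i : nat, j : nat, t) s)%:R.

Lemma count_row_move p i' i tau (i1 : nat) j t :
  count_mem (i1, j, t) (row_move p i' i tau) =
  ((i1 == i') * (if tau then t * count_mem (i, j, false) (links p)
                 else count_mem (i, j, t) (links p)))%N.
Proof.
rewrite count_map count_filter; have [->|neq] := eqVneq i1 i'; last first.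
  rewrite mul0n (eq_count (a2 := pred0)) ?count_pred0 // => l /=.
  by rewrite !xpair_eqE eq_sym (negPf neq).
rewrite mul1n; case: tau; last first.
  apply: eq_count => -[[x y] u] /=; rewrite !xpair_eqE eqxx orbF /=.
  by case: (x == i); case: (y == j); case: (u == t); rewrite ?andbF.
case: t; rewrite ?mul0n ?mul1n.
  apply: eq_count => -[[x y] u] /=; rewrite !xpair_eqE eqxx orbT andbT /= eqbF_neg.
  by case: (x == i); case: (y == j); case: u.
rewrite (eq_count (a2 := pred0)) ?count_pred0 // => -[[x y] u] /=.
by rewrite !xpair_eqE orbT !andbF.
Qed.

Lemma count_col_move q j' j tau i (j1 : nat) t :
  count_mem (i, j1, t) (col_move q j' j tau) =
  ((j1 == j) * (if tau then t * count_mem (i, j', false) (links q)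
                 else count_mem (i, j', t) (links q)))%N.
Proof.
rewrite count_map count_filter; have [->|neq] := eqVneq j1 j; last first.
  rewrite mul0n (eq_count (a2 := pred0)) ?count_pred0 // => l /=.
  by rewrite !xpair_eqE [j == _]eq_sym (negPf neq) andbF.
rewrite mul1n; case: tau; last first.
  apply: eq_count => -[[x y] u] /=; rewrite !xpair_eqE eqxx orbF /= !andbF !andbT.
  by case: (x == i); case: (y == j'); case: (u == t); rewrite ?andbF.
case: t; rewrite ?mul0n ?mul1n.
  apply: eq_count => -[[x y] u] /=; rewrite !xpair_eqE eqxx orbT !andbT /= eqbF_neg.
  by case: (x == i); case: (y == j'); case: u.
rewrite (eq_count (a2 := pred0)) ?count_pred0 // => -[[x y] u] /=.
by rewrite !xpair_eqE orbT !andbF.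
Qed.

Section Soundness.
Variables (R : comNzRingType) (p q : piece).
Let D := piece_datum p.
Let D' := piece_datum q.

Lemma row_move_span i' i tau : (i' < size (rows q))%N -> (i < size (rows p))%N ->
  hom_class (nth 0%N (rows q) i') (nth 0%N (rows p) i) tau ->
  @in_span R D D' (cell_array R (row_move p i' i tau)).
Proof.
move=> lt_i' lt_i hom; pose k0 : drow D := Ordinal lt_i.
exists (fun (i1 : 'I_(size (rows q))) (k : 'I_(size (rows p))) t =>
  ((i1 == i' :> nat) && (k == i :> nat) && (t == tau))%:R), (fun _ _ _ => 0).
split=> [i1 k t||i1 j t].
- move=> ns; case: eqP => //= e1; case: eqP => //= e2; case: eqP => //= e3.
  by case/negP: ns; rewrite /= e1 e2 e3; exact: hom_class_size.
- by [].
rewrite [X in _ = _ + X]big1 ?addr0 => [|k _]; last exact: (band_conv0r (lk R i1 k)).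
rewrite (sum_pick_fin (k := k0)) => [|k neq]; last first.
  have /negPf -> : (k : nat) != i by apply: contraNneq neq => eq_k; apply/eqP/val_inj.
  by rewrite andbF; exact: (band_conv0l (lk R k j)).
rewrite /cell_array count_row_move /band_conv /lk /= eqxx andbT natrM.
case: eqP => _ /=; last by rewrite !mul0r; case: t; rewrite addr0.
by case: tau hom; case: t => _ /=; rewrite ?(mul0r, mul1r, add0r, addr0, mul0n, mul1n).
Qed.

Lemma col_move_span j' j tau : (j' < size (cols q))%N -> (j < size (cols p))%N ->
  hom_class (nth 0%N (cols p) j) (nth 0%N (cols q) j') tau ->
  @in_span R D D' (cell_array R (col_move q j' j tau)).
Proof.
move=> lt_j' lt_j hom; pose k0 : dcol D' := Ordinal lt_j'.
exists (fun _ _ _ => 0), (fun (k : 'I_(size (cols q))) (j1 : 'I_(size (cols p))) t =>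
  ((j1 == j :> nat) && (k == j' :> nat) && (t == tau))%:R).
split=> [|j1 k t ns|i j1 t]; first by [].
  case: eqP => //= e1; case: eqP => //= e2; case: eqP => //= e3.
  by case/negP: ns; rewrite /= e1 e2 e3; exact: hom_class_size.
rewrite [X in _ = X + _]big1 ?add0r => [|k _]; last exact: (band_conv0l (lk R k j1)).
rewrite (sum_pick_fin (k := k0)) => [|k neq]; last first.
  have /negPf -> : (k : nat) != j' by apply: contraNneq neq => eq_k; apply/eqP/val_inj.
  by rewrite andbF; exact: (band_conv0r (lk R i k)).
rewrite /cell_array count_col_move /band_conv /lk /= eqxx andbT natrM.
case: eqP => _ /=; last by rewrite !mulr0 mul0r; case: t; rewrite addr0.
by case: tau hom; case: t => _ /=; rewrite ?(mul0r, mulr0, mulr1, mul1r, add0r, addr0, mul0n, mul1n).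
Qed.

Lemma moves_span m : m \in moves p q -> @in_span R D D' (cell_array R m).
Proof.
have nil_span : @in_span R D D' (cell_array R [::]) by apply: in_span_ext (@in_span0 R D D').
case/flatten_mapP=> tau _; rewrite mem_cat => /orP[]; case/allpairsP=> -[x y] /= [].
  rewrite !mem_iota /= => lt_x lt_y ->; case: ifP => // hom; exact: row_move_span.
rewrite !mem_iota /= => lt_x lt_y ->; case: ifP => // hom; exact: col_move_span.
Qed.

Lemma mem_cells (i : 'I_(size (rows q))) (j : 'I_(size (cols p))) t :
  (i : nat, j : nat, t) \in cells p q =
  t || (0 < nth 0 (rows q) i)%N && (0 < nth 0 (cols p) j)%N.
Proof.
apply/flattenP/idP => [[s /allpairsP[[i1 j1] /= [_ _ ->]]]|ok].
  by case: ifP; rewrite !inE !xpair_eqE; case: t => //;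
    rewrite !andbF ?orbF // => + /andP[/andP[/eqP-> /eqP->]].
exists [seq ij <- [:: (i : nat, j : nat, false); (i : nat, j : nat, true)]
         | ij.2 || (0 < nth 0%N (rows q) i)%N && (0 < nth 0%N (cols p) j)%N].
  by apply/allpairsP; exists (i : nat, j : nat); split; rewrite ?mem_iota /= ?ltn_ord.
by rewrite mem_filter /= ok !inE; case: t {ok}; rewrite eqxx ?orbT.
Qed.

Lemma cell_array_seq m n (s : seq cell) (i : 'I_m) (j : 'I_n) t :
  cell_array R s i j t = \sum_(x <- s) cell_array R [:: x] i j t.
Proof.
rewrite /cell_array; elim: s => [|x s IHs]; first by rewrite big_nil.
by rewrite big_cons -IHs -natrD /= addn0.
Qed.

Lemma saturate_span ms known :
  (forall m, m \in ms -> @in_span R D D' (cell_array R m)) ->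
  (forall x, x \in known -> @in_span R D D' (cell_array R [:: x])) ->
  forall x, x \in saturate_step ms known -> @in_span R D D' (cell_array R [:: x]).
Proof.
elim: ms known => //= m ms IHms known span_ms span_known.
apply: IHms => [m' m'ms|]; first by apply: span_ms; rewrite inE m'ms orbT.
case E: [seq x <- m | x \notin known] => [|x [|y s]] // z; rewrite inE => /orP[/eqP->|/span_known//].
have span_m : @in_span R D D' (cell_array R m) by apply: span_ms; rewrite mem_head.
have span_rest : @in_span R D D' (fun i j t =>
    \sum_(e <- [seq e <- m | e \in known]) (if e \in known then cell_array R [:: e] i j t else 0)).
  apply: (@in_span_sum R D D' _ _ (fun e i j t => if e \in known then cell_array R [:: e] i j t else 0)).
  by move=> e; case: (boolP (e \in known)) => [e_known|_]; [exact: span_known | exact: in_span0].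
(* The only cell of [m] that is not yet known occurs in it once, so its unit vector is [m] minus the
   known cells of [m]. *)
apply: in_span_ext (in_spanD span_m (in_spanZ (-1) span_rest)) => i j t.
rewrite mulN1r (cell_array_seq m) (bigID (mem known)) /=.
rewrite -[X in _ + X - _]big_filter E big_seq1 addrAC big_filter.
rewrite [X in _ - X](eq_bigr (fun e => cell_array R [:: e] i j t)) ?subrr ?add0r //.
by move=> e ->.
Qed.

Lemma orthogonal_tangent_span (h : drow D' -> dcol D -> bool -> R) : orthogonal p q ->
  (forall i j, ~~ ((1 < dcol_size j)%N && (1 < drow_size i)%N) -> h i j false = 0) ->
  in_span h.
Proof.
move=> /allP orth_pq h0.
have span_reached : forall n x, x \in iter n (saturate_step (moves p q)) [::] ->
    @in_span R D D' (cell_array R [:: x]).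
  by elim=> [//|n IHn] x; apply: saturate_span; [exact: moves_span | exact: IHn].
have span_cell : forall x : 'I_(size (rows q)) * 'I_(size (cols p)) * bool,
    @in_span R D D' (fun i j t => h x.1.1 x.1.2 x.2 *
       cell_array R [:: (x.1.1 : nat, x.1.2 : nat, x.2)] i j t).
  move=> [[i j] t] /=; have [cell_ij|] := boolP ((i : nat, j : nat, t) \in cells p q).
    by apply: in_spanZ; apply: (span_reached 4%N); exact: (orth_pq _ cell_ij).
  move=> ncell; apply: in_span_ext (@in_span0 R D D') => i1 j1 t1.
  suff -> : h i j t = 0 by rewrite mul0r.
  case: t ncell => [|ncell]; first by rewrite mem_cells.
  by apply: h0; rewrite /= !size_fun_gt1 // andbC; apply: contraNN ncell; rewrite mem_cells.
apply: in_span_ext (@in_span_sum R D D' _ (index_enum _) _ span_cell) => i j t.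
rewrite (bigD1 (i, j, t)) //= /cell_array /= eqxx mulr1 big1 ?addr0 // => -[[i1 j1] t1] /= neq.
rewrite !xpair_eqE (inj_eq val_inj) (inj_eq val_inj) -!xpair_eqE (negPf neq).
by rewrite mulr0.
Qed.

End Soundness.
End PieceDatum.

(** * Generic points and orbit closures *)

Section FractionLift.
Local Open Scope ring_scope.
Variable R : idomainType.

Lemma fracP (x : {fraction R}) : exists nd : R * R, nd.2 != 0 /\ x = tofrac nd.1 / tofrac nd.2.
Proof.
have [r ->] : exists r : {ratio R}, x = \pi_({fraction R})%qT r by exists (repr x); rewrite reprK.
exists (\n_r, \d_r); have d0 := denom_ratioP r; split=> //=.
apply: (canRL (mulfK _)); first by rewrite tofrac_eq0.
rewrite !piE; apply/eqP; rewrite FracField.equivf_def.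
by rewrite /FracField.mulf !numden_Ratio ?mulr1 ?oner_neq0 // mulrC.
Qed.

Definition fracnd (x : {fraction R}) : R * R := projT1 (cid (fracP x)).

Variables (F : fieldType) (phi : {rmorphism R -> F}).
Hypothesis phi_inj : forall x, phi x = 0 -> x = 0.

Definition frac_lift (x : {fraction R}) : F := phi (fracnd x).1 / phi (fracnd x).2.

Lemma frac_lift_nz d : d != 0 -> phi d != 0.
Proof. by apply: contraNneq => /phi_inj->. Qed.

Lemma frac_liftE n d : d != 0 -> frac_lift (tofrac n / tofrac d) = phi n / phi d.
Proof.
move=> d0; rewrite /frac_lift /fracnd; case: cid => -[n' d'] /= [d'0 /eqP].
rewrite eqr_div ?tofrac_eq0 // -!tofracM tofrac_eq => /eqP eq_nd.
by apply/eqP; rewrite eqr_div ?frac_lift_nz // -!rmorphM eq_nd.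
Qed.

Lemma frac_lift_tofrac x : frac_lift (tofrac x) = phi x.
Proof. by have := frac_liftE x (oner_neq0 _); rewrite tofrac1 rmorph1 !divr1. Qed.

Lemma frac_lift_zmod : zmod_morphism frac_lift.
Proof.
move=> x y; have [[n d] /= [d0 ->]] := fracP x; have [[n' d'] /= [d'0 ->]] := fracP y.
rewrite -mulNr addf_div ?tofrac_eq0 // -tofracN -!tofracM -tofracD.
rewrite !frac_liftE ?mulf_neq0 // -mulNr addf_div ?frac_lift_nz //.
by rewrite rmorphD !rmorphM rmorphN.
Qed.

Lemma frac_lift_monoid : monoid_morphism frac_lift.
Proof.
split=> [|x y]; first by rewrite -(tofrac1 R) frac_lift_tofrac rmorph1.
have [[n d] /= [d0 ->]] := fracP x; have [[n' d'] /= [d'0 ->]] := fracP y.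
by rewrite mulf_div -!tofracM !frac_liftE ?mulf_neq0 // mulf_div !rmorphM.
Qed.

Lemma frac_lift_morphism : exists chi : {rmorphism {fraction R} -> F},
  forall x, chi (tofrac x) = phi x.
Proof.
pose h := GRing.isZmodMorphism.Build _ _ frac_lift frac_lift_zmod.
pose h' := GRing.isMonoidMorphism.Build _ _ frac_lift frac_lift_monoid.
pose chi : {rmorphism {fraction R} -> F} := HB.pack frac_lift h h'.
by exists chi; exact: frac_lift_tofrac.
Qed.

End FractionLift.

Section ResidueField.
Local Open Scope ring_scope.
Variables (R : comNzRingType) (P : prime_idealr R).

Definition rquot : Type := {ideal_quot P}.
HB.instance Definition _ := GRing.ComNzRing.on rquot.

Definition rquot_unit : {pred rquot} := fun x => `[< exists y, y * x = 1 >].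
Definition rquot_inv (x : rquot) : rquot :=
  if pselect (exists y, y * x = 1) is left e then projT1 (cid e) else x.

Lemma rquot_mulVx : {in rquot_unit, left_inverse 1 rquot_inv *%R}.
Proof.
move=> x /asboolP ux; rewrite /rquot_inv; case: pselect => // e.
by case: cid.
Qed.

Lemma rquot_unitPl (x y : rquot) : y * x = 1 -> rquot_unit x.
Proof. by move=> yx; apply/asboolP; exists y. Qed.

Lemma rquot_invr_out : {in [predC rquot_unit], rquot_inv =1 id}.
Proof. by move=> x /asboolP nux; rewrite /rquot_inv; case: pselect. Qed.

HB.instance Definition _ := GRing.ComNzRing_hasMulInverse.Build rquot
  rquot_mulVx rquot_unitPl rquot_invr_out.

Lemma rquot_integral (x y : rquot) : x * y = 0 -> (x == 0) || (y == 0).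
Proof. exact: Quotient.rquot_IdomainAxiom. Qed.

HB.instance Definition _ := GRing.ComUnitRing_isIntegral.Build rquot rquot_integral.

(** The second clause, initiality among field-valued points with kernel P, is what brings the
    generic points of two orbits over one field. *)
Lemma residue_field : exists (F : fieldType) (phi : {rmorphism R -> F}),
  (forall f, phi f = 0 <-> f \in (P : pred R)) /\
  (forall (F' : fieldType) (psi : {rmorphism R -> F'}),
     (forall f, psi f = 0 <-> f \in (P : pred R)) ->
     exists chi : {rmorphism F -> F'}, forall f, psi f = chi (phi f)).
Proof.
pose pi : {rmorphism R -> rquot} := \pi_rquot%qT.
have piE f : pi f = 0 <-> f \in (P : pred R).
  rewrite -[f in f \in _]subr0 Quotient.idealrBE; split=> [E|/eqP].
    by apply/eqP; rewrite -[LHS]/(pi f) E /pi rmorph0.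
  by move=> E; rewrite -(rmorph0 pi).
exists {fraction rquot}, (@tofrac rquot \o pi); split=> [f|F' psi psiP].
  rewrite -piE /=; split=> [/eqP|->]; last by rewrite rmorph0.
  by rewrite tofrac_eq0 => /eqP.
have psi_pi f : psi (repr (pi f)) = psi f.
  apply/eqP; rewrite -subr_eq0 -rmorphB; apply/eqP/psiP/piE.
  by rewrite rmorphB /pi /= reprK subrr.
have reprE (x : rquot) : pi (repr x) = x by rewrite /pi /= reprK.
have psi_zmod : zmod_morphism (fun x : rquot => psi (repr x)).
  by move=> x y; rewrite -rmorphB -(psi_pi (_ - _)) rmorphB !reprE.
have psi_monoid : monoid_morphism (fun x : rquot => psi (repr x)).
  by split=> [|x y]; rewrite -?(rmorph1 pi) ?psi_pi ?rmorph1 // -rmorphM -(psi_pi (_ * _)) rmorphM !reprE.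
pose h := GRing.isZmodMorphism.Build _ _ _ psi_zmod.
pose h' := GRing.isMonoidMorphism.Build _ _ _ psi_monoid.
pose psi' : {rmorphism rquot -> F'} := HB.pack (fun x : rquot => psi (repr x)) h h'.
have psi'_inj x : psi' x = 0 -> x = 0.
  by rewrite /psi' /= => /psiP/piE; rewrite reprE.
have [chi chiE] := frac_lift_morphism psi'_inj.
by exists chi => f; rewrite /= chiE /psi' /= psi_pi.
Qed.

End ResidueField.

Section RepIso.
Local Open Scope ring_scope.
Variable Q : quiver.

(** For [R = k] this is [isomorphic] up to conversion; other rings serve for points of an orbit over
    extension fields and for families over polynomial rings. *)
Definition rep_iso (R : comNzRingType) (d e : dim_vector Q)
    (M : rep_space R d) (N : rep_space R e) : Prop :=
  exists (f : forall z, 'M[R]_(e z, d z)) (g : forall z, 'M[R]_(d z, e z)),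
    [/\ forall a, f (arrow_head a) *m M a = N a *m f (arrow_tail a),
        forall z, g z *m f z = 1%:M & forall z, f z *m g z = 1%:M].

Definition map_rep (R S : comNzRingType) (phi : R -> S) (d : dim_vector Q)
    (M : rep_space R d) : rep_space S d := fun a => map_mx phi (M a).

Section Equivalence.
Variable R : comNzRingType.
Variables d e f : dim_vector Q.
Variables (M : rep_space R d) (N : rep_space R e) (L : rep_space R f).

Lemma rep_iso_refl : rep_iso M M.
Proof. by exists (fun=> 1%:M), (fun=> 1%:M); split=> *; rewrite ?mul1mx ?mulmx1. Qed.

Lemma rep_iso_sym : rep_iso M N -> rep_iso N M.
Proof.
case=> u [v [uM vu uv]]; exists v, u; split=> // a.
by rewrite -[LHS]mulmx1 -uv mulmxA -[_ *m N a *m _]mulmxA -uM !mulmxA vu mul1mx.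
Qed.

Lemma rep_iso_trans : rep_iso M N -> rep_iso N L -> rep_iso M L.
Proof.
case=> u [v [uM vu uv]] [u' [v' [uN vu' uv']]].
exists (fun z => u' z *m u z), (fun z => v z *m v' z); split=> z.
- by rewrite -mulmxA uM !mulmxA uN.
- by rewrite mulmxA -[_ *m u' z]mulmxA vu' mulmx1.
- by rewrite mulmxA -[_ *m v z]mulmxA uv mulmx1.
Qed.

Lemma map_rep_iso (S : comNzRingType) (phi : {rmorphism R -> S}) :
  rep_iso M N -> rep_iso (map_rep phi M) (map_rep phi N).
Proof.
case=> u [v [uM vu uv]]; exists (fun z => map_mx phi (u z)), (fun z => map_mx phi (v z)).
split=> z; rewrite /map_rep -!map_mxM ?uM // ?vu ?uv ?map_mx1 //.
Qed.

End Equivalence.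

Lemma rep_isoE (R : comNzRingType) (d e : dim_vector Q) (M : rep_space R d) (N : rep_space R e)
    (f : forall z, 'M[R]_(e z, d z)) (g : forall z, 'M[R]_(d z, e z)) :
  (forall a, f (arrow_head a) *m M a = N a *m f (arrow_tail a)) ->
  (forall z, g z *m f z = 1%:M) -> (forall z, f z *m g z = 1%:M) ->
  forall a, N a = f (arrow_head a) *m M a *m g (arrow_tail a).
Proof. by move=> fM _ fg a; rewrite fM -mulmxA fg mulmx1. Qed.

Lemma map_repE (R S T : comNzRingType) (phi : R -> S) (psi : S -> T) (d : dim_vector Q)
    (M : rep_space R d) : map_rep psi (map_rep phi M) = map_rep (psi \o phi) M.
Proof. by apply: functional_extensionality_dep => a; rewrite /map_rep map_mx_comp. Qed.

Lemma path_eval_map (R S : comNzRingType) (psi : {rmorphism R -> S}) (d : dim_vector Q)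
    (M : rep_space R d) x y (p : qpath x y) :
  map_mx psi (path_eval M p) = path_eval (map_rep psi M) p.
Proof. by elim: p => [|a p IHp] /=; rewrite ?map_mx1 // map_mxM IHp. Qed.

End RepIso.

Lemma relation_eval_map (k : fieldType) (Q : quiver) (R S : comNzRingType) (iota : k -> R)
    (psi : {rmorphism R -> S}) (d : dim_vector Q) (M : rep_space R d) (r : relation k Q) :
  map_mx psi (relation_eval iota M r) = relation_eval (psi \o iota) (map_rep psi M) r.
Proof.
by rewrite raddf_sum; apply: eq_bigr => cp _; rewrite /= map_mxZ path_eval_map.
Qed.

(** * Polynomials evaluated at field-valued points *)

Section MultivariateEvaluation.
Local Open Scope ring_scope.
Variables (k : fieldType) (n : nat).

(* Evaluation at [u / D], multiplied by a power of [D]. *)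
Definition hmap (R : comNzRingType) (phi : k -> R) (u : 'I_n -> R) (D : R) (p : mpoly n k) : R :=
  \sum_(m <- msupp p) phi (mcoeff m p) * D ^+ (msize p - mdeg m) * mmap1 u m.

Variables (R S : comNzRingType).

Lemma mmap_comp (psi : {rmorphism R -> S}) (f : k -> R) (h : 'I_n -> R) p :
  psi (mmap f h p) = mmap (psi \o f) (psi \o h) p.
Proof.
rewrite /mmap rmorph_sum; apply: eq_bigr => m _; rewrite rmorphM; congr (_ * _).
by rewrite rmorph_prod; apply: eq_bigr => i _; rewrite rmorphXn.
Qed.

Lemma mmap_unique (psi : {rmorphism mpoly n k -> R}) p :
  psi p = mmap (psi \o @mpolyC n k) (fun i => psi (mpolyX k (mnm1 i))) p.
Proof.
rewrite {1}[p]mpolyE rmorph_sum; apply: eq_bigr => m _.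
rewrite -mul_mpolyC rmorphM; congr (_ * _); rewrite mpolyXE_id rmorph_prod.
by apply: eq_bigr => i _; rewrite rmorphXn.
Qed.

Lemma hmapE (phi : k -> R) u D D' p : D * D' = 1 ->
  hmap phi u D p = D ^+ msize p * mmap phi (fun i => u i * D') p.
Proof.
move=> DD'; rewrite /mmap mulr_sumr; apply: eq_big_seq => m m_p.
rewrite [RHS]mulrCA -mulrA; congr (_ * _).
have -> : mmap1 (fun i => u i * D') m = D' ^+ mdeg m * mmap1 u m.
  rewrite mdegE -prodrXr /mmap1 -big_split /=.
  by apply: eq_bigr => i _; rewrite exprMn mulrC.
rewrite mulrA -[in RHS](subnK (ltnW (msize_mdeg_lt m_p))) exprD -[_ * D ^+ _ * _]mulrA.
by rewrite -exprMn DD' expr1n mulr1.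
Qed.

Lemma hmap_comp (psi : {rmorphism R -> S}) (phi : k -> R) (u : 'I_n -> R) D p :
  psi (hmap phi u D p) = hmap (psi \o phi) (psi \o u) (psi D) p.
Proof.
rewrite /hmap rmorph_sum; apply: eq_bigr => m _; rewrite !rmorphM rmorphXn; congr (_ * _).
by rewrite rmorph_prod; apply: eq_bigr => i _; rewrite rmorphXn.
Qed.

End MultivariateEvaluation.

Section FieldPoints.
Local Open Scope classical_set_scope.
Local Open Scope ring_scope.

Section Kernel.
Variables (F : fieldType).

Let zero : pred F := fun x => x == 0.

Let zeroE x : (x \in zero) = (x == 0).
Proof. by []. Qed.

Lemma zero_idealr : idealr_closed zero.
Proof.
split; rewrite ?zeroE ?eqxx ?oner_eq0 // => a u v.
by rewrite !zeroE => /eqP-> /eqP->; rewrite mulr0 addr0.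
Qed.

Lemma zero_prime : prime_idealr_closed zero.
Proof. by move=> u v; rewrite !zeroE mulf_eq0. Qed.

Definition zero_point : Spec F :=
  HB.pack_for (prime_idealr F) (zero : F -> bool)
    (isIdealr.Build F zero zero_idealr) (isPrimeIdealrClosed.Build F zero zero_prime).

Definition kernel_point (R : comNzRingType) (psi : {rmorphism R -> F}) : Spec R :=
  spec_map psi zero_point.

Lemma kernel_pointE (R : comNzRingType) (psi : {rmorphism R -> F}) f :
  (f \in (kernel_point psi : pred R)) = (psi f == 0).
Proof. by []. Qed.

End Kernel.

Lemma closure_SpecE (R : comNzRingType) (O : set (Spec R)) (P : Spec R) :
  closure O P <-> forall f, (forall P' : Spec R, O P' -> f \in (P' : pred R)) -> f \in (P : pred R).
Proof.
split=> [clP f Of|clP].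
  apply: contrapT => nf.
  have : nbhs P (~` zero_locus [set f] : set (Spec R)).
    apply: open_nbhs_nbhs; split; first by exists [set f].
    by move=> /(_ f erefl).
  by move=> /clP[P' [OP' /= nP']]; apply: nP' => _ ->; exact: Of.
move=> B; rewrite nbhsE => -[U [[E UE] UP] UB].
apply: contrapT => noP'; move: UP; rewrite UE; apply => f Ef.
apply: clP => P' OP'; apply: contrapT => nf; apply: noP'; exists P'; split=> //.
by apply: UB; rewrite UE => /(_ f Ef).
Qed.

Lemma closed_SpecE (R : comNzRingType) (Z : set (Spec R)) :
  closed Z -> exists E, Z = zero_locus E.
Proof.
move=> /closed_openC -[E ZE]; exists E.
by rewrite -[Z]setCK ZE setCK.
Qed.

Lemma zero_locus_closed (R : comNzRingType) (E : set R) : closed (zero_locus E : set (Spec R)).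
Proof. by rewrite -[zero_locus E]setCK; apply: open_closedC; exists E. Qed.

End FieldPoints.

Section Evaluation.
Local Open Scope classical_set_scope.
Local Open Scope ring_scope.
Variables (k : fieldType) (A : bound_quiver k) (d : dim_vector A).

Definition evalr (S : comNzRingType) (phi : {rmorphism k -> S}) (N : rep_space S d) :
    {rmorphism rep_ring d -> S} :=
  mmap phi (fun i => rep_entry N (enum_val i)).

Definition gl_entry (S : comNzRingType) (g g' : forall z, 'M[S]_(d z))
    (i : 'I_(#|gl_coord d| + #|gl_coord d|)) : S :=
  match fintype.split i with
  | inl c => g (tag (enum_val c)) (tagged (enum_val c)).1 (tagged (enum_val c)).2
  | inr c => g' (tag (enum_val c)) (tagged (enum_val c)).1 (tagged (enum_val c)).2
  end.

Definition evalg (S : comNzRingType) (phi : {rmorphism k -> S}) (g g' : forall z, 'M[S]_(d z)) :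
    {rmorphism gl_ring d -> S} :=
  mmap phi (gl_entry g g').

Section Ring.
Variables (S : comNzRingType) (phi : {rmorphism k -> S}).
Implicit Type N : rep_space S d.

Lemma evalr_generic N : map_rep (evalr phi N) (@generic_rep k A d) = N.
Proof.
apply: functional_extensionality_dep => a; apply/matrixP => i j.
by rewrite !mxE /= mmapX mmap1U enum_rankK.
Qed.

Lemma evalr_comp (S' : comNzRingType) (psi : {rmorphism S -> S'}) N f :
  psi (evalr phi N f) = evalr (psi \o phi) (map_rep psi N) f.
Proof.
rewrite /= mmap_comp; apply: eq_bigr => m _; congr (_ * _).
by apply: eq_bigr => i _; rewrite /= /rep_entry !mxE.
Qed.

Lemma evalr_relation N r :
  map_mx (evalr phi N) (relation_eval (@mpolyC _ k) (@generic_rep k A d) r) =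
  relation_eval phi N r.
Proof.
rewrite relation_eval_map evalr_generic; apply: eq_bigr => cp _.
by rewrite /= mmapC.
Qed.

Lemma evalg_generic (g g' : forall z, 'M[S]_(d z)) z : map_mx (evalg phi g g') (generic_gl d z) = g z.
Proof.
apply/matrixP => i j; rewrite !mxE /= mmapX mmap1U /gl_entry.
by rewrite (unsplitK (inl _)) enum_rankK.
Qed.

Lemma evalg_generic_inv (g g' : forall z, 'M[S]_(d z)) z :
  map_mx (evalg phi g g') (generic_gl_inv d z) = g' z.
Proof.
apply/matrixP => i j; rewrite !mxE /= mmapX mmap1U /gl_entry.
by rewrite (unsplitK (inr _)) enum_rankK.
Qed.

Lemma evalg_orbit (g g' : forall z, 'M[S]_(d z)) (M : rep_space k d) f :
  evalg phi g g' (orbit_comorphism M f) =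
  evalr phi (fun a => g (arrow_head a) *m map_mx phi (M a) *m g' (arrow_tail a)) f.
Proof.
rewrite /= /comp_mpoly [LHS]mmap_comp; apply: eq_bigr => m _.
rewrite /= mmapC; congr (_ * _); apply: eq_bigr => i _; congr (_ ^+ _).
rewrite /= tnth_mktuple /rep_entry /generic_translate.
case: (enum_val i) => a [x y] /=.
have E : map_mx (evalg phi g g') (generic_translate M a) =
    g (arrow_head a) *m map_mx phi (M a) *m g' (arrow_tail a).
  rewrite /generic_translate !map_mxM evalg_generic evalg_generic_inv; congr (_ *m _ *m _).
  by apply/matrixP => u v; rewrite !mxE /= mmapC.
by rewrite -E [RHS]mxE.
Qed.

End Ring.

Lemma mem_rep_scheme (F : fieldType) (phi : {rmorphism k -> F}) (N : rep_space F d)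
    (P : Spec (rep_ring d)) :
  (forall f, evalr phi N f = 0 <-> f \in (P : pred _)) ->
  rep_scheme d P <-> (forall r, relations r -> relation_eval phi N r = 0).
Proof.
move=> PN; split=> [relP r rr|relN f [r [rr [i [j ->]]]]].
  apply/matrixP => i j; rewrite -evalr_relation !mxE; apply/PN/relP.
  by exists r; split=> //; exists i, j.
apply/PN; have /matrixP/(_ i j) := relN r rr.
by rewrite -evalr_relation !mxE.
Qed.

(* Functions vanishing on the orbit of [M], tested on points over fields. *)
Definition vanishes (M : rep_space k d) (f : rep_ring d) : Prop :=
  forall (F : fieldType) (phi : {rmorphism k -> F}) (N : rep_space F d),
    rep_iso (map_rep phi M) N -> evalr phi N f = 0.

Lemma orbit_point (M : rep_space k d) (F : fieldType) (phi : {rmorphism k -> F}) (N : rep_space F d) :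
  rep_iso (map_rep phi M) N ->
  exists2 P, rep_orbit M P & forall f, evalr phi N f = 0 <-> f \in (P : pred _).
Proof.
case=> g [g' [gM g'g gg']].
have NE := rep_isoE gM g'g gg'.
exists (spec_map (orbit_comorphism M) (kernel_point (evalg phi g g'))).
  exists (kernel_point (evalg phi g g')) => // f [z [i [j fE]]].
  have g1 (h : gl_ring d) (B : 'M_(d z)) : map_mx (evalg phi g g') B = 0 -> h = B i j ->
      h \in (kernel_point (evalg phi g g') : pred _).
    by move=> /matrixP/(_ i j) B0 ->; move: B0; rewrite kernel_pointE !mxE => ->.
  by case: fE; apply: g1; rewrite map_mxB map_mxM map_mx1 evalg_generic evalg_generic_inv ?gg' ?g'g subrr.
move=> f; rewrite -[f \in _]/(orbit_comorphism M f \in (kernel_point (evalg phi g g') : pred _)).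
rewrite kernel_pointE evalg_orbit.
have -> : N = fun a => g (arrow_head a) *m map_mx phi (M a) *m g' (arrow_tail a).
  by apply: functional_extensionality_dep.
by split=> [->|/eqP].
Qed.

(** The field is the residue field of a preimage of P in GL(d); over it the generic matrices
    specialise to an isomorphism. *)
Lemma orbit_pointE (M : rep_space k d) P : rep_orbit M P ->
  exists (F : fieldType) (phi : {rmorphism k -> F}) (N : rep_space F d),
    rep_iso (map_rep phi M) N /\ forall f, evalr phi N f = 0 <-> f \in (P : pred _).
Proof.
case=> Q glQ <-; have [F [psi [psiQ _]]] := residue_field Q.
pose phi : {rmorphism k -> F} := psi \o @mpolyC _ k.
pose g z := map_mx psi (generic_gl d z); pose g' z := map_mx psi (generic_gl_inv d z).
have gg' z : g z *m g' z = 1%:M.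
  apply/eqP; rewrite -subr_eq0 -map_mxM -(map_mx1 psi) -map_mxB; apply/eqP/matrixP => i j.
  by rewrite [LHS]mxE [RHS]mxE; apply/psiQ/glQ; exists z, i, j; left.
have g'g z : g' z *m g z = 1%:M.
  apply/eqP; rewrite -subr_eq0 -map_mxM -(map_mx1 psi) -map_mxB; apply/eqP/matrixP => i j.
  by rewrite [LHS]mxE [RHS]mxE; apply/psiQ/glQ; exists z, i, j; right.
exists F, phi, (fun a => g (arrow_head a) *m map_mx phi (M a) *m g' (arrow_tail a)).
split; first by exists g, g'; split=> // a; rewrite -[RHS]mulmxA g'g [RHS]mulmx1.
move=> f; rewrite -evalg_orbit.
rewrite -[f \in _]/(orbit_comorphism M f \in (Q : pred _)) -psiQ (mmap_unique psi).
suff eq_entry : gl_entry g g' = fun i => psi (mpolyX k (mnm1 i)) by rewrite /evalg /= -eq_entry.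
apply/funext => i; rewrite /gl_entry; case: split_ordP => c ->.
  by rewrite !mxE -[in RHS](enum_valK c); case: (enum_val c) => z [].
by rewrite !mxE -[in RHS](enum_valK c); case: (enum_val c) => z [].
Qed.

Lemma vanishesP M f : vanishes M f <-> forall P : Spec _, rep_orbit M P -> f \in (P : pred _).
Proof.
split=> [van P /orbit_pointE[F [phi [N [isoN PN]]]]|van F phi N isoN].
  exact/PN/van.
by have [P orbP PN] := orbit_point isoN; apply/PN/van.
Qed.

End Evaluation.

Section GenericPoint.
Local Open Scope ring_scope.
Variables (k : fieldType) (A : bound_quiver k) (d : dim_vector A) (M : rep_space k d).

Let S : idomainType := mpoly #|gl_coord d| k.

Let X (z : vertex A) : 'M[S]_(d z) := \matrix_(i, j) mpolyX k (mnm1 (enum_rank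
  (Tagged (fun z => ('I_(d z) * 'I_(d z))%type) (i, j) : gl_coord d))).

Let D : S := \prod_z \det (X z).

(* [D] times the generic translate of [M] has polynomial entries. *)
Let U : rep_space S d := fun a => (\prod_(z | z != arrow_tail a) \det (X z)) *:
  (X (arrow_head a) *m map_mx (@mpolyC _ k) (M a) *m \adj (X (arrow_tail a))).

Let eval_gl (F : fieldType) (phi : {rmorphism k -> F}) (h : forall z, 'M[F]_(d z)) :
    {rmorphism S -> F} :=
  mmap phi (fun i => h (tag (enum_val i)) (tagged (enum_val i)).1 (tagged (enum_val i)).2).

Lemma eval_glX (F : fieldType) (phi : {rmorphism k -> F}) (h : forall z, 'M[F]_(d z)) z :
  map_mx (eval_gl phi h) (X z) = h z.
Proof. by apply/matrixP => i j; rewrite !mxE /= mmapX mmap1U enum_rankK. Qed.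

Section Specialization.
Variables (F : fieldType) (chi : {rmorphism S -> F}).
Hypothesis chiD : chi D != 0.

Let N : rep_space F d := fun a => map_mx chi (X (arrow_head a)) *m
  map_mx (chi \o @mpolyC _ k) (M a) *m invmx (map_mx chi (X (arrow_tail a))).

Lemma unit_specialization z : map_mx chi (X z) \in unitmx.
Proof.
rewrite unitmxE det_map_mx unitfE; apply: contraNneq chiD => detX.
by rewrite /D (bigD1 z) //= rmorphM /= detX mul0r.
Qed.

Lemma iso_specialization : rep_iso (map_rep (chi \o @mpolyC _ k) M) N.
Proof.
exists (fun z => map_mx chi (X z)), (fun z => invmx (map_mx chi (X z))); split=> [a|z|z].
- by rewrite /N mulmxKV ?unit_specialization.
- exact: mulVmx (unit_specialization z).
- exact: mulmxV (unit_specialization z).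
Qed.

Lemma specializationE a : N a = (chi D)^-1 *: map_mx chi (U a).
Proof.
have unit_t := unit_specialization (arrow_tail a).
apply: (canRL (scalerK chiD)); rewrite /N /U map_mxZ !map_mxM map_mx_adj.
rewrite /invmx unit_t -scalemxAr scalerA map_mx_comp; congr (_ *: _).
rewrite /D (bigD1 (arrow_tail a)) //= rmorphM det_map_mx mulrAC mulfV ?mul1r //.
by rewrite -unitfE -det_map_mx -unitmxE.
Qed.

Lemma evalr_specialization f :
  evalr (chi \o @mpolyC _ k) N f = 0 <->
  chi (hmap (@mpolyC _ k) (fun i => rep_entry U (enum_val i)) D f) = 0.
Proof.
rewrite hmap_comp (@hmapE _ _ _ _ _ _ (chi D)^-1) ?mulfV //.
have -> : evalr (chi \o @mpolyC _ k) N f = mmap (chi \o @mpolyC _ k)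
    (fun i => (chi \o (fun i => rep_entry U (enum_val i))) i * (chi D)^-1) f.
  rewrite /=; congr mmap; apply/funext => i.
  by rewrite /rep_entry specializationE !mxE mulrC.
split=> [->|/eqP]; first by rewrite mulr0.
by rewrite mulf_eq0 expf_eq0 (negPf chiD) andbF => /eqP.
Qed.

End Specialization.

(** The polynomial [D] is non-zero, since its value at the identity is 1, so the generic matrices
    translate M over the fraction field of [S]. A function vanishes at this translate exactly if its
    numerator [hmap] is the zero polynomial, and then it vanishes at every specialisation, that is,
    on the whole orbit. *)
Lemma generic_orbit_point : exists (F : fieldType) (phi : {rmorphism k -> F}) (N : rep_space F d),
  rep_iso (map_rep phi M) N /\ forall f, evalr phi N f = 0 <-> vanishes M f.
Proof.
have D0 : D != 0.
  apply/eqP => D0; have := rmorph0 (eval_gl idfun (fun=> 1%:M)).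
  rewrite -D0 rmorph_prod big1 => [/eqP|z _]; first by rewrite oner_eq0.
  by rewrite -det_map_mx eval_glX det1.
pose chi : {rmorphism S -> {fraction S}} := @tofrac S.
have chiD : chi D != 0 by rewrite tofrac_eq0.
eexists; eexists; eexists; split; first exact: (iso_specialization chiD).
move=> f; rewrite evalr_specialization //; split=> [/eqP|van].
  rewrite tofrac_eq0 => /eqP hf0 F phi N [h [h' [hM h'h hh']]].
  pose chi' := eval_gl phi h.
  have chi'D : chi' D != 0.
    rewrite rmorph_prod; apply/prodf_neq0 => z _; rewrite -det_map_mx eval_glX.
    by rewrite -unitfE -unitmxE; case/mulmx1_unit: (hh' z).
  have := (evalr_specialization chi'D f).2; rewrite hf0 rmorph0 => /(_ erefl).
  have phiE : chi' \o @mpolyC _ k =1 phi by move=> c; rewrite /= mmapC.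
  suff -> : evalr phi N f = evalr (chi' \o @mpolyC _ k) (fun a => map_mx chi' (X (arrow_head a)) *m
      map_mx (chi' \o @mpolyC _ k) (M a) *m invmx (map_mx chi' (X (arrow_tail a)))) f by [].
  rewrite /=; have -> : (chi' \o @mpolyC _ k : k -> F) = phi by apply/funext.
  congr mmap; apply/funext => i; rewrite /rep_entry; case: (enum_val i) => a [x y] /=.
  rewrite !eval_glX (rep_isoE hM h'h hh' a) /map_rep; congr ((_ *m _) _ _).
  by rewrite -[LHS]mul1mx -(mulVmx (proj1 (mulmx1_unit (hh' (arrow_tail a))))) -mulmxA hh' mulmx1.
by rewrite -evalr_specialization //; apply: van; exact: iso_specialization.
Qed.

End GenericPoint.

(** * Irreducible components as orbit closures *)

Section Components.
Local Open Scope classical_set_scope.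
Local Open Scope ring_scope.

Lemma path_eval_iso (Q : quiver) (R : comNzRingType) (d e : dim_vector Q)
    (M : rep_space R d) (N : rep_space R e) (f : forall z, 'M[R]_(e z, d z)) :
  (forall a, f (arrow_head a) *m M a = N a *m f (arrow_tail a)) ->
  forall x y (p : qpath x y), f y *m path_eval M p = path_eval N p *m f x.
Proof.
move=> fM x y; elim=> [|a p IHp] /=; first by rewrite mulmx1 mul1mx.
by rewrite mulmxA fM -mulmxA IHp mulmxA.
Qed.

Lemma relation_eval_iso (k : fieldType) (Q : quiver) (R : comNzRingType) (iota : k -> R)
    (d e : dim_vector Q) (M : rep_space R d) (N : rep_space R e) r :
  rep_iso M N -> relation_eval iota M r = 0 -> relation_eval iota N r = 0.
Proof.
case=> f [g [fM gf fg]] M0.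
suff E : f _ *m relation_eval iota M r = relation_eval iota N r *m f _.
  by rewrite -[LHS]mulmx1 -(fg (source r)) mulmxA -E M0 mulmx0 mul0mx.
rewrite mulmx_sumr mulmx_suml; apply: eq_bigr => cp _.
by rewrite -scalemxAr -scalemxAl (path_eval_iso fM).
Qed.

Variables (k : fieldType) (A : bound_quiver k) (d : dim_vector A).

Lemma relation_eval_base (F : fieldType) (phi : {rmorphism k -> F}) (M : rep_space k d) :
  is_rep M -> forall r, relations r -> relation_eval phi (map_rep phi M) r = 0.
Proof.
move=> repM r rr; have := relation_eval_map id phi M r.
by rewrite (repM r rr) map_mx0.
Qed.

Lemma orbit_sub_scheme (M : rep_space k d) : is_rep M -> rep_orbit M `<=` rep_scheme d.
Proof.
move=> repM P /orbit_pointE[F [phi [N [isoN PN]]]]; apply/(mem_rep_scheme PN) => r rr.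
exact: relation_eval_iso isoN (relation_eval_base phi repM rr).
Qed.

Lemma closure_orbitE (M : rep_space k d) (P : Spec (rep_ring d)) :
  closure (rep_orbit M) P <-> forall f, vanishes M f -> f \in (P : pred _).
Proof.
rewrite closure_SpecE; split=> H f vf; apply: H.
  exact/vanishesP.
exact/vanishesP.
Qed.

Lemma closure_irreducible (T : topologicalType) (Z : set T) :
  irreducible_set Z -> irreducible_set (closure Z).
Proof.
move=> [[x Zx] irrZ]; split; first by exists x; exact: subset_closure.
move=> B C clB clC ZBC.
have sub B' : closed B' -> Z `<=` B' -> closure Z `<=` B'.
  by move=> clB' ZB'; rewrite (closure_id B').1 //; exact: closure_subset.
by case: (irrZ B C clB clC) => [y Zy|H|H]; [exact/ZBC/subset_closure | left | right]; exact: sub.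
Qed.

Lemma closure_orbit_irreducible (M : rep_space k d) :
  irreducible_set (closure (rep_orbit M)).
Proof.
have [F [phi [N [isoN NE]]]] := generic_orbit_point M.
have [P orbP PN] := orbit_point isoN.
split; first by exists P; exact: subset_closure.
move=> B C /closed_SpecE[E ->] /closed_SpecE[E' ->] sub.
have gen E1 : zero_locus E1 P -> closure (rep_orbit M) `<=` zero_locus E1.
  by move=> E1P P' /closure_orbitE clP' f /E1P fP; apply/clP'/NE/PN.
by case: (sub P (subset_closure orbP)) => [/gen|/gen]; [left | right].
Qed.

Lemma component_closed (Z : set (Spec (rep_ring d))) :
  irreducible_component (rep_scheme d) Z -> closed Z.
Proof.
case=> ZX irrZ maxZ; have <- : closure Z = Z; last exact: closed_closure.
apply: maxZ; [|exact: closure_irreducible | exact: subset_closure].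
rewrite (closure_id (rep_scheme d)).1; first exact: closure_subset.
exact: zero_locus_closed.
Qed.

(** If a product vanishes on Z, the zero loci of its factors cover Z, so irreducibility makes the
    ideal of Z prime. *)
Lemma generic_prime (R : comNzRingType) (Z : set (Spec R)) : irreducible_set Z ->
  exists P : Spec R, forall f, f \in (P : pred R) <-> forall P' : Spec R, Z P' -> f \in (P' : pred R).
Proof.
move=> [[P0 ZP0] irrZ].
pose I : pred R := fun f => `[< forall P' : Spec R, Z P' -> f \in (P' : pred R) >].
have IE f : f \in I <-> forall P' : Spec R, Z P' -> f \in (P' : pred R) by split=> /asboolP.
have I_ideal : idealr_closed I.
  split.
  - by apply/IE => P' _; rewrite idealr0.
  - by apply/negP => /IE/(_ P0 ZP0); rewrite idealr1.
  by move=> a u v /IE Iu /IE Iv; apply/IE => P' ZP'; rewrite rpredD ?idealMr ?Iu ?Iv.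
have I_prime : prime_idealr_closed I.
  move=> u v /IE Iuv.
  have [] := irrZ (zero_locus [set u]) (zero_locus [set v]);
    [exact: zero_locus_closed | exact: zero_locus_closed | | |].
  - move=> P' ZP'; have := Iuv P' ZP'; rewrite prime_idealrM => /orP[] H.
      by left=> _ ->.
    by right=> _ ->.
  - by move=> Zu; apply/orP; left; apply/IE => P' /Zu; apply.
  - by move=> Zv; apply/orP; right; apply/IE => P' /Zv; apply.
by exists (HB.pack_for (prime_idealr R) (I : R -> bool)
  (isIdealr.Build R I I_ideal) (isPrimeIdealrClosed.Build R I I_prime)) => f; exact: IE.
Qed.

(** The hypothesis is applied to one representation only, the one over the residue field of the
    generic point of Z. It puts Z inside an orbit closure; this is irreducible, so maximality of Z
    gives equality. The predicate [st] keeps track of the shape of the representation found. *)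
Theorem component_orbit (st : rep_space k d -> Prop) :
  (forall (F : fieldType) (phi : {rmorphism k -> F}) (N : rep_space F d),
     (forall r, relations r -> relation_eval phi N r = 0) ->
     exists M, [/\ is_rep M, st M & forall f, vanishes M f -> evalr phi N f = 0]) ->
  forall Z, irreducible_component (rep_scheme d) Z ->
    exists M, [/\ is_rep M, st M & dense_in (rep_orbit M) Z].
Proof.
move=> stdN Z compZ; have clZ := component_closed compZ; case: compZ => ZX irrZ maxZ.
have [P PZ] := generic_prime irrZ.
have ZP : Z P.
  by rewrite (closure_id Z).1 //; apply/closure_SpecE => f Zf; exact/PZ.
have [F [psi [psiP _]]] := residue_field P.
pose phi : {rmorphism k -> F} := psi \o @mpolyC _ k.
pose N : rep_space F d := map_rep psi (@generic_rep k A d).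
have NP f : evalr phi N f = 0 <-> f \in (P : pred _).
  rewrite -psiP (mmap_unique psi) /=; have -> // : (fun i : 'I_#|rep_coord d| => psi (mpolyX k (mnm1 i))) =
      fun i => rep_entry N (enum_val i).
  apply/funext => i; rewrite /rep_entry !mxE -[in LHS](enum_valK i).
  by case: (enum_val i) => a [].
have [M [repM stM vanM]] := stdN F phi N ((mem_rep_scheme NP).1 (ZX _ ZP)).
have Zcl : Z `<=` closure (rep_orbit M).
  move=> P' ZP'; apply/closure_orbitE => f /vanM /NP /PZ; exact.
have clE : closure (rep_orbit M) = Z.
  apply: maxZ Zcl; last exact: closure_orbit_irreducible.
  rewrite (closure_id (rep_scheme d)).1; last exact: zero_locus_closed.
  exact/closure_subset/orbit_sub_scheme.
by exists M; split=> //; split=> //; rewrite -clE; exact: subset_closure.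
Qed.

Lemma dense_vanishes (M M' : rep_space k d) Z f :
  dense_in (rep_orbit M) Z -> dense_in (rep_orbit M') Z -> vanishes M f -> vanishes M' f.
Proof.
move=> [_ Zcl] [orbZ _] vanM; apply/vanishesP => P /orbZ/Zcl/closure_orbitE; exact.
Qed.

End Components.

(** * Recovering a representation from its generic point *)

Section Families.
Local Open Scope ring_scope.
Variables (T : finType) (p q : T -> nat).

Definition fam (R : Type) := forall z, 'M[R]_(p z, q z).

Definition fam_coord : finType := {z : T & ('I_(p z) * 'I_(q z))%type}.

Definition flat (R : Type) (f : fam R) : 'rV[R]_#|fam_coord| :=
  \row_i f (tag (enum_val i)) (tagged (enum_val i)).1 (tagged (enum_val i)).2.

Definition unflat (R : Type) (v : 'rV[R]_#|fam_coord|) : fam R :=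
  fun z => \matrix_(i, j) v ord0
    (enum_rank (Tagged (fun z => ('I_(p z) * 'I_(q z))%type) (i, j) : fam_coord)).

Lemma unflatK R : cancel (@unflat R) (@flat R).
Proof.
move=> v; apply/rowP => i; rewrite !mxE -[in RHS](enum_valK i).
by case: (enum_val i) => z [].
Qed.

Lemma flatK R (f : fam R) z : unflat (flat f) z = f z.
Proof. by apply/matrixP => i j; rewrite !mxE enum_rankK. Qed.

Lemma unflat_map (R S : Type) (phi : R -> S) (v : 'rV[R]_#|fam_coord|) z :
  map_mx phi (unflat v z) = unflat (map_mx phi v) z.
Proof. by apply/matrixP => i j; rewrite !mxE. Qed.

Lemma flat_map (R S : Type) (phi : R -> S) (f : fam R) :
  map_mx phi (flat f) = flat (fun z => map_mx phi (f z)).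
Proof. by apply/rowP => i; rewrite !mxE. Qed.

Lemma unflat_sum (R : comNzRingType) m (c : 'rV[R]_m) (V : 'M[R]_(m, #|fam_coord|)) z :
  unflat (c *m V) z = \sum_i c ord0 i *: unflat (row i V) z.
Proof.
apply/matrixP => i j; rewrite summxE !mxE; apply: eq_bigr => l _.
by rewrite !mxE.
Qed.

End Families.

Section Summands.
Local Open Scope ring_scope.
Variable Q : quiver.

Definition is_hom (R : comNzRingType) (d e : dim_vector Q) (M : rep_space R d) (N : rep_space R e)
    (f : forall z, 'M[R]_(e z, d z)) : Prop :=
  forall a, f (arrow_head a) *m M a = N a *m f (arrow_tail a).

(* [M] is a direct summand of a power of [N]. *)
Definition divides_power (R : comNzRingType) (d e : dim_vector Q)
    (M : rep_space R d) (N : rep_space R e) : Prop :=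
  exists (I : finType) (f : I -> forall z, 'M[R]_(e z, d z)) (g : I -> forall z, 'M[R]_(d z, e z)),
    [/\ forall i, is_hom M N (f i), forall i, is_hom N M (g i) &
        forall z, \sum_i g i z *m f i z = 1%:M].

Lemma iso_divides_power (R : comNzRingType) (d e : dim_vector Q)
    (M : rep_space R d) (N : rep_space R e) : rep_iso M N -> divides_power M N.
Proof.
move=> isoN; have [g' [f' [gN _ _]]] := rep_iso_sym isoN.
case: isoN => f [g [fM gf fg]].
exists unit, (fun=> f), (fun=> g); split=> // [_ a|z]; last by rewrite big_const card_unit /= addr0.
by rewrite -[LHS]mulmx1 -fg mulmxA -[_ *m N a *m _]mulmxA -fM !mulmxA gf mul1mx.
Qed.

Lemma divides_power_trans (R : comNzRingType) (d e c : dim_vector Q)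
    (M : rep_space R d) (N : rep_space R e) (L : rep_space R c) :
  divides_power M N -> divides_power N L -> divides_power M L.
Proof.
case=> I [f [g [fM gN gf]]] [J [f' [g' [fN gL gf']]]].
exists (I * J)%type, (fun ij z => f' ij.2 z *m f ij.1 z), (fun ij z => g ij.1 z *m g' ij.2 z).
split=> [ij a|ij a|z].
- by rewrite -mulmxA fM !mulmxA fN.
- by rewrite -mulmxA gL !mulmxA gN.
rewrite -(gf z) -(pair_bigA _ (fun i j => g i z *m g' j z *m (f' j z *m f i z))) /=.
apply: eq_bigr => i _; rewrite -[in RHS](mul1mx (f i z)) -(gf' z) mulmx_suml mulmx_sumr.
by apply: eq_bigr => j _; rewrite !mulmxA.
Qed.

Section HomSpace.
Variables (d e : dim_vector Q).

Definition hom_defect (R : comNzRingType) (M : rep_space R d) (N : rep_space R e)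
    (v : 'rV[R]_#|fam_coord e d|) : 'rV[R]_#|fam_coord (e \o @arrow_head Q) (d \o @arrow_tail Q)| :=
  flat (p := e \o @arrow_head Q) (q := d \o @arrow_tail Q)
    (fun a => unflat v (arrow_head a) *m M a - N a *m unflat v (arrow_tail a)).

Lemma unflat_linear (R : comNzRingType) (p q : vertex Q -> nat) (c : R)
    (u v : 'rV_#|fam_coord p q|) z :
  unflat (c *: u + v) z = c *: unflat u z + unflat v z.
Proof. by apply/matrixP => i j; rewrite !mxE. Qed.

Lemma hom_defect_linear (R : comNzRingType) (M : rep_space R d) (N : rep_space R e) :
  linear (hom_defect M N).
Proof.
move=> c u v; apply/rowP => i; rewrite [LHS]mxE [RHS]mxE [X in _ = X + _]mxE.
rewrite [X in _ = _ * X + _]mxE [X in _ = _ + X]mxE.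
set B := LHS; pose a := tag (enum_val i).
have -> : B = (c *: (unflat u (arrow_head a) *m M a - N a *m unflat u (arrow_tail a)) +
    (unflat v (arrow_head a) *m M a - N a *m unflat v (arrow_tail a)))
    (tagged (enum_val i)).1 (tagged (enum_val i)).2.
  rewrite /B !unflat_linear mulmxDl mulmxDr -scalemxAl -scalemxAr scalerBr.
  by congr (fun_of_matrix _ _ _); rewrite opprD addrACA.
by rewrite mxE [X in X + _]mxE.
Qed.

(** Flattening families of matrices to row vectors turns Hom(M, N) into the kernel of a single
    matrix, and kernels are compatible with field extensions. *)
Definition hom_mx (R : comNzRingType) (M : rep_space R d) (N : rep_space R e) :=
  lin1_mx (hom_defect M N).

Lemma hom_mxP (R : comNzRingType) (M : rep_space R d) (N : rep_space R e) v :
  is_hom M N (unflat v) <-> v *m hom_mx M N = 0.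
Proof.
pose h := GRing.isLinear.Build _ _ _ _ _ (hom_defect_linear M N).
pose L : {linear _ -> _} := HB.pack (hom_defect M N) h.
have -> : v *m hom_mx M N = hom_defect M N v by exact: (mul_rV_lin1 L).
split=> [hv|/(congr1 (fun w => unflat w)) hv a].
  by apply/rowP => i; rewrite [LHS]mxE [RHS]mxE /= hv subrr mxE.
apply/eqP; rewrite -subr_eq0; apply/eqP.
have := congr1 (fun f : fam _ _ R => f a) hv; rewrite flatK /= => ->.
by apply/matrixP => i j; rewrite !mxE.
Qed.

Lemma hom_mx_map (R S : comNzRingType) (phi : {rmorphism R -> S})
    (M : rep_space R d) (N : rep_space R e) :
  map_mx phi (hom_mx M N) = hom_mx (map_rep phi M) (map_rep phi N).
Proof.
apply/matrixP => i j; rewrite !mxE /= rmorphB !rmorph_sum; congr (_ - _).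
  by apply: eq_bigr => l _; rewrite rmorphM !mxE rmorph_nat.
by apply: eq_bigr => l _; rewrite rmorphM !mxE rmorph_nat.
Qed.

End HomSpace.

Lemma is_hom_basis (K F : fieldType) (phi : {rmorphism K -> F}) (d e : dim_vector Q)
    (M : rep_space K d) (N : rep_space K e) f :
  is_hom (map_rep phi M) (map_rep phi N) f ->
  exists c : 'rV[F]_#|fam_coord e d|, forall z,
    f z = \sum_i c ord0 i *: map_mx phi (unflat (row i (kermx (hom_mx M N))) z).
Proof.
move=> fM; have : flat f *m hom_mx (map_rep phi M) (map_rep phi N) = 0.
  by apply/hom_mxP => a; rewrite !flatK.
rewrite -hom_mx_map => /sub_kermxP; rewrite -map_kermx => /submxP[c fc]; exists c => z.
rewrite -(flatK f) fc unflat_sum; apply: eq_bigr => i _.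
by rewrite unflat_map map_row.
Qed.

Lemma row_ker_hom (K : fieldType) (d e : dim_vector Q) (M : rep_space K d) (N : rep_space K e) i :
  is_hom M N (unflat (row i (kermx (hom_mx M N)))).
Proof. by apply/hom_mxP; rewrite -row_mul mulmx_ker row0. Qed.

(* The spaces of homomorphisms, hence the span of their composites, are compatible
   with extensions of the ground field. *)
Lemma divides_power_descent (K F : fieldType) (phi : {rmorphism K -> F}) (d e : dim_vector Q)
    (M : rep_space K d) (N : rep_space K e) :
  divides_power (map_rep phi M) (map_rep phi N) -> divides_power M N.
Proof.
case=> I [f [g [fM gN gf]]].
have /choice[c cE] := fun i => is_hom_basis (fM i).
have /choice[b bE] := fun i => is_hom_basis (gN i).
pose u i := unflat (row i (kermx (hom_mx M N))).
pose v j := unflat (row j (kermx (hom_mx N M))).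
pose J : finType := ('I_#|fam_coord e d| * 'I_#|fam_coord d e|)%type.
pose W : 'M[K]_(#|J|, #|fam_coord d d|) := \matrix_l
  flat (fun z => v (enum_val l).2 z *m u (enum_val l).1 z).
pose r (l : J) : F := \sum_i b i ord0 l.2 * c i ord0 l.1.
have key z : 1%:M = \sum_(l : J) r l *: map_mx phi (v l.2 z *m u l.1 z) :> 'M[F]_(d z).
  under eq_bigr do rewrite scaler_suml.
  rewrite exchange_big -(gf z); apply: eq_bigr => i _.
  rewrite cE bE mulmx_suml -(pair_bigA _ (fun l j => (b i ord0 j * c i ord0 l) *:
    map_mx phi (v j z *m u l z))) /= exchange_big /=.
  apply: eq_bigr => j _; rewrite mulmx_sumr; apply: eq_bigr => l _.
  by rewrite map_mxM -scalemxAl -scalemxAr scalerA.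
(* The identity lies in the row space of [W] over F, and whether a vector over K lies in the row
   space of a matrix over K does not depend on the field. *)
have : (map_mx phi (flat (fun z => 1%:M : 'M[K]_(d z))) <= map_mx phi W)%MS.
  apply/submxP; exists (\row_l r (enum_val l)); rewrite flat_map.
  apply: (can_inj (@unflatK _ d d F)); apply: functional_extensionality_dep => z.
  rewrite flatK map_mx1 key unflat_sum (reindex (@enum_val J J)) /=; last first.
    by exists enum_rank => l _; rewrite ?enum_valK ?enum_rankK.
  by apply: eq_bigr => l _; rewrite -map_row -unflat_map rowK flatK mxE.
rewrite map_submx => /submxP[s sE].
exists 'I_#|J|, (fun l => u (enum_val l).1), (fun l z => s ord0 l *: v (enum_val l).2 z).
split=> [l|l a|z]; first exact: row_ker_hom.
  by rewrite -scalemxAl -scalemxAr row_ker_hom.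
have := flatK (fun z => 1%:M : 'M[K]_(d z)) z; rewrite sE unflat_sum => <-.
by apply: eq_bigr => l _; rewrite rowK flatK scalemxAl.
Qed.

End Summands.

(** * Fitting's lemma and local endomorphism rings *)

Section Fitting.
Local Open Scope ring_scope.
Variables (k : fieldType) (A : bound_quiver k) (d : dim_vector A) (M : rep_space k d).

Lemma hom_pow (f : forall z, 'M[k]_(d z)) n : is_hom M M f -> is_hom M M (fun z => mxpow (f z) n).
Proof.
move=> fM a; elim: n => [|n IHn]; first by rewrite /mxpow mulmx1 mul1mx.
by rewrite !mxpowS -mulmxA IHn !mulmxA fM.
Qed.

(** Minimising the sum of the ranks over all vertices gives one exponent for all of them. It has the
    form n + 1 to be positive, so that an invertible power makes f invertible. *)
Lemma rank_stable (f : forall z, 'M[k]_(d z)) :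
  exists n, forall z, \rank (mxpow (f z) n.+1 *m mxpow (f z) n.+1) = \rank (mxpow (f z) n.+1).
Proof.
pose rk n := (\sum_z \rank (mxpow (f z) n.+1))%N.
have [r [[n rn] minr]] : exists r, (exists n, rk n = r) /\ forall n, (r <= rk n)%N.
  have ex : exists r, `[< exists n, rk n = r >] by exists (rk 0%N); apply/asboolP; exists 0%N.
  exists (ex_minn ex); case: ex_minnP => r /asboolP rP minr; split=> // n.
  by apply/minr/asboolP; exists n.
exists n => z; apply/eqP; rewrite eqn_leq mxrankM_maxl /=.
rewrite leqNgt; apply/negP => lt_z; have := minr (n + n.+1)%N; rewrite leqNgt -rn => /negP[].
have h1 : (\rank (mxpow (f z) (n + n.+1).+1) < \rank (mxpow (f z) n.+1))%N.
  by rewrite -addSn mxpowD.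
have h2 : (\sum_(z' | z' != z) \rank (mxpow (f z') (n + n.+1).+1) <=
    \sum_(z' | z' != z) \rank (mxpow (f z') n.+1))%N.
  by apply: leq_sum => z' _; rewrite -addSn mxpowD mxrankM_maxl.
rewrite /rk [ltnLHS](bigD1 z) // [ltnRHS](bigD1 z) //; exact: (leq_add h1 h2).
Qed.

Lemma split_rep (e : forall z, 'M[k]_(d z)) : is_rep M -> is_hom M M e ->
  (forall z, e z *m e z = e z) -> indecomposable M ->
  (forall z, e z = 0) \/ (forall z, e z = 1%:M).
Proof.
move=> repM eM ee [_ indM].
have ee' z : (1%:M - e z) *m (1%:M - e z) = 1%:M - e z.
  by rewrite mulmxBl mul1mx mulmxBr mulmx1 ee subrr subr0.
have split_e z : exists x : {r & ('M[k]_(d z, r) * 'M[k]_(r, d z))%type},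
    (tagged x).2 *m (tagged x).1 = 1%:M /\ (tagged x).1 *m (tagged x).2 = e z.
  have [r [U [V [VU UV]]]] := split_idempotent (ee z).
  by exists (Tagged (fun r => ('M[k]_(d z, r) * 'M[k]_(r, d z))%type) (U, V)).
have split_e' z : exists x : {r & ('M[k]_(d z, r) * 'M[k]_(r, d z))%type},
    (tagged x).2 *m (tagged x).1 = 1%:M /\ (tagged x).1 *m (tagged x).2 = 1%:M - e z.
  have [r [U [V [VU UV]]]] := split_idempotent (ee' z).
  by exists (Tagged (fun r => ('M[k]_(d z, r) * 'M[k]_(r, d z))%type) (U, V)).
pose x z := projT1 (cid (split_e z)); pose x' z := projT1 (cid (split_e' z)).
pose d1 : dim_vector A := fun z => tag (x z); pose d2 : dim_vector A := fun z => tag (x' z).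
pose U z : 'M[k]_(d z, d1 z) := (tagged (x z)).1; pose V z : 'M[k]_(d1 z, d z) := (tagged (x z)).2.
pose U' z : 'M[k]_(d z, d2 z) := (tagged (x' z)).1; pose V' z : 'M[k]_(d2 z, d z) := (tagged (x' z)).2.
have VU z : V z *m U z = 1%:M by rewrite /V /U /d1 /x; case: cid => ? [].
have UV z : U z *m V z = e z by rewrite /V /U /d1 /x; case: cid => ? [].
have VU' z : V' z *m U' z = 1%:M by rewrite /V' /U' /d2 /x'; case: cid => ? [].
have UV' z : U' z *m V' z = 1%:M - e z by rewrite /V' /U' /d2 /x'; case: cid => ? [].
have Ve z : V z *m e z = V z by rewrite -UV mulmxA VU mul1mx.
have V'e z : V' z *m e z = 0.
  apply/eqP; have := congr1 (mulmx (V' z)) (UV' z).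
  rewrite mulmxA VU' mul1mx mulmxBr mulmx1 => /eqP.
  by rewrite -subr_eq0 opprB addrCA subrr addr0.
have eU' z : e z *m U' z = 0.
  apply/eqP; have := congr1 (mulmx^~ (U' z)) (UV' z).
  rewrite -mulmxA VU' mulmx1 mulmxBl mul1mx => /eqP.
  by rewrite -subr_eq0 opprB addrCA subrr addr0.
pose M1 : rep_space k d1 := fun a => V (arrow_head a) *m M a *m U (arrow_tail a).
pose M2 : rep_space k d2 := fun a => V' (arrow_head a) *m M a *m U' (arrow_tail a).
have VM : is_hom M M1 V.
  by move=> a; rewrite /M1 -[RHS]mulmxA UV -[RHS]mulmxA -eM mulmxA Ve.
have VM' : is_hom M M2 V'.
  move=> a; rewrite /M2 -[RHS]mulmxA UV' mulmxBr mulmx1.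
  by rewrite -[_ *m _ *m e _]mulmxA -eM mulmxA V'e mul0mx subr0.
have repN (d' : dim_vector A) (N : rep_space k d') (f : forall z, 'M[k]_(d' z, d z))
    (g : forall z, 'M[k]_(d z, d' z)) : is_hom M N f -> (forall z, f z *m g z = 1%:M) -> is_rep N.
  move=> fM fg r rr.
  have E : f _ *m relation_eval id M r = relation_eval id N r *m f _.
    rewrite mulmx_sumr mulmx_suml; apply: eq_bigr => cp _.
    by rewrite -scalemxAr -scalemxAl (path_eval_iso fM).
  by rewrite -[LHS]mulmx1 -(fg (source r)) mulmxA -E (repM r rr) mulmx0 mul0mx.
have VU'0 z : V z *m U' z = 0 by rewrite -Ve -mulmxA eU' mulmx0.
have V'U0 z : V' z *m U z = 0.
  by rewrite -[U z]mulmx1 -VU [U z *m _]mulmxA UV mulmxA V'e mul0mx.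
have isoM : isomorphic M (direct_sum M1 M2).
  exists (fun z => col_mx (V z) (V' z)), (fun z => row_mx (U z) (U' z)); split=> [a|z|z].
  - by rewrite mul_col_mx mul_block_col !mul0mx addr0 add0r VM VM'.
  - by rewrite mul_row_col UV UV' addrC subrK.
  - by rewrite mul_col_row VU VU' VU'0 V'U0 -scalar_mx_block.
have [d10|d20] := indM _ _ M1 M2 (repN _ _ _ _ VM VU) (repN _ _ _ _ VM' VU') isoM.
  by left=> z; rewrite -UV -[U z]mulmx1 (_ : 1%:M = 0) ?mulmx0 ?mul0mx //;
     apply/matrixP => i; have := ltn_ord i; rewrite [X in (_ < X)%N]d10.
right=> z; apply/eqP; rewrite eq_sym -subr_eq0 -UV' -[U' z]mulmx1 (_ : 1%:M = 0) ?mulmx0 ?mul0mx //.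
by apply/matrixP => i; have := ltn_ord i; rewrite [X in (_ < X)%N]d20.
Qed.

(** It is not assumed that X is an endomorphism. From g e = g follows e M = e M e, and from e g = g
    follows e M e = M e. *)
Lemma hom_projection (g X e : forall z, 'M[k]_(d z)) : is_hom M M g ->
  (forall z, g z *m X z = e z) -> (forall z, X z *m g z = e z) ->
  (forall z, e z *m g z = g z) -> (forall z, g z *m e z = g z) -> is_hom M M e.
Proof.
move=> gM gXe Xge eg ge a.
have left_e : e (arrow_head a) *m M a = e (arrow_head a) *m M a *m e (arrow_tail a).
  transitivity (X (arrow_head a) *m (M a *m (g (arrow_tail a) *m e (arrow_tail a)))).
    by rewrite ge -gM mulmxA Xge.
  by rewrite [M a *m (_ *m _)]mulmxA -gM !mulmxA Xge.
transitivity (g (arrow_head a) *m M a *m X (arrow_tail a)); last by rewrite gM -mulmxA gXe.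
by rewrite left_e -(gXe (arrow_tail a)) mulmxA -[e _ *m M a *m g _]mulmxA -gM mulmxA eg.
Qed.

(** For a stable power g of f, let [e] be the projection onto the image of g along its kernel. It is
    an endomorphism, and indecomposability leaves only 0 and 1: then f is nilpotent or
    invertible. *)
Lemma Fitting (f : forall z, 'M[k]_(d z)) : is_rep M -> indecomposable M -> is_hom M M f ->
  (forall z, f z \in unitmx) \/ exists n, forall z, mxpow (f z) n = 0.
Proof.
move=> repM indM fM; have [n rk_n] := rank_stable f.
pose g z := mxpow (f z) n.+1; have gM : is_hom M M g := hom_pow n.+1 fM.
have [r [U [V [UV unitVU]]]] : exists (r : vertex A -> nat) (U : forall z, 'M[k]_(d z, r z))
    (V : forall z, 'M[k]_(r z, d z)),
    (forall z, U z *m V z = g z) /\ (forall z, V z *m U z \in unitmx).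
  exists (fun z => \rank (g z)), (fun z => col_base (g z)), (fun z => row_base (g z)).
  split=> z; first exact: mulmx_base.
  (* The product [V z *m U z] has full rank because no rank is lost from g to its square. *)
  rewrite -row_free_unit -row_leq_rank.
  have E : g z *m g z = col_base (g z) *m (row_base (g z) *m col_base (g z)) *m row_base (g z).
    by rewrite mulmxA mulmx_base -mulmxA mulmx_base.
  apply: leq_trans (_ : \rank (g z *m g z) <= _)%N; first by rewrite rk_n.
  by rewrite E; exact: leq_trans (mxrankM_maxl _ _) (mxrankM_maxr _ _).
pose W z := invmx (V z *m U z); pose e z := U z *m W z *m V z.
have gXe z : g z *m (U z *m W z *m W z *m V z) = e z.
  transitivity (U z *m (V z *m U z *m W z) *m W z *m V z); first by rewrite -UV !mulmxA.
  by rewrite mulmxV // mulmx1.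
have Xge z : (U z *m W z *m W z *m V z) *m g z = e z.
  transitivity (U z *m W z *m (W z *m (V z *m U z)) *m V z); first by rewrite -UV !mulmxA.
  by rewrite mulVmx // mulmx1.
have eg z : e z *m g z = g z.
  transitivity (U z *m (W z *m (V z *m U z)) *m V z); first by rewrite -UV /e !mulmxA.
  by rewrite mulVmx // mulmx1 UV.
have ge z : g z *m e z = g z.
  transitivity (U z *m (V z *m U z *m W z) *m V z); first by rewrite -UV /e !mulmxA.
  by rewrite mulmxV // mulmx1 UV.
have ee z : e z *m e z = e z by rewrite -{1}Xge -mulmxA ge Xge.
have eM : is_hom M M e := hom_projection gM gXe Xge eg ge.
have [e0|e1] := split_rep repM eM ee indM.
  by right; exists n.+1 => z; rewrite -/(g z) -eg e0 mul0mx.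
by left=> z; have := gXe z; rewrite e1 /g mxpowS -mulmxA => /mulmx1_unit[].
Qed.

End Fitting.

Section LocalEndomorphisms.
Local Open Scope ring_scope.

Lemma unitmx_1sub_nilp (k : fieldType) p (x : 'M[k]_p) n : mxpow x n = 0 -> 1%:M - x \in unitmx.
Proof.
move=> xn; rewrite -row_free_unit -kermx_eq0; set K := kermx _.
have Kx : K = K *m x.
  by apply/eqP; rewrite -subr_eq0 -[X in X - _]mulmx1 -mulmxBr mulmx_ker.
have Kxn i : K = K *m mxpow x i.
  by elim: i => [|i IHi]; rewrite ?mulmx1 // mxpowS mulmxA -Kx.
by rewrite (Kxn n) xn mulmx0.
Qed.

Variables (k : fieldType) (A : bound_quiver k) (d : dim_vector A) (M : rep_space k d).
Hypotheses (repM : is_rep M) (indM : indecomposable M).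
Implicit Types x y : forall z, 'M[k]_(d z).

(** Let w be the inverse of the sum. By [Fitting], w x is invertible or nilpotent, and in the second
    case w y = 1 - w x is invertible. *)
Lemma add_unit x y : is_hom M M x -> is_hom M M y -> (forall z, x z + y z \in unitmx) ->
  (forall z, x z \in unitmx) \/ (forall z, y z \in unitmx).
Proof.
move=> xM yM uxy; pose w z := invmx (x z + y z).
have wM : is_hom M M w.
  move=> a; rewrite -[LHS]mulmx1 -(mulmxV (uxy (arrow_tail a))) -/(w _) mulmxA.
  by congr (_ *m _); rewrite -mulmxA mulmxDr -xM -yM -mulmxDl mulmxA (mulVmx (uxy _)) mul1mx.
have wxM : is_hom M M (fun z => w z *m x z) by move=> b; rewrite -mulmxA xM !mulmxA wM.
have [u|[n niln]] := Fitting repM indM wxM; [left|right] => z.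
  by have := u z; rewrite unitmx_mul => /andP[_ ->].
have := unitmx_1sub_nilp (niln z); rewrite -(mulVmx (uxy z)) -/(w z) -mulmxBr addrC addKr.
by rewrite unitmx_mul => /andP[].
Qed.

Lemma sum_unit (I : Type) (s : seq I) (x : I -> forall z, 'M[k]_(d z)) :
  (forall i, is_hom M M (x i)) -> (forall z, \sum_(i <- s) x i z \in unitmx) ->
  exists i, forall z, x i z \in unitmx.
Proof.
move=> xM; elim: s => [|i s IHs] u.
  case: indM => -[] z; have := mxrank_unit (u z).
  by rewrite big_nil mxrank0.
have sM : is_hom M M (fun z => \sum_(i <- s) x i z).
  by move=> a; rewrite mulmx_sumr mulmx_suml; apply: eq_bigr => j _; rewrite xM.
have [|ux|/IHs//] := add_unit (xM i) sM; last by exists i.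
by move=> z; have := u z; rewrite big_cons.
Qed.

(** The identity of M is a sum of endomorphisms through M', so one of them is invertible. As M' has
    the same dimension vector, its factor from M to M' is square at each vertex, hence
    invertible. *)
Lemma divides_power_iso (M' : rep_space k d) : divides_power M M' -> rep_iso M M'.
Proof.
case=> I [f [g [fM gM gf]]]; have gfM i : is_hom M M (fun z => g i z *m f i z).
  by move=> a; rewrite -mulmxA fM !mulmxA gM.
have [|i u] := sum_unit (s := index_enum I) gfM; first by move=> z; rewrite gf unitmx1.
have uf z : f i z \in unitmx by have := u z; rewrite unitmx_mul => /andP[_ ->].
exists (f i), (fun z => invmx (f i z)).
by split=> [a|z|z]; [exact: fM | exact: mulVmx | exact: mulmxV].
Qed.

(* Both generic representations are defined over the residue field of the common
   prime ideal of the two orbit closures. *)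
Lemma same_vanishing_iso (M' : rep_space k d) :
  (forall f, vanishes M f <-> vanishes M' f) -> rep_iso M M'.
Proof.
move=> vanE; apply: divides_power_iso.
have [F [phi [N [isoN NE]]]] := generic_orbit_point M.
have [F' [phi' [N' [isoN' NE']]]] := generic_orbit_point M'.
have [P _ PN] := orbit_point isoN.
have [K [rho [rhoE lift]]] := residue_field P.
pose iota : {rmorphism k -> K} := rho \o @mpolyC _ k.
pose G : rep_space K d := map_rep rho (@generic_rep k A d).
(* Over [F0] the representations [G] and [M0] become isomorphic; what is brought down to [K] is only
   that each divides a power of the other. *)
have descend (M0 : rep_space k d) (F0 : fieldType) (phi0 : {rmorphism k -> F0}) (N0 : rep_space F0 d) :
    rep_iso (map_rep phi0 M0) N0 -> (forall f, evalr phi0 N0 f = 0 <-> f \in (P : pred _)) ->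
    divides_power (map_rep iota M0) G /\ divides_power G (map_rep iota M0).
  move=> iso0 P0; have [chi chiE] := lift F0 (evalr phi0 N0) P0.
  have E1 : map_rep chi G = N0.
    rewrite map_repE -[RHS](evalr_generic phi0) (_ : chi \o rho = evalr phi0 N0) //.
    by apply/funext => f; rewrite chiE.
  have E2 : map_rep chi (map_rep iota M0) = map_rep phi0 M0.
    rewrite map_repE (_ : chi \o iota = phi0) //.
    by apply/funext => c; rewrite /= -chiE /= mmapC.
  by split; apply: (divides_power_descent (phi := chi)); apply: iso_divides_power; rewrite E1 E2 //;
     exact: rep_iso_sym.
have [MG _] := descend _ _ _ _ isoN PN.
have PN' f : evalr phi' N' f = 0 <-> f \in (P : pred _).
  by split=> [/NE'/vanE/NE/PN|/PN/NE/vanE/NE'].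
have [_ GM'] := descend _ _ _ _ isoN' PN'.
exact: divides_power_descent (divides_power_trans MG GM').
Qed.

End LocalEndomorphisms.

(** * Degenerations *)

Section Degeneration.
Local Open Scope ring_scope.
Variables (k : fieldType) (A : bound_quiver k).

(* The function [f] vanishes on the orbit of [N]; dimension vectors that differ
   from the one of [f] are allowed, and make the condition void unless they agree
   pointwise. *)
Definition nul (d : dim_vector A) (f : rep_ring d) (e : dim_vector A) (F : fieldType)
    (phi : {rmorphism k -> F}) (N : rep_space F e) : Prop :=
  forall (F' : fieldType) (psi : {rmorphism F -> F'}) (N' : rep_space F' d),
    rep_iso (map_rep psi N) N' -> evalr (psi \o phi) N' f = 0.

Lemma map_rep_id (e : dim_vector A) (R : comNzRingType) (N : rep_space R e) : map_rep idfun N = N.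
Proof. by apply: functional_extensionality_dep => a; rewrite /map_rep map_mx_id. Qed.

Section Nul.
Variables (d : dim_vector A) (f : rep_ring d).

Lemma nul_iso (e e' : dim_vector A) (F : fieldType) (phi : {rmorphism k -> F})
    (N : rep_space F e) (N' : rep_space F e') : rep_iso N N' -> nul f phi N' -> nul f phi N.
Proof.
move=> isoN nulN' F' psi L isoL; apply: nulN'; apply: rep_iso_trans isoL.
exact/map_rep_iso/rep_iso_sym.
Qed.

Lemma nul_vanishes (M : rep_space k d) : vanishes M f -> nul f idfun M.
Proof.
move=> van F psi N isoN.
exact: (van F psi).
Qed.

Lemma nul_evalr (F : fieldType) (phi : {rmorphism k -> F}) (N : rep_space F d) :
  nul f phi N -> evalr phi N f = 0.
Proof. by move=> /(_ F idfun N); apply; rewrite map_rep_id; exact: rep_iso_refl. Qed.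

(** An isomorphism with the fibre at c has constant entries, so it transports the whole family.
    There f takes a polynomial value that is 0 in the fraction field, hence 0, and evaluating it at
    c gives the claim. *)
Lemma nul_specialization (e : dim_vector A) (F : fieldType) (phi : {rmorphism k -> F})
    (N : rep_space {poly F} e) (c : F) :
  nul f (@tofrac {poly F} \o (@polyC F \o phi)) (map_rep (@tofrac {poly F}) N) ->
  nul f phi (map_rep (horner_eval c) N).
Proof.
move=> nulN F' psi L isoL; case: (isoL) => g [g' [gN g'g gg']].
pose psiX : {rmorphism {poly F} -> {poly F'}} := map_poly psi.
have inj p : (@tofrac {poly F'} \o psiX) p = 0 -> p = 0.
  by move/eqP; rewrite /= tofrac_eq0 map_poly_eq0 => /eqP.
have [chi chiE] := frac_lift_morphism inj.
pose NX : rep_space {poly F'} d := fun a =>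
  map_mx polyC (g (arrow_head a)) *m map_mx psiX (N a) *m map_mx polyC (g' (arrow_tail a)).
have isoX : rep_iso (map_rep psiX N) NX.
  exists (fun z => map_mx polyC (g z)), (fun z => map_mx polyC (g' z)).
  split=> [a|z|z].
  - by rewrite /NX -[RHS]mulmxA -(map_mxM polyC) g'g map_mx1 mulmx1.
  - by rewrite -(map_mxM polyC) g'g map_mx1.
  - by rewrite -(map_mxM polyC) gg' map_mx1.
have LE : L = map_rep (horner_eval (psi c)) NX.
  apply: functional_extensionality_dep => a; rewrite (rep_isoE gN g'g gg').
  rewrite /map_rep !map_mxM -!map_mx_comp; congr (_ *m _ *m _); apply/matrixP => i j; rewrite !mxE /=.
  - by rewrite /horner_eval hornerC.
  - by rewrite /horner_eval /psiX /= horner_map.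
  - by rewrite /horner_eval hornerC.
pose phiX : {rmorphism k -> {poly F'}} := @polyC F' \o (psi \o phi).
suff NX0 : evalr phiX NX f = 0.
  have := evalr_comp phiX (horner_eval (psi c)) NX f; rewrite NX0 rmorph0 -LE.
  have E : horner_eval (psi c) \o phiX =1 psi \o phi by move=> x; rewrite /= /horner_eval hornerC.
  by move=> /esym; rewrite /= (_ : horner_eval (psi c) \o phiX = psi \o phi) //; exact/funext.
apply/eqP; rewrite -tofrac_eq0 (evalr_comp phiX (@tofrac {poly F'})); apply/eqP.
have := nulN _ chi (map_rep (@tofrac {poly F'}) NX).
have -> : map_rep chi (map_rep (@tofrac {poly F}) N) = map_rep (@tofrac {poly F'}) (map_rep psiX N).
  rewrite !map_repE (_ : chi \o @tofrac {poly F} = @tofrac {poly F'} \o psiX) //.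
  by apply/funext => x; rewrite /= chiE.
move=> /(_ (map_rep_iso _ isoX)); rewrite /=.
rewrite (_ : chi \o (@tofrac {poly F} \o (@polyC F \o phi)) = @tofrac {poly F'} \o phiX) //.
by apply/funext => x /=; rewrite chiE /psiX /= map_polyC.
Qed.

End Nul.

Lemma rep_iso_dim (F : fieldType) (e e' : dim_vector A) (N : rep_space F e) (N' : rep_space F e') :
  rep_iso N N' -> e =1 e'.
Proof. by case=> f [g [_ gf fg]] z; apply: inverse_dims (gf z) (fg z). Qed.

End Degeneration.

Section LambdaRepresentations.
Local Open Scope ring_scope.
Variables (k : fieldType) (m n : nat).
Let A := Lambda k m n.

Definition triple_dim (d1 d2 : nat) : dim_vector A := fun z =>
  match z with vertex_1 => d1 | vertex_2 => d2 end.

Definition triple (R : comNzRingType) (d1 d2 : nat) (a : 'M[R]_d1) (b : 'M[R]_d2)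
    (c : 'M[R]_(d2, d1)) : rep_space R (triple_dim d1 d2) :=
  fun x => match x with arrow_a => a | arrow_b => b | arrow_c => c end.

Lemma rep_triple (R : comNzRingType) (d : dim_vector A) (N : rep_space R d) :
  rep_iso N (triple (N arrow_a) (N arrow_b) (N arrow_c)).
Proof.
exists (fun z => match z as z0 return 'M[R]_(triple_dim (d vertex_1) (d vertex_2) z0, d z0) with
  vertex_1 => 1%:M | vertex_2 => 1%:M end),
  (fun z => match z as z0 return 'M[R]_(d z0, triple_dim (d vertex_1) (d vertex_2) z0) with
  vertex_1 => 1%:M | vertex_2 => 1%:M end).
by split=> [[]|[]|[]] /=; rewrite ?mul1mx ?mulmx1.
Qed.

Lemma triple_iso (R : comNzRingType) (d1 d2 e1 e2 : nat) (a : 'M[R]_d1) (b : 'M[R]_d2) c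
    (a' : 'M[R]_e1) (b' : 'M[R]_e2) c' (P : 'M_(e1, d1)) P' (Q : 'M_(e2, d2)) Q' :
  P *m a = a' *m P -> Q *m b = b' *m Q -> Q *m c = c' *m P ->
  P' *m P = 1%:M -> P *m P' = 1%:M -> Q' *m Q = 1%:M -> Q *m Q' = 1%:M ->
  rep_iso (triple a b c) (triple a' b' c').
Proof.
move=> Pa Qb Qc P'P PP' Q'Q QQ'.
exists (fun z => match z as z0 return 'M[R]_(triple_dim e1 e2 z0, triple_dim d1 d2 z0) with
  vertex_1 => P | vertex_2 => Q end),
  (fun z => match z as z0 return 'M[R]_(triple_dim d1 d2 z0, triple_dim e1 e2 z0) with
  vertex_1 => P' | vertex_2 => Q' end).
by split=> [[]|[]|[]] /=.
Qed.

Lemma map_triple (R S : comNzRingType) (phi : {rmorphism R -> S}) (d1 d2 : nat)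
    (a : 'M[R]_d1) (b : 'M[R]_d2) c :
  map_rep phi (triple a b c) = triple (map_mx phi a) (map_mx phi b) (map_mx phi c).
Proof. by apply: functional_extensionality_dep; case. Qed.

Lemma path_eval_a (R : comNzRingType) (d : dim_vector A) (N : rep_space R d) i :
  path_eval N (iter i (@then_a _) Lambda_e1) = mxpow (N arrow_a) i.
Proof. by elim: i => //= i ->. Qed.

Lemma path_eval_b (R : comNzRingType) (d : dim_vector A) (N : rep_space R d) i :
  path_eval N (iter i (@then_b _) Lambda_e2) = mxpow (N arrow_b) i.
Proof. by elim: i => //= i ->. Qed.

Definition commuting_triple (R : comNzRingType) (d1 d2 : nat) (a : 'M[R]_d1) (b : 'M[R]_d2)
    (c : 'M[R]_(d2, d1)) : Prop :=
  [/\ mxpow a m = 0, mxpow b n = 0, c *m a = b *m c & b *m (b *m c) = 0].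

Lemma Lambda_relations (R : comNzRingType) (phi : {rmorphism k -> R}) (d : dim_vector A)
    (N : rep_space R d) :
  (forall r, relations (b := A) r -> relation_eval phi N r = 0) <->
  commuting_triple (N arrow_a) (N arrow_b) (N arrow_c).
Proof.
split=> [relN|[am bn ca bbc] r].
  split.
  - have := relN _ (or_introl (or_introl (or_introl erefl))).
    by rewrite /relation_eval /= big_seq1 /= rmorph1 scale1r path_eval_a.
  - have := relN _ (or_introl (or_introl (or_intror erefl))).
    by rewrite /relation_eval /= big_seq1 /= rmorph1 scale1r path_eval_b.
  - have := relN _ (or_introl (or_intror erefl)).
    rewrite /relation_eval /= big_cons big_seq1 /= rmorphN rmorph1 scale1r scaleN1r !mulmx1.
    by move/eqP; rewrite subr_eq0 => /eqP.
  have := relN _ (or_intror erefl).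
  by rewrite /relation_eval /= big_seq1 /= rmorph1 scale1r mulmx1.
case=> [[[->|->]|->]|->].
- by rewrite /relation_eval /= big_seq1 /= rmorph1 scale1r path_eval_a.
- by rewrite /relation_eval /= big_seq1 /= rmorph1 scale1r path_eval_b.
- by rewrite /relation_eval /= big_cons big_seq1 /= rmorphN rmorph1 scale1r scaleN1r !mulmx1 ca subrr.
by rewrite /relation_eval /= big_seq1 /= rmorph1 scale1r mulmx1.
Qed.

End LambdaRepresentations.

Section Deformations.
Local Open Scope ring_scope.
Variables (k : fieldType) (m n : nat).

Lemma map_blk (R S : comNzRingType) (phi : R -> S) (I J : finType) (a : I -> nat) (b : J -> nat) F :
  map_mx phi (blk a b F) = blk a b (fun i p j q => phi (F i p j q)).
Proof. by apply/matrixP => i j; rewrite !mxE. Qed.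

Lemma map_Jord (R S : comNzRingType) (phi : {rmorphism R -> S}) (I : finType) (a : I -> nat) :
  map_mx phi (Jord R a) = Jord S a.
Proof. by rewrite map_blk; apply/matrixP => i j; rewrite !mxE rmorph_nat. Qed.

Lemma commuting_triple_iso (R : comNzRingType) (d1 d2 e1 e2 : nat) (a : 'M[R]_d1) (b : 'M[R]_d2)
    (c : 'M[R]_(d2, d1)) (a' : 'M[R]_e1) (b' : 'M[R]_e2) :
  sim a a' -> sim b b' -> commuting_triple m n a b c ->
  exists c' : 'M[R]_(e2, e1), commuting_triple m n a' b' c' /\
    rep_iso (triple (k := k) (m := m) (n := n) a b c) (triple a' b' c').
Proof.
move=> sim_a sim_b [am bn ca bbc].
have a'm := sim_mxpow0 sim_a am; have b'n := sim_mxpow0 sim_b bn.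
case: sim_a => P [P' [Pa P'P PP']]; case: sim_b => Q [Q' [Qb Q'Q QQ']].
exists (Q *m c *m P'); split; last first.
  have Qc : Q *m c = Q *m c *m P' *m P by rewrite -[RHS]mulmxA P'P mulmx1.
  exact: triple_iso Pa Qb Qc P'P PP' Q'Q QQ'.
have bQ (x : 'M_(d2, e1)) : b' *m (Q *m x) = Q *m (b *m x) by rewrite !mulmxA Qb.
split=> //.
- rewrite -!mulmxA bQ (_ : P' *m a' = a *m P'); first by rewrite [c *m (_ *m _)]mulmxA ca -mulmxA.
  by rewrite -[LHS]mulmx1 -PP' mulmxA -[_ *m a' *m P]mulmxA -Pa !mulmxA P'P mul1mx.
by rewrite -!mulmxA !bQ [b *m (c *m _)]mulmxA [b *m (_ *m _ *m _)]mulmxA bbc mul0mx mulmx0.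
Qed.

(* A perturbation that preserves the relations is undone by specialising the
   parameter to 0. *)
Lemma deform (F : fieldType) (phi : {rmorphism k -> F}) (d1 d2 e1 e2 : nat) (a u : 'M[F]_d1)
    (b v : 'M[F]_d2) (c : 'M[F]_(d2, d1)) (F' := {fraction {poly F}})
    (iota := @tofrac {poly F} \o @polyC F) (a' : 'M[F']_e1) (b' : 'M[F']_e2) :
  commuting_triple m n a b c -> c *m u = 0 -> v *m c = 0 ->
  sim (map_mx iota a + tofrac 'X *: map_mx iota u) a' ->
  sim (map_mx iota b + tofrac 'X *: map_mx iota v) b' ->
  mxpow a' m = 0 -> mxpow b' n = 0 ->
  exists c' : 'M[F']_(e2, e1), commuting_triple m n a' b' c' /\
    forall (d : dim_vector (Lambda k m n)) (f : rep_ring d),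
      nul f (@tofrac {poly F} \o (@polyC F \o phi)) (triple a' b' c') -> nul f phi (triple a b c).
Proof.
move=> [am bn ca bbc] cu vc sim_a sim_b a'm b'n.
pose aX : 'M[{poly F}]_d1 := map_mx polyC a + 'X *: map_mx polyC u.
pose bX : 'M[{poly F}]_d2 := map_mx polyC b + 'X *: map_mx polyC v.
have aXE : map_mx (@tofrac {poly F}) aX = map_mx iota a + tofrac 'X *: map_mx iota u.
  by rewrite map_mxD map_mxZ -!map_mx_comp.
have bXE : map_mx (@tofrac {poly F}) bX = map_mx iota b + tofrac 'X *: map_mx iota v.
  by rewrite map_mxD map_mxZ -!map_mx_comp.
have bXc : (map_mx iota b + tofrac 'X *: map_mx iota v) *m map_mx iota c = map_mx iota (b *m c).
  by rewrite mulmxDl -scalemxAl -!map_mxM vc map_mx0 scaler0 addr0.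
have [|c' [relc' iso_c']] := @commuting_triple_iso _ _ _ _ _ _ _ (map_mx iota c) _ _ sim_a sim_b.
  split; [exact: sim_mxpow0 (sim_sym sim_a) a'm | exact: sim_mxpow0 (sim_sym sim_b) b'n | |].
    by rewrite bXc mulmxDr -scalemxAr -!map_mxM cu map_mx0 scaler0 addr0 ca.
  rewrite bXc mulmxDl -scalemxAl -!map_mxM bbc -ca [v *m (_ *m _)]mulmxA vc mul0mx.
  by rewrite map_mx0 scaler0 addr0.
exists c'; split=> // d f nul_c'.
have -> : triple (k := k) (m := m) (n := n) a b c =
    map_rep (horner_eval 0) (triple aX bX (map_mx polyC c)).
  rewrite map_triple; congr triple; apply/matrixP => i j; rewrite !mxE /=.
  - by rewrite /horner_eval hornerD hornerM hornerX mul0r addr0 hornerC.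
  - by rewrite /horner_eval hornerD hornerM hornerX mul0r addr0 hornerC.
  - by rewrite /horner_eval hornerC.
apply: nul_specialization; rewrite map_triple aXE bXE -map_mx_comp.
exact: nul_iso nul_c'.
Qed.

Section Moves.
Variables (F : fieldType) (phi : {rmorphism k -> F}) (I J : finType) (a : I -> nat) (b : J -> nat).
Variable c : 'M[F]_(#|bix b|, #|bix a|).
Hypotheses (a_bound : forall i, (0 < a i <= m)%N) (b_bound : forall j, (0 < b j <= n)%N).
Hypothesis rel_c : commuting_triple m n (Jord F a) (Jord F b) c.

(** Only the first two columns of a block of C can be non-zero, and the last column of a block of
    width at least 3 is not among them. *)
Lemma mul_last_unit j0 j1 : (2 < a j0)%N -> c *m last_unit F a j0 j1 = 0.
Proof.
move=> a3; case: rel_c => _ _ ca bbc.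
have [|h -> _] := bandsP _ ca bbc; first by move=> i; case/andP: (a_bound i).
apply: entP => i p j q lt_p lt_q; rewrite ent_mul ent0 big1 // => j' _; rewrite big1 // => r _.
rewrite !ent_blk //; case: (eqVneq j' j0) => [_|]; last by rewrite mulr0.
case: (eqVneq r.+1 (a j0)) => [rE|]; last by rewrite !andbF mulr0.
by rewrite big1 ?mul0r // => t _; rewrite (_ : (_ == _)%N = false) ?mulr0 //; lia.
Qed.

(** Only the last two rows of a block of C can be non-zero, so the top row of a block of height at
    least 3 is zero. *)
Lemma mul_first_unit j0 j1 : (2 < b j0)%N -> first_unit F b j0 j1 *m c = 0.
Proof.
move=> b3; case: rel_c => _ _ ca bbc.
have [|h -> _] := bandsP _ ca bbc; first by move=> i; case/andP: (a_bound i).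
apply: entP => i p j q lt_p lt_q; rewrite ent_mul ent0 big1 // => j' _; rewrite big1 // => r _.
rewrite !ent_blk //; case: (eqVneq j' j0) => [ej|]; last by rewrite andbF mul0r.
case: (eqVneq (r : nat) 0%N) => [r0|]; last by rewrite !andbF mul0r.
by rewrite [X in _ * X]big1 ?mulr0 // => t _; rewrite r0 ej (_ : (_ == _)%N = false) ?mulr0 //; lia.
Qed.

End Moves.
End Deformations.

(** * Reduction of the Jordan types *)

Section Reduction.

Definition bounded (m : nat) (I : finType) (a : I -> nat) : Prop := forall i, 0 < a i <= m.

(** No transfer is possible any more. For bounded sizes this leaves at most one block whose size is
    strictly between 2 and m. *)
Definition reduced (m : nat) (I : finType) (a : I -> nat) : Prop :=
  forall j0 j1, j0 != j1 -> 2 < a j0 -> a j0 <= a j1 -> m <= a j1.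

(** A transfer preserves the sum of the sizes, so the defect falls exactly when the sum of their
    squares grows, as it does if the receiving block is at least as large. *)
Definition defect (m : nat) (I : finType) (a : I -> nat) : nat := \sum_i a i * (m - a i).

Lemma reduced_or_move m (I : finType) (a : I -> nat) : reduced m a \/
  exists j0 j1, [/\ j0 != j1, 2 < a j0, a j0 <= a j1 & a j1 < m].
Proof.
have [/existsP[j0 /existsP[j1 /and4P[]]]|no] :=
  boolP [exists j0, [exists j1, [&& j0 != j1, 2 < a j0, a j0 <= a j1 & a j1 < m]]].
  by right; exists j0, j1.
left=> j0 j1 neq_j a3 le_a; rewrite leqNgt; apply: contra no => lt_m.
by apply/existsP; exists j0; apply/existsP; exists j1; rewrite neq_j a3 le_a lt_m.
Qed.

Lemma bounded_moved m (I : finType) (a : I -> nat) j0 j1 :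
  j0 != j1 -> 1 < a j0 -> a j1 < m -> bounded m a -> bounded m (moved a j0 j1).
Proof.
move=> neq_j a2 lt_m bd i; have := bd i; have := bd j0; rewrite /moved.
by case: eqP => // _; [lia | case: eqP => // _; lia].
Qed.

Lemma square_gap x y m : x < y -> y < m ->
  x * (m - x) + y.+1 * (m - y.+1) < x.+1 * (m - x.+1) + y * (m - y).
Proof.
move=> lt_xy lt_ym; have [e ye] : exists e, y = x.+1 + e by exists (y - x.+1); lia.
have [g mg] : exists g, m = y.+1 + g by exists (m - y.+1); lia.
have -> : m - x = e + g + 2 by lia.
have -> : m - y.+1 = g by lia.
have -> : m - x.+1 = e + g + 1 by lia.
have -> : m - y = g + 1 by lia.
by subst y; nia.
Qed.

Lemma defect_moved m (I : finType) (a : I -> nat) j0 j1 :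
  j0 != j1 -> 0 < a j0 -> a j0 <= a j1 -> a j1 < m -> defect m (moved a j0 j1) < defect m a.
Proof.
move=> neq_j a0 le_a lt_m; rewrite /defect.
have j10 : true && (j1 != j0) by rewrite eq_sym.
rewrite (bigD1 j0) // (bigD1 j1) //.
rewrite [ltnRHS](bigD1 j0) // [X in _ < _ + X](bigD1 j1) //.
rewrite moved0 moved1 // [X in _ + (_ + X) < _](eq_bigr (fun i => a i * (m - a i))); last first.
  by move=> i /andP[/= /negPf ni0 /negPf ni1]; rewrite /moved ni0 ni1.
rewrite addnA [ltnRHS]addnA ltn_add2r; have := @square_gap (a j0).-1 (a j1) m.
by rewrite prednK // => /(_ le_a lt_m).
Qed.

Local Open Scope ring_scope.
Variables (k : fieldType) (m n : nat).

(** Each transfer passes to a rational function field in one more variable, where the deformation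
    parameter is invertible. Specialisations carry [nul] back to the original field, which is why
    the final field is existentially quantified. *)
Lemma reduction (s : nat) : forall (F : fieldType) (phi : {rmorphism k -> F}) (I J : finType)
    (a : I -> nat) (b : J -> nat) (c : 'M[F]_(#|bix b|, #|bix a|)),
  (defect m a + defect n b < s)%N -> bounded m a -> bounded n b ->
  commuting_triple m n (Jord F a) (Jord F b) c ->
  exists (F' : fieldType) (phi' : {rmorphism k -> F'}) (a' : I -> nat) (b' : J -> nat)
    (c' : 'M[F']_(#|bix b'|, #|bix a'|)),
  [/\ [/\ bounded m a', bounded n b', reduced m a' & reduced n b'],
      #|bix a| = #|bix a'|, #|bix b| = #|bix b'|,
      commuting_triple m n (Jord F' a') (Jord F' b') c' &
      forall (d : dim_vector (Lambda k m n)) (f : rep_ring d),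
        nul f phi' (triple (Jord F' a') (Jord F' b') c') ->
        nul f phi (triple (Jord F a) (Jord F b) c)].
Proof.
elim: s => // s IHs F phi I J a b c lt_s bd_a bd_b rel_c.
pose F' : fieldType := {fraction {poly F}}; pose iota : {rmorphism F -> F'} := @tofrac {poly F} \o @polyC F.
have X0 : tofrac 'X != 0 :> F' by rewrite tofrac_eq0 polyX_eq0.
have [red_a|[j0 [j1 [neq_j a3 le_a lt_m]]]] := reduced_or_move m a; last first.
  have bd_a' := bounded_moved neq_j (ltnW a3) lt_m bd_a.
  have [||||c' [rel_c' nul_c']] := @deform k m n F phi _ _ _ _ (Jord F a) (last_unit F a j0 j1)
    (Jord F b) 0 c (Jord F' (moved a j0 j1)) (Jord F' b) rel_c
    (mul_last_unit bd_a rel_c j1 a3) (mul0mx _ _).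
  - rewrite map_Jord (_ : map_mx iota (last_unit F a j0 j1) = last_unit F' a j0 j1).
      exact: (sim_last_unit neq_j (ltnW (ltnW a3)) le_a X0).
    by apply/matrixP => i j; rewrite !mxE (rmorph_nat iota).
  - by rewrite map_Jord map_mx0 scaler0 addr0; exact: sim_refl.
  - by apply/Jord_pow0 => i; case/andP: (bd_a' i).
  - by apply/Jord_pow0 => i; case/andP: (bd_b i).
  have [|F1 [phi1 [a1 [b1 [c1 [red ca cb rel1 nul1]]]]]] :=
    IHs _ (@tofrac {poly F} \o (@polyC F \o phi)) I J _ _ c' _ bd_a' bd_b rel_c'.
    rewrite -ltnS; apply: leq_trans lt_s; rewrite ltnS ltn_add2r.
    exact: defect_moved neq_j (ltnW (ltnW a3)) le_a lt_m.
  exists F1, phi1, a1, b1, c1; split=> // [|d f /nul1/nul_c'//].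
  by rewrite -ca; exact: card_moved neq_j (ltnW (ltnW a3)) le_a _ X0.
have [red_b|[j0 [j1 [neq_j b3 le_b lt_n]]]] := reduced_or_move n b; last first.
  have bd_b' := bounded_moved neq_j (ltnW b3) lt_n bd_b.
  have [||||c' [rel_c' nul_c']] := @deform k m n F phi _ _ _ _ (Jord F a) 0
    (Jord F b) (first_unit F b j0 j1) c (Jord F' a) (Jord F' (moved b j0 j1)) rel_c
    (mulmx0 _ _) (mul_first_unit bd_a rel_c j1 b3).
  - by rewrite map_Jord map_mx0 scaler0 addr0; exact: sim_refl.
  - rewrite map_Jord (_ : map_mx iota (first_unit F b j0 j1) = first_unit F' b j0 j1).
      exact: (sim_first_unit neq_j (ltnW (ltnW b3)) le_b X0).
    by apply/matrixP => i j; rewrite !mxE (rmorph_nat iota).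
  - by apply/Jord_pow0 => i; case/andP: (bd_a i).
  - by apply/Jord_pow0 => i; case/andP: (bd_b' i).
  have [|F1 [phi1 [a1 [b1 [c1 [red ca cb rel1 nul1]]]]]] :=
    IHs _ (@tofrac {poly F} \o (@polyC F \o phi)) I J _ _ c' _ bd_a bd_b' rel_c'.
    rewrite -ltnS; apply: leq_trans lt_s; rewrite ltnS ltn_add2l.
    exact: defect_moved neq_j (ltnW (ltnW b3)) le_b lt_n.
  exists F1, phi1, a1, b1, c1; split=> // [|d f /nul1/nul_c'//].
  by rewrite -cb; exact: card_moved neq_j (ltnW (ltnW b3)) le_b _ X0.
by exists F, phi, a, b, c; split.
Qed.

End Reduction.

(** * Lines through the link matrix *)

Section Congruence.
Local Open Scope ring_scope.

Definition cong (S : comNzRingType) (r x y : S) : Prop := exists q, x - y = r * q.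

Lemma cong_refl (S : comNzRingType) (r x : S) : cong r x x.
Proof. by exists 0; rewrite subrr mulr0. Qed.

Lemma congD (S : comNzRingType) (r x x' y y' : S) : cong r x y -> cong r x' y' -> cong r (x + x') (y + y').
Proof. by case=> q E [q' E']; exists (q + q'); rewrite mulrDr -E -E' opprD addrACA. Qed.

Lemma congM (S : comNzRingType) (r x x' y y' : S) : cong r x y -> cong r x' y' -> cong r (x * x') (y * y').
Proof.
case=> q E [q' E']; exists (q * x' + y * q'); rewrite mulrDr mulrA -E mulrCA -E'.
by rewrite mulrBl mulrBr addrA subrK.
Qed.

Lemma congX (S : comNzRingType) (r x y : S) n : cong r x y -> cong r (x ^+ n) (y ^+ n).
Proof. by move=> xy; elim: n => [|n IHn]; rewrite ?exprS; [exact: cong_refl | exact: congM]. Qed.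

Lemma cong_mx (S : comNzRingType) (r : S) p q (x y z : 'M[S]_(p, q)) i j :
  x = y + r *: z -> cong r (x i j) (y i j).
Proof. by move=> ->; exists (z i j); rewrite !mxE [_ + r * _]addrC addrK. Qed.

Lemma mulmx_curve (S : comNzRingType) (r : S) p q p' q' (P : 'M[S]_(p', p)) (x y : 'M[S]_(p, q))
    (Q : 'M[S]_(q, q')) : P *m (x + r *: y) *m Q = P *m x *m Q + r *: (P *m y *m Q).
Proof. by rewrite mulmxDr mulmxDl -scalemxAr -scalemxAl. Qed.

Lemma evalr_cong (k : fieldType) (A : bound_quiver k) (d : dim_vector A) (S : comNzRingType)
    (phi : {rmorphism k -> S}) (r : S) (N N' : rep_space S d) f :
  (forall a i j, cong r (N a i j) (N' a i j)) -> cong r (evalr phi N f) (evalr phi N' f).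
Proof.
move=> NN'; rewrite /= /mmap; apply: (big_ind2 (cong r)) => [|*|]; [exact: cong_refl | exact: congD |].
move=> m _; apply: congM; first exact: cong_refl.
rewrite /mmap1; apply: (big_ind2 (cong r)) => [|*|]; [exact: cong_refl | exact: congM |].
by move=> i _; apply: congX; exact: NN'.
Qed.

Lemma cong_Xn_eq0 (F : fieldType) (p : {poly F}) : (forall j, cong 'X^(j.+1) p 0) -> p = 0.
Proof.
move=> p0; apply/eqP; apply: contraT => nz_p; have [q] := p0 (size p).
rewrite subr0 mulrC => pE; have q0 : q != 0 by apply: contraNneq nz_p => q0; rewrite pE q0 mul0r.
have := congr1 (fun p : {poly F} => size p) pE; rewrite /= size_mulXn //; lia.
Qed.

End Congruence.

Section Curve.
Local Open Scope ring_scope.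
Variables (k : fieldType) (m n : nat).
Variable D : datum.
Hypotheses (wfD : wf_datum D) (tangentD : tangent D D).

Let Ja (R : comNzRingType) := Jord R (@dcol_size D).
Let Jb (R : comNzRingType) := Jord R (@drow_size D).
Let L (R : comNzRingType) := link_mx R D.

Lemma map_link (R S : comNzRingType) (phi : {rmorphism R -> S}) : map_mx phi (L R) = L S.
Proof.
rewrite map_blk; apply/matrixP => i j; rewrite !mxE rmorph_sum; apply: eq_bigr => t _.
by rewrite rmorphM !rmorph_nat.
Qed.

Lemma link_commutes (R : comNzRingType) : L R *m Ja R = Jb R *m L R.
Proof.
case: wfD => c0 r0 lf.
have h0 (i : drow D) (j : dcol D) : ~~ ((1 < dcol_size j)%N && (1 < drow_size i)%N) -> lk R i j false = 0.
  by move=> ij; rewrite /lk (lf _ _ ij).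
apply: entP => i p j q lt_p lt_q; rewrite ent_mul_Jord // ent_Jord_mul //.
have [lt_q1|ge_q1] := ltnP q.+1 (dcol_size j); last first.
  rewrite ent_big ?ge_q1 ?orbT //; case: p lt_p => // p lt_p; rewrite ent_blk ?(ltnW lt_p) // big_bool /=.
  rewrite (_ : (p + 2 == q + drow_size i + 1)%N = false) ?mulr0 ?add0r; last lia.
  have [pE|] := eqVneq (p + 2)%N (q + drow_size i + 0)%N; last by rewrite mulr0.
  by rewrite h0 ?mul0r //; lia.
case: p lt_p => [|p] lt_p; rewrite !ent_blk ?(ltnW lt_p) //.
rewrite big_bool /= (_ : (0 + 2 == q.+1 + drow_size i + 1)%N = false) ?mulr0 ?add0r.
  have [pE|] := eqVneq (0 + 2)%N (q.+1 + drow_size i + 0)%N; last by rewrite mulr0.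
  by rewrite h0 ?mul0r //; lia.
by have := r0 i; lia.
Qed.

Lemma link_annihilated (R : comNzRingType) : Jb R *m (Jb R *m L R) = 0.
Proof.
apply: entP => i p j q lt_p lt_q; rewrite ent0 ent_Jord_mul //.
case: p lt_p => // p lt_p; rewrite ent_Jord_mul ?(ltnW lt_p) //.
case: p lt_p => // p lt_p; rewrite ent_blk ?(ltnW (ltnW lt_p)) // big1 // => t _.
by rewrite (_ : (_ == _)%N = false) ?mulr0 //; lia.
Qed.

(* To any order in [s], the curve [L + s C] stays in the orbit of [L]: the tangent
   condition corrects the error term one order at a time. *)
Lemma curve_lift (S : idomainType) (s : S) (C : 'M[S]_(#|bix (@drow_size D)|, #|bix (@dcol_size D)|)) j :
  s != 0 -> C *m Ja S = Jb S *m C -> Jb S *m (Jb S *m C) = 0 ->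
  exists G0 H0 E, let G := 1%:M + s *: G0 in let H := 1%:M + s *: H0 in
    [/\ G *m Jb S = Jb S *m G, H *m Ja S = Ja S *m H &
        L S + s *: C = G *m L S *m H + s ^+ j.+1 *: E].
Proof.
move=> s0 CJ JJC; elim: j => [|j [G0 [H0 [E]]]] /=.
  by exists 0, 0, C; rewrite !scaler0 !addr0 !mul1mx !mulmx1.
move GE : (1%:M + _) => G; move HE : (1%:M + _) => H [GJ HJ GLH].
have scalI p q (A B : 'M[S]_(p, q)) : s ^+ j.+1 *: A = s ^+ j.+1 *: B -> A = B.
  move=> AB; apply/matrixP => x y; have /matrixP/(_ x y) := AB; rewrite !mxE.
  by apply: mulfI; rewrite expf_neq0.
have EE : s ^+ j.+1 *: E = L S + s *: C - G *m L S *m H by rewrite GLH addrC addKr.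
have LJ := link_commutes S; have JJL := link_annihilated S.
(* In a domain s^(j+1) cancels, so the error satisfies the same linear equations as C and the
   tangent condition applies to it. *)
have EJ : E *m Ja S = Jb S *m E.
  apply: scalI; rewrite scalemxAl EE scalemxAr EE mulmxBl mulmxBr mulmxDl mulmxDr.
  rewrite -!scalemxAl -!scalemxAr CJ LJ; congr (_ - _).
  by rewrite -[G *m L S *m H *m _]mulmxA HJ mulmxA -[G *m L S *m _]mulmxA LJ !mulmxA GJ.
have JJG : Jb S *m (Jb S *m (G *m L S *m H)) = 0.
  by rewrite !mulmxA -[Jb S *m Jb S *m G]mulmxA -GJ [Jb S *m (G *m _)]mulmxA -GJ
    -!mulmxA [Jb S *m (L S *m _)]mulmxA
    [Jb S *m (Jb S *m _ *m _)]mulmxA JJL mul0mx mulmx0.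
have JJE : Jb S *m (Jb S *m E) = 0.
  apply: scalI; rewrite !scalemxAr EE scaler0 !mulmxBr !mulmxDr -!scalemxAr JJC JJL JJG.
  by rewrite scaler0 addr0 subr0.
have [Y [X [YJ XJ EYX]]] := tangent_mx wfD wfD tangentD EJ JJE.
(* G and H change by s^(j+1) times Y and X. To this order the product changes by Y L + L X, which is
   E; the remaining terms are divisible by s^(j+2) and form the new error. *)
exists (G0 + s ^+ j *: Y), (H0 + s ^+ j *: X).
exists (- (Y *m L S *m H0 + G0 *m L S *m X + s ^+ j *: (Y *m L S *m X))).
rewrite !scalerDr !scalerA -!exprS !addrA GE HE; split.
- by rewrite mulmxDl mulmxDr GJ -scalemxAl -scalemxAr YJ.
- by rewrite mulmxDl mulmxDr HJ -scalemxAl -scalemxAr XJ.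
have YLH : Y *m L S *m H = Y *m L S + s *: (Y *m L S *m H0).
  by rewrite -HE mulmxDr mulmx1 -scalemxAr.
have GLX : G *m L S *m X = L S *m X + s *: (G0 *m L S *m X).
  by rewrite -GE !mulmxDl mul1mx -!scalemxAl.
rewrite GLH EYX !mulmxDl !mulmxDr -!scalemxAl -!scalemxAr YLH GLX scalerN.
rewrite !scalerDr !scalerA -exprSr -exprD (_ : (j.+1 + j.+1 = j.+2 + j)%N) ?addSnnS //.
rewrite -exprD [(j.+2 + j)%N]addnC /L.
set x := _ *: (_ *m X); set y := _ *: (Y *m _); set b := _ *: (_ *m H0); set c := _ *: (G0 *m _ *m _).
set q := _ *: _; rewrite -[LHS](addrK (b + c + q)); congr (_ - _).
by rewrite !addrA [LHS](ACl (1*3*5*2*4*6)%AC).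
Qed.

Variables (F : fieldType) (phi : {rmorphism k -> F}).
Variable C : 'M[F]_(#|bix (@drow_size D)|, #|bix (@dcol_size D)|).

Section Conjugate.
Variables (d : dim_vector (Lambda k m n)) (f : rep_ring d).
Let e : dim_vector (Lambda k m n) := triple_dim #|bix (@dcol_size D)| #|bix (@drow_size D)|.
Hypothesis nul_L : nul f idfun (triple (k := k) (m := m) (n := n) (Ja k) (Jb k) (L k)).
Variables (g : forall z, 'M[F]_(d z, e z)) (g' : forall z, 'M[F]_(e z, d z)).
Hypotheses (g'g : forall z, g' z *m g z = 1%:M) (gg' : forall z, g z *m g' z = 1%:M).

Let conj (c : 'M[{poly F}]_(#|bix (@drow_size D)|, #|bix (@dcol_size D)|)) : rep_space {poly F} d :=
  fun a => map_mx polyC (g (arrow_head a)) *m triple (k := k) (m := m) (n := n) (Ja _) (Jb _) c a *m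
           map_mx polyC (g' (arrow_tail a)).

Lemma conj_iso c : rep_iso (triple (k := k) (m := m) (n := n) (Ja _) (Jb _) c) (conj c).
Proof.
exists (fun z => map_mx polyC (g z)), (fun z => map_mx polyC (g' z)); split=> [a|z|z].
- by rewrite /conj -[RHS]mulmxA -(map_mxM polyC) g'g map_mx1 mulmx1.
- by rewrite -(map_mxM polyC) g'g map_mx1.
- by rewrite -(map_mxM polyC) gg' map_mx1.
Qed.

Let phiX : {rmorphism k -> {poly F}} := @polyC F \o phi.

(** The determinants of G and H are 1 at X = 0, hence non-zero polynomials, so G and H become
    automorphisms of the Jordan matrices over the fraction field. *)
Lemma conj_orbit G0 H0 (G := 1%:M + 'X *: G0) (H := 1%:M + 'X *: H0) :
  G *m Jb _ = Jb _ *m G -> H *m Ja _ = Ja _ *m H ->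
  evalr phiX (conj (G *m L _ *m H)) f = 0.
Proof.
move=> GJ HJ.
have unit1 p (x : 'M[{poly F}]_p) : map_mx (@tofrac {poly F}) (1%:M + 'X *: x) \in unitmx.
  rewrite unitmxE unitfE det_map_mx tofrac_eq0; apply/eqP => det0.
  have := congr1 (horner_eval 0) det0; rewrite -det_map_mx map_mxD map_mxZ map_mx1 rmorph0.
  rewrite [X in X *: _](_ : _ = 0) ?scale0r ?addr0 ?det1; last by rewrite /= /horner_eval hornerX.
  by move=> /eqP; exact/negP/oner_neq0.
apply/eqP; rewrite -tofrac_eq0 (evalr_comp phiX (@tofrac {poly F})); apply/eqP.
pose psi : {rmorphism k -> {fraction {poly F}}} := @tofrac {poly F} \o phiX.
have := @nul_L _ psi (map_rep (@tofrac {poly F}) (conj (G *m L _ *m H))).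
apply; apply: rep_iso_trans (map_rep_iso _ (conj_iso _)).
rewrite !map_triple !map_Jord map_link !map_mxM map_link.
pose tG := map_mx (@tofrac {poly F}) G; pose tH := map_mx (@tofrac {poly F}) H.
have tGJ : tG *m Jb _ = Jb _ *m tG by rewrite -[Jb _](map_Jord (@tofrac {poly F})) -!map_mxM GJ.
have tHJ : tH *m Ja _ = Ja _ *m tH by rewrite -[Ja _](map_Jord (@tofrac {poly F})) -!map_mxM HJ.
have uG : tG \in unitmx by exact: unit1.
have uH : tH \in unitmx by exact: unit1.
apply: (@triple_iso _ _ _ _ _ _ _ _ _ _ _ _ _ _ (invmx tH) tH tG (invmx tG)) => //.
- by rewrite -[LHS]mulmx1 -(mulmxV uH) mulmxA -[_ *m _ *m tH]mulmxA -tHJ mulmxA mulVmx ?mul1mx.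
- by rewrite mulmxK.
- exact: mulmxV uH.
- exact: mulVmx uH.
- exact: mulVmx uG.
- exact: mulmxV uG.
Qed.

(** On the line from the link matrix at X = 0 to C at X = 1, the function f is a polynomial in X. By
    [curve_lift] and [conj_orbit] it is divisible by every power of X, hence zero, and X = 1 gives
    the claim. *)
Lemma conj_curve : C *m Ja F = Jb F *m C -> Jb F *m (Jb F *m C) = 0 ->
  evalr phi (fun a => g (arrow_head a) *m triple (k := k) (m := m) (n := n) (Ja F) (Jb F) C a *m
    g' (arrow_tail a)) f = 0.
Proof.
move=> CJ JJC; pose C' := map_mx polyC C - L {poly F}.
have JaX : Ja _ = map_mx (@polyC F) (Ja F) by rewrite map_Jord.
have JbX : Jb _ = map_mx (@polyC F) (Jb F) by rewrite map_Jord.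
have C'J : C' *m Ja _ = Jb _ *m C'.
  by rewrite mulmxBl mulmxBr link_commutes JaX JbX -!map_mxM CJ.
have JJC' : Jb _ *m (Jb _ *m C') = 0.
  by rewrite !mulmxBr link_annihilated JbX -!map_mxM JJC map_mx0 subr0.
have X0 : 'X != 0 :> {poly F} by rewrite polyX_eq0.
have p0 : evalr phiX (conj (L _ + 'X *: C')) f = 0.
  apply: cong_Xn_eq0 => j; have [G0 [H0 [E [GJ HJ ->]]]] := curve_lift j X0 C'J JJC'.
  rewrite -(conj_orbit GJ HJ); apply: evalr_cong; case=> x y; [exact: cong_refl | exact: cong_refl |].
  apply: (@cong_mx _ _ _ _ _ _ (map_mx polyC (g vertex_2) *m E *m map_mx polyC (g' vertex_1))).
  exact: mulmx_curve.
have := congr1 (horner_eval 1) p0; rewrite (evalr_comp phiX (horner_eval 1)) rmorph0.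
rewrite /= (_ : horner_eval 1 \o phiX = phi); last by apply/funext => x; rewrite /= /horner_eval hornerC.
have K p q (x : 'M[F]_(p, q)) : map_mx (horner_eval 1) (map_mx polyC x) = x.
  by apply/matrixP => y z; rewrite !mxE /= /horner_eval hornerC.
rewrite (_ : map_rep _ _ = fun a => g (arrow_head a) *m
    triple (k := k) (m := m) (n := n) (Ja F) (Jb F) C a *m
    g' (arrow_tail a)) //.
apply: functional_extensionality_dep => a; rewrite /map_rep !map_mxM !K; congr (_ *m _ *m _).
have := map_triple k m n (horner_eval 1) (Ja {poly F}) (Jb _) (L _ + 'X *: C').
move=> /(congr1 (fun N : rep_space F e => N a)); rewrite /map_rep => ->.
rewrite !map_Jord map_mxD map_mxZ map_mxB K map_link [X in X *: _](_ : _ = 1).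
  by rewrite scale1r addrC subrK.
by rewrite /= /horner_eval hornerX.
Qed.

End Conjugate.
End Curve.

Section TangentNul.
Local Open Scope ring_scope.

Lemma tangent_nul (k : fieldType) (m n : nat) (D : datum) (F : fieldType) (phi : {rmorphism k -> F}) C
    (d : dim_vector (Lambda k m n)) (f : rep_ring d) :
  wf_datum D -> tangent D D ->
  C *m Jord F _ = Jord F _ *m C -> Jord F _ *m (Jord F _ *m C) = 0 ->
  nul f idfun (triple (k := k) (m := m) (n := n)
    (Jord k (@dcol_size D)) (Jord k (@drow_size D)) (link_mx k D)) ->
  nul f phi (triple (k := k) (m := m) (n := n) (Jord F (@dcol_size D)) (Jord F (@drow_size D)) C).
Proof.
move=> wfD tanD CJ JJC nulD F' psi N' [g [g' [gN g'g gg']]].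
have -> : N' = fun a => g (arrow_head a) *m triple (k := k) (m := m) (n := n) (Jord F' (@dcol_size D))
    (Jord F' (@drow_size D)) (map_mx psi C) a *m g' (arrow_tail a).
  apply: functional_extensionality_dep => a; rewrite (rep_isoE gN g'g gg') map_triple.
  by rewrite !map_Jord.
apply: (@conj_curve k m n D wfD tanD F' (psi \o phi) (map_mx psi C) d f nulD g g' g'g gg').
  by rewrite -!(map_Jord psi) -!map_mxM CJ.
by rewrite -!(map_Jord psi) -!map_mxM JJC map_mx0.
Qed.

End TangentNul.

(** * Standard representations *)

Section Selection.
Local Open Scope ring_scope.
Variables (R : comNzRingType) (I I' : finType) (s : I' -> I) (a : I -> nat).

(** One kind of matrix serves both to split off the blocks of a summand and to permute blocks of
    equal sizes. *)
Definition select : 'M[R]_(#|bix (a \o s)|, #|bix a|) :=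
  blk a (a \o s) (fun i p j q => ((s i == j) && (p == q))%:R).

Lemma ent_select_mul (K : finType) (c : K -> nat) (M : 'M[R]_(#|bix a|, #|bix c|)) i p k r :
  (p < a (s i))%N -> ent (select *m M) i p k r = ent M (s i) p k r.
Proof.
move=> lt_p; rewrite ent_mul (sum_pick_fin (k := s i)) => [|j neq_j]; last first.
  by rewrite big1 // => q _; rewrite ent_blk // eq_sym (negPf neq_j) mul0r.
rewrite (@sum_pick_ord _ _ (fun q => ent select i p (s i) q * ent M (s i) q k r) p) => [|q lt_q neq_q].
  by rewrite lt_p ent_blk // !eqxx mul1r.
by rewrite ent_blk // [p == q]eq_sym (negPf neq_q) andbF mul0r.
Qed.

Lemma ent_mul_select_out (K : finType) (c : K -> nat) (M : 'M[R]_(#|bix c|, #|bix (a \o s)|)) k r j q :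
  (forall i, s i != j) -> (q < a j)%N -> ent (M *m select) k r j q = 0.
Proof.
move=> out lt_q; rewrite ent_mul big1 // => i _; rewrite big1 // => p _.
by rewrite ent_blk // (negPf (out i)) mulr0.
Qed.

Hypothesis s_inj : injective s.

Lemma ent_mul_select (K : finType) (c : K -> nat) (M : 'M[R]_(#|bix c|, #|bix (a \o s)|)) k r i q :
  (q < a (s i))%N -> ent (M *m select) k r (s i) q = ent M k r i q.
Proof.
move=> lt_q; rewrite ent_mul (sum_pick_fin (k := i)) => [|j neq_j]; last first.
  by rewrite big1 // => p _; rewrite ent_blk // (inj_eq s_inj) (negPf neq_j) mulr0.
rewrite (@sum_pick_ord _ _ (fun p => ent M k r i p * ent select i p (s i) q) q) => [|p lt_p neq_p].
  by rewrite /= lt_q ent_blk // !eqxx mulr1.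
by rewrite ent_blk // (negPf neq_p) andbF mulr0.
Qed.

Lemma select_Jord : select *m Jord R a = Jord R (a \o s) *m select.
Proof.
apply: entP => i p j q lt_p lt_q; rewrite ent_select_mul // ent_Jord // ent_Jord_mul //.
case: p lt_p => [|p] lt_p; first by rewrite andbF.
by rewrite ent_blk ?(ltnW lt_p) // eqSS.
Qed.

Lemma ent_select_tr i p j q : (p < a i)%N -> (q < a (s j))%N ->
  ent select^T i p j q = ((i == s j) && (p == q))%:R.
Proof.
move=> lt_p; rewrite -[a (s j)]/((a \o s) j) => lt_q.
by rewrite (ent_ix _ lt_p lt_q) mxE entE ent_blk // [s _ == _]eq_sym [q == p]eq_sym.
Qed.

End Selection.

Section SelectionPairs.
Local Open Scope ring_scope.
Variables (R : comNzRingType) (I : finType) (a : I -> nat).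

Lemma select_tr (I1 : finType) (s1 : I1 -> I) :
  injective s1 -> select R s1 a *m (select R s1 a)^T = 1%:M.
Proof.
move=> inj; apply: entP => i p j q lt_p lt_q; rewrite ent_select_mul // ent_select_tr //.
by rewrite (ent_ix _ lt_p lt_q) fm1E bix_eq (inj_eq inj).
Qed.

Lemma select_tr0 (I1 I2 : finType) (s1 : I1 -> I) (s2 : I2 -> I) :
  (forall i j, s1 i != s2 j) -> select R s1 a *m (select R s2 a)^T = 0.
Proof.
move=> disj; apply: entP => i p j q lt_p lt_q; rewrite ent_select_mul // ent_select_tr // ent0.
by rewrite (negPf (disj _ _)).
Qed.

End SelectionPairs.

Section SelectionSum.
Local Open Scope ring_scope.
Variables (F : fieldType) (I1 I2 : finType) (a : I1 + I2 -> nat).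

Definition split_mx := col_mx (select F inl a) (select F inr a).
Definition merge_mx := row_mx (select F inl a)^T (select F inr a)^T.

Lemma split_merge : split_mx *m merge_mx = 1%:M.
Proof.
rewrite mul_col_row !select_tr ?select_tr0 // -?scalar_mx_block //.
- by move=> x y [].
- by move=> x y [].
Qed.

Lemma merge_split : merge_mx *m split_mx = 1%:M.
Proof.
by apply: left_inverse_square split_merge; rewrite !card_bix big_sumType.
Qed.

Lemma split_Jord :
  split_mx *m Jord F a = block_mx (Jord F (a \o inl)) 0 0 (Jord F (a \o inr)) *m split_mx.
Proof. by rewrite mul_col_mx mul_block_col !mul0mx addr0 add0r !select_Jord. Qed.

End SelectionSum.

Section DatumRepresentation.
Local Open Scope ring_scope.
Variables (k : fieldType) (m n : nat).
Let A := Lambda k m n.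

Definition datum_rep (D : datum) :
    rep_space k (@triple_dim k m n #|bix (@dcol_size D)| #|bix (@drow_size D)|) :=
  triple (Jord k (@dcol_size D)) (Jord k (@drow_size D)) (link_mx k D).

Definition datum_bounded (D : datum) : Prop :=
  (forall j : dcol D, dcol_size j <= m)%N /\ (forall i : drow D, drow_size i <= n)%N.

Lemma datum_rep_is_rep D : wf_datum D -> datum_bounded D -> is_rep (datum_rep D).
Proof.
move=> wfD [Da Db]; apply/(Lambda_relations idfun (datum_rep D)); split.
- exact/Jord_pow0.
- exact/Jord_pow0.
- exact: link_commutes.
- exact: link_annihilated.
Qed.

Lemma split_link (D D' : datum) :
  split_mx k (@drow_size (dsum D D')) *m link_mx k (dsum D D') =
  block_mx (link_mx k D) 0 0 (link_mx k D') *m split_mx k (@dcol_size (dsum D D')).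
Proof.
rewrite mul_col_mx mul_block_col !mul0mx addr0 add0r; congr col_mx.
- apply: entP => i p [j|j] q lt_p lt_q; rewrite ent_select_mul //.
    transitivity (ent (link_mx k D) i p j q); first by rewrite !ent_blk.
    by apply/esym/(@ent_mul_select k _ _ inl (@dcol_size (dsum D D'))) => // x y [].
  transitivity (0 : k); first by rewrite ent_blk // big1 // => t _; exact: mul0r.
  by apply/esym/(@ent_mul_select_out k _ _ inl (@dcol_size (dsum D D'))).
- apply: entP => i p [j|j] q lt_p lt_q; rewrite ent_select_mul //.
    transitivity (0 : k); first by rewrite ent_blk // big1 // => t _; exact: mul0r.
    by apply/esym/(@ent_mul_select_out k _ _ inr (@dcol_size (dsum D D'))).
  transitivity (ent (link_mx k D') i p j q); first by rewrite !ent_blk.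
  by apply/esym/(@ent_mul_select k _ _ inr (@dcol_size (dsum D D'))) => // x y [].
Qed.

Lemma datum_rep_sum D D' :
  rep_iso (datum_rep (dsum D D')) (direct_sum (datum_rep D) (datum_rep D')).
Proof.
pose dim E : dim_vector A := @triple_dim k m n #|bix (@dcol_size E)| #|bix (@drow_size E)|.
exists (fun z => match z as z0 return 'M[k]_(dim D z0 + dim D' z0, dim (dsum D D') z0) with
  vertex_1 => split_mx k (@dcol_size (dsum D D')) | vertex_2 => split_mx k (@drow_size (dsum D D')) end).
exists (fun z => match z as z0 return 'M[k]_(dim (dsum D D') z0, dim D z0 + dim D' z0) with
  vertex_1 => merge_mx k (@dcol_size (dsum D D')) | vertex_2 => merge_mx k (@drow_size (dsum D D')) end).
split=> [[]|[]|[]]; try exact: split_merge; try exact: merge_split.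
- exact: split_Jord.
- exact: split_Jord.
- exact: split_link.
Qed.

Lemma direct_sum_zero_l (d e : dim_vector A) (M : rep_space k d) (N : rep_space k e) :
  zero_dim d -> rep_iso (direct_sum M N) N.
Proof.
move=> d0; 
have zr p z (x y : 'M[k]_(d z, p)) : x = y.
  by apply/matrixP => i; have := ltn_ord i; rewrite [X in (_ < X)%N]d0.
exists (fun z => row_mx 0 1%:M), (fun z => col_mx 0 1%:M); split=> [a|z|z].
- by rewrite mul_row_block mul_mx_row !mul0mx !mul1mx !mulmx0 mulmx1 !add0r.
- by rewrite mul_col_row !mul1mx !mul0mx [RHS]scalar_mx_block; congr block_mx; exact: zr.
- by rewrite mul_row_col mul0mx add0r mul1mx.
Qed.

Lemma direct_sum_zero_r (d e : dim_vector A) (M : rep_space k d) (N : rep_space k e) :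
  zero_dim e -> rep_iso (direct_sum M N) M.
Proof.
move=> e0.
have zr p z (x y : 'M[k]_(e z, p)) : x = y.
  by apply/matrixP => i; have := ltn_ord i; rewrite [X in (_ < X)%N]e0.
exists (fun z => row_mx 1%:M 0), (fun z => col_mx 1%:M 0); split=> [a|z|z].
- by rewrite mul_row_block mul_mx_row !mul0mx !mul1mx !mulmx0 mulmx1 !addr0.
- by rewrite mul_col_row !mul1mx !mul0mx [RHS]scalar_mx_block; congr block_mx; exact: zr.
- by rewrite mul_row_col mul0mx addr0 mul1mx.
Qed.

Section Sums.
Variables (T : eqType) (D : T -> datum).
Hypothesis wfD : forall t, wf_datum (D t).

Definition dsums (s : seq T) : datum := foldr (fun t => dsum (D t)) dnil s.

Lemma wf_dsums s : wf_datum (dsums s).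
Proof. by elim: s => [|t s IHs]; [exact: wf_nil | exact: wf_sum]. Qed.

Lemma datum_bounded_sum E E' : datum_bounded (dsum E E') -> datum_bounded E /\ datum_bounded E'.
Proof.
case=> a b; split; split=> i.
- exact: (a (inl i)).
- exact: (b (inl i)).
- exact: (a (inr i)).
- exact: (b (inr i)).
Qed.

Lemma indecomposable_summand s (d : dim_vector A) (M : rep_space k d) :
  datum_bounded (dsums s) -> indecomposable M -> rep_iso M (datum_rep (dsums s)) ->
  exists2 t, t \in s & rep_iso M (datum_rep (D t)).
Proof.
move=> + [nz_d indM]; elim: s => [_ isoM|t s IHs /datum_bounded_sum[bdt bds] isoM].
  by case: nz_d => z; rewrite (rep_iso_dim isoM); case: z; rewrite /= card_bix big1 // => -[].
have isoM' := rep_iso_trans isoM (datum_rep_sum (D t) (dsums s)).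
have [z|z] := indM _ _ _ _ (datum_rep_is_rep (wfD t) bdt) (datum_rep_is_rep (wf_dsums s) bds) isoM'.
  have [|t' st' isot'] := IHs bds; last by exists t' => //; rewrite inE st' orbT.
  exact: rep_iso_trans isoM' (direct_sum_zero_l _ _ z).
exists t; first exact: mem_head.
exact: rep_iso_trans isoM' (direct_sum_zero_r _ _ z).
Qed.

End Sums.
End DatumRepresentation.

(** * From reduced Jordan types to sums of pieces *)

Section JordanTypes.
Variables (I J : finType) (a : I -> nat) (b : J -> nat).

Lemma count_codom (K : finType) (c : K -> nat) P : count P (codom c) = \sum_j P (c j).
Proof. by rewrite -sum1_count big_map big_mkcond big_enum; apply: eq_bigr => j _; case: (P _). Qed.

Lemma perm_injection : perm_eq (codom a) (codom b) ->
  exists2 f : I -> J, injective f & forall i, b (f i) = a i.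
Proof.
move=> /(perm_iotaP 0)[s perm_s sE].
have size_s : size s = #|I| by have := congr1 size sE; rewrite size_map size_codom.
have uniq_s : uniq s by rewrite (perm_uniq perm_s) iota_uniq.
have lt_s (i : I) : nth 0 s (enum_rank i) < #|J|.
  have : nth 0 s (enum_rank i) \in s by apply: mem_nth; rewrite size_s; exact: ltn_ord.
  by rewrite (perm_mem perm_s) mem_iota size_codom add0n => /andP[].
exists (fun i => enum_val (Ordinal (lt_s i))) => [i j /enum_val_inj/(congr1 val)/= /eqP|i].
  by rewrite nth_uniq ?size_s // => /eqP /val_inj /enum_rank_inj.
have -> : a i = nth 0 (codom a) (enum_rank i) by rewrite codomE (nth_map i) ?nth_enum_rank // -cardE.
rewrite sE (nth_map 0) ?size_s // codomE (nth_map (enum_val (Ordinal (lt_s i)))) -?cardE //.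
by congr b; rewrite {1}(enum_val_nth (enum_val (Ordinal (lt_s i)))).
Qed.

Lemma perm_sim_Jord (F : fieldType) : perm_eq (codom a) (codom b) -> sim (Jord F a) (Jord F b).
Proof.
move=> perm_ab; have [f f_inj bf] := perm_injection perm_ab.
have -> : a = b \o f by apply/funext => i; rewrite /= bf.
apply: sim_sym; exists (select F f b), (select F f b)^T%R.
split; [exact: select_Jord | | exact: select_tr].
apply: left_inverse_square; last exact: select_tr.
rewrite !card_bix.
have sumE (K : finType) (c : K -> nat) : \sum_j c j = sumn (codom c).
  by rewrite sumnE big_map big_enum.
rewrite !sumE; apply: perm_sumn; rewrite perm_sym.
by rewrite (_ : b \o f = a) //; apply/funext => i; rewrite /= bf.
Qed.

End JordanTypes.

(** Class 3 has size [maxn m 3] rather than m so that sizes grow with the class even if m < 3; in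
    that case the bound m on the blocks excludes the classes 2 and 3. *)
Definition class_size (m a0 c : nat) : nat :=
  match c with 0 => 1 | 1 => 2 | 2 => a0 | _ => maxn m 3 end.

Lemma size_fun_class m a0 : 2 < a0 <= maxn m 3 -> size_fun (class_size m a0).
Proof. by move=> a0P; split=> // -[|[|[|c]]] [|[|[|c']]] //=; lia. Qed.

Lemma reduced_classes m (I : finType) (a : I -> nat) : bounded m a -> reduced m a ->
  exists (a0 : nat) (c : I -> nat), [/\ 2 < a0 <= maxn m 3, forall i, c i < 4,
    forall i, a i = class_size m a0 (c i) & \sum_i (c i == 2) <= 1].
Proof.
move=> bd red.
have [/existsP[i0 /andP[a3 lt_m]]|none] := boolP [exists i, (2 < a i) && (a i < m)].
  pose c i := if i == i0 then 2 else if 2 < a i then 3 else (a i).-1.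
  exists (a i0), c; split=> [|i|i|].
  - by rewrite a3 (leq_trans (ltnW lt_m)) // leq_maxl.
  - by rewrite /c; case: eqP => // _; case: ltnP => //; case: (a i) => [|[|[]]].
  - rewrite /c; case: eqVneq => [->//|neq_i]; case: ltnP => [ai|].
      have := bd i; have [le_i|lt_i] := leqP (a i) (a i0); last first.
        by have := red i0 i; rewrite eq_sym neq_i a3 (ltnW lt_i) /= => /(_ isT isT isT); lia.
      by have := red i i0 neq_i ai le_i; lia.
    by have := bd i; case: (a i) => [|[|[|]]].
  - rewrite (bigD1 i0) //= {1}/c eqxx big1 // => i /negPf neq_i.
    by rewrite /c neq_i; case: ltnP => //; case: (a i) => [|[|[|]]].
(* Without an intermediate size no block receives class 2, and 3 is a legitimate size for that
   class. *)
exists 3, (fun i => if 2 < a i then 3 else (a i).-1); split=> [|i|i|].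
- by rewrite leq_maxr.
- by case: ltnP => //; case: (a i) => [|[|[]]].
- have := bd i; case: (ltnP 2 (a i)) => [a3|]; last by case: (a i) => [|[|[|]]].
  move: none; rewrite negb_exists => /forallP/(_ i); rewrite a3 /= -leqNgt => le_m; lia.
- by rewrite big1 // => i _; case: ltnP => //; case: (a i) => [|[|[|]]].
Qed.

Section PieceSums.
Variables sa sb : nat -> nat.
Hypotheses (sa_fun : size_fun sa) (sb_fun : size_fun sb).

Definition pieces_datum (L : seq nat) : datum := dsums (fun i => piece_datum sa sb (pc i)) L.

Lemma sum_nth (P : pred nat) (s : nat -> nat) (l : seq nat) :
  \sum_(j < size l) P (s (nth 0 l j)) = count P (map s l).
Proof.
rewrite -sum1_count big_map [RHS]big_mkcond [RHS](big_nth 0) [RHS]big_mkord.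
by apply: eq_bigr => j _; case: (P _).
Qed.

Lemma count_dcol P L : count P (codom (@dcol_size (pieces_datum L))) = count P (map sa (all_cols L)).
Proof.
rewrite count_codom; elim: L => [|i L IHL]; first by rewrite big1 // => -[].
rewrite [LHS]big_sumType /= [all_cols _]/= map_cat count_cat -IHL; congr (_ + _).
exact: sum_nth.
Qed.

Lemma count_drow P L : count P (codom (@drow_size (pieces_datum L))) = count P (map sb (all_rows L)).
Proof.
rewrite count_codom; elim: L => [|i L IHL]; first by rewrite big1 // => -[].
rewrite [LHS]big_sumType /= [all_rows _]/= map_cat count_cat -IHL; congr (_ + _).
exact: sum_nth.
Qed.

Lemma perm_dcol L : perm_eq (codom (@dcol_size (pieces_datum L))) (map sa (all_cols L)).
Proof. by apply/permP => P; exact: count_dcol. Qed.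

Lemma perm_drow L : perm_eq (codom (@drow_size (pieces_datum L))) (map sb (all_rows L)).
Proof. by apply/permP => P; exact: count_drow. Qed.

Lemma links_wf : all (fun p : piece => all (fun l : cell =>
  l.2 || (0 < nth 0 (rows p) l.1.1) && (0 < nth 0 (cols p) l.1.2)) (links p)) pieces.
Proof. by vm_compute. Qed.

Lemma wf_piece i : wf_datum (piece_datum sa sb (pc i)).
Proof.
split=> [j|j|r j]; rewrite /= ?size_fun_gt0 //.
rewrite !size_fun_gt1 // => small; apply/count_memPn; apply: contra small => lrj.
have [lt_i|ge_i] := ltnP i (size pieces); last first.
  have links0 : links (pc i) = [::] by rewrite /pc nth_default.
  by move: lrj; rewrite links0.
have /allP/(_ _ lrj) /= := allP links_wf _ (mem_nth ([::], [::], [::]) lt_i).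
by rewrite andbC.
Qed.

Lemma tangent_pieces L : all (mem candidates) L -> {in L &, forall i j, orth i j} ->
  tangent (pieces_datum L) (pieces_datum L).
Proof.
move=> candL orthL.
suff tan L1 L2 : {subset L1 <= L} -> {subset L2 <= L} ->
  tangent (pieces_datum L1) (pieces_datum L2) by exact: tan.
elim: L1 => [_ _|i L1 IHL1 sub1 sub2]; first exact: tangent_nil_l.
have Li : i \in L by apply: sub1; rewrite mem_head.
apply: tangent_sum_l; last by apply: IHL1 => // j Lj; apply: sub1; rewrite inE Lj orbT.
elim: L2 {IHL1} sub2 => [_|j L2 IHL2 sub2]; first exact: tangent_nil_r.
have Lj : j \in L by apply: sub2; rewrite mem_head.
apply: tangent_sum_r; last by apply: IHL2 => l Ll; apply: sub2; rewrite inE Ll orbT.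
move=> R h; apply: orthogonal_tangent_span => //.
have /allP/(_ j (allP candL j Lj)) := allP orth_tableP i (allP candL i Li).
by rewrite orthL.
Qed.

End PieceSums.

Section Matching.
Variables (m n : nat) (I J : finType) (a : I -> nat) (b : J -> nat).

Lemma generic_datum : bounded m a -> bounded n b -> reduced m a -> reduced n b ->
  exists a0 b0 L, [/\ 2 < a0 <= maxn m 3, 2 < b0 <= maxn n 3, all (mem candidates) L &
    let D := pieces_datum (class_size m a0) (class_size n b0) L in
    [/\ tangent D D, perm_eq (codom a) (codom (@dcol_size D)) & perm_eq (codom b) (codom (@drow_size D))]].
Proof.
move=> bda bdb reda redb.
have [a0 [c [a0P c4 aE c2]]] := reduced_classes bda reda.
have [b0 [e [b0P e4 bE e2]]] := reduced_classes bdb redb.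
(* The descent starts with C = 0: every Jordan block is a piece of its own, found at its position
   among the first eight. *)
pose L0 := [seq 7 - c i | i <- enum I] ++ [seq 3 - e j | j <- enum J].
have rowP i : i \in iota 0 4 -> (cols (pc (3 - i)) == [::]) && (rows (pc (3 - i)) == [:: i]).
  by move: i; apply/allP.
have colP i : i \in iota 0 4 -> (cols (pc (7 - i)) == [:: i]) && (rows (pc (7 - i)) == [::]).
  by move: i; apply/allP.
have rowE j : cols (pc (3 - e j)) = [::] /\ rows (pc (3 - e j)) = [:: e j].
  by have /rowP/andP[/eqP-> /eqP->] : e j \in iota 0 4 by rewrite mem_iota e4.
have colE i : cols (pc (7 - c i)) = [:: c i] /\ rows (pc (7 - c i)) = [::].
  by have /colP/andP[/eqP-> /eqP->] : c i \in iota 0 4 by rewrite mem_iota c4.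
have cols0 : all_cols L0 = codom c.
  rewrite all_cols_cat /all_cols /codom /image_mem; elim: (enum I) => [|i l IHl] /=.
    by elim: (enum J) => //= j l; case: (rowE j) => ->.
  by rewrite (colE i).1 /= IHl.
have rows0 : all_rows L0 = codom e.
  rewrite all_rows_cat /all_rows /codom /image_mem; elim: (enum I) => [|i l IHl] /=.
    by elim: (enum J) => //= j l; case: (rowE j) => _ -> /= ->.
  by rewrite (colE i).2 /= IHl.
have candL0 : all (mem candidates) L0.
  rewrite all_cat; apply/andP; split; apply/allP => _ /mapP[x _ ->]; rewrite inE candidateP.
    exact: leq_ltn_trans (leq_subr _ _) _.
  exact: leq_ltn_trans (leq_subr _ _) _.
have [|L [candL permc permr orthL]] := generic_pieces candL0.
  rewrite /admissible cols0 rows0; apply/andP; split; rewrite count_codom.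
    exact: c2.
  exact: e2.
have aC : codom a = map (class_size m a0) (codom c).
  by rewrite /codom /image_mem -map_comp; apply: eq_map => i; rewrite /= aE.
have bC : codom b = map (class_size n b0) (codom e).
  by rewrite /codom /image_mem -map_comp; apply: eq_map => i; rewrite /= bE.
exists a0, b0, L; split=> //=; split.
- exact: tangent_pieces (size_fun_class a0P) (size_fun_class b0P) _ candL orthL.
- rewrite aC perm_sym (perm_trans (perm_dcol _ _ _)) // (perm_trans (perm_map _ permc)) //.
  by rewrite cols0.
- rewrite bC perm_sym (perm_trans (perm_drow _ _ _)) // (perm_trans (perm_map _ permr)) //.
  by rewrite rows0.
Qed.

End Matching.

Section GeneralRepresentations.
Local Open Scope ring_scope.
Variables (k : fieldType) (m n : nat).
Let A := Lambda k m n.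

Definition standard (d : dim_vector A) (M : rep_space k d) : Prop :=
  exists a0 b0 L, let D := pieces_datum (class_size m a0) (class_size n b0) L in
    [/\ (2 < a0 <= maxn m 3)%N, (2 < b0 <= maxn n 3)%N, all (mem candidates) L,
        datum_bounded m n D & rep_iso M (@datum_rep k m n D)].

Lemma bounded_codom (I J : finType) (a : I -> nat) (b : J -> nat) p :
  perm_eq (codom a) (codom b) -> bounded p a -> forall j, (b j <= p)%N.
Proof.
move=> perm_ab bd j; have : b j \in codom a by rewrite (perm_mem perm_ab) codom_f.
by case/codomP => i ->; case/andP: (bd i).
Qed.

(** The property [nul] travels back from the links to an arbitrary C with the same Jordan matrices,
    then through the transfers to the Jordan types of N itself. *)
Lemma standard_degeneration (F : fieldType) (phi : {rmorphism k -> F}) (d : dim_vector A)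
    (N : rep_space F d) :
  (forall r, relations (b := A) r -> relation_eval phi N r = 0) ->
  exists M : rep_space k d, [/\ is_rep M, standard M & forall f, vanishes M f -> evalr phi N f = 0].
Proof.
move=> /Lambda_relations relN; case: (relN) => am bn _ _.
have [I [a [bda sim_a]]] := Jordan_form am; have [J [b [bdb sim_b]]] := Jordan_form bn.
have [c [rel_c iso_c]] := commuting_triple_iso k sim_a sim_b relN.
have [F' [phi' [a' [b' [c' [[bda' bdb' reda redb] carda cardb rel_c' nul_c']]]]]] :=
  reduction phi (ltnSn _) bda bdb rel_c.
have [a0 [b0 [L [a0P b0P candL [tanD perm_a perm_b]]]]] := generic_datum bda' bdb' reda redb.
set D := pieces_datum _ _ L in tanD perm_a perm_b.
have wfD : wf_datum D := wf_dsums (wf_piece (size_fun_class a0P) (size_fun_class b0P)) L.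
have bdD : datum_bounded m n D by split; [exact: bounded_codom perm_a _ | exact: bounded_codom perm_b _].
have sim_a' := perm_sim_Jord F' perm_a; have sim_b' := perm_sim_Jord F' perm_b.
have [C [[_ _ CJ JJC] iso_C]] := commuting_triple_iso k sim_a' sim_b' rel_c'.
have dimE : d = @triple_dim k m n #|bix (@dcol_size D)| #|bix (@drow_size D)|.
  apply/funext => z; rewrite (rep_iso_dim (rep_iso_trans (rep_triple N) iso_c)).
  by have := rep_iso_dim iso_C z; case: z => /= <-.
have degen f : nul f idfun (@datum_rep k m n D) -> nul f phi N.
  move=> nulD; apply: nul_iso (rep_iso_trans (rep_triple N) iso_c) _; apply: nul_c'.
  by apply: nul_iso iso_C _; exact: tangent_nul.
(* The equality of dimension vectors is only propositional, so N and the facts about it are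
   generalised before [d] is replaced. *)
move: N relN am bn sim_a sim_b iso_c degen; rewrite dimE => N *.
exists (@datum_rep k m n D); split.
- exact: datum_rep_is_rep.
- by exists a0, b0, L; split=> //; exact: rep_iso_refl.
- by move=> f /nul_vanishes vf; apply: nul_evalr; auto.
Qed.

Lemma discrete_Lambda : discrete_general_type A.
Proof.
move=> d Z compZ.
have [F phi N relN|M [repM _ denseM]] := @component_orbit k A d (@standard d) _ Z compZ; last by exists M.
exact: standard_degeneration.
Qed.

(** Finiteness arises here: besides the index of the piece only the two intermediate sizes vary, and
    both are bounded in terms of m and n. *)
Lemma general_piece (d : dim_vector A) (M : rep_space k d) : indecomposable M -> general_rep M ->
  exists (i : 'I_(size pieces)) (a0 : 'I_(maxn m 3).+1) (b0 : 'I_(maxn n 3).+1),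
    rep_iso M (@datum_rep k m n (piece_datum (class_size m a0) (class_size n b0) (pc i))).
Proof.
move=> indM [repM [Z [compZ denseM]]].
have [F phi N relN|M' [repM' stM' denseM']] := @component_orbit k A d (@standard d) _ Z compZ.
  exact: standard_degeneration.
have vanE f : vanishes M f <-> vanishes M' f.
  by split; [exact: dense_vanishes denseM denseM' | exact: dense_vanishes denseM' denseM].
have isoM := same_vanishing_iso repM indM vanE.
case: stM' => a0 [b0 [L [a0P b0P candL bdD isoM']]].
have wfD := wf_piece (size_fun_class a0P) (size_fun_class b0P).
have [i Li isoi] := indecomposable_summand wfD bdD indM (rep_iso_trans isoM isoM').
have lt_i : (i < size pieces)%N by rewrite -candidateP; exact: (allP candL).
have lt_a : (a0 < (maxn m 3).+1)%N by case/andP: a0P.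
have lt_b : (b0 < (maxn n 3).+1)%N by case/andP: b0P.
by exists (Ordinal lt_i), (Ordinal lt_a), (Ordinal lt_b).
Qed.

End GeneralRepresentations.

Theorem theorem1p2 (k : fieldType) (m n : nat) (hm : 1 <= m) (hn : 1 <= n) :
  finite_general_type (Lambda k m n).
Proof.
split; first exact: discrete_Lambda.
pose T : finType := ('I_(size pieces) * 'I_(maxn m 3).+1 * 'I_(maxn n 3).+1)%type.
pose rep (t : T) : {d : dim_vector (Lambda k m n) & rep_space k d} := existT _ _
  (@datum_rep k m n (piece_datum (class_size m t.1.2) (class_size n t.2) (pc t.1.1))).
exists #|T|, (fun i => rep (enum_val i)) => d M indM genM.
have [i [a0 [b0 isoM]]] := general_piece indM genM.
by exists (enum_rank ((i, a0, b0) : T)); rewrite enum_rankK.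
Qed.
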